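(* There is an isomorphism of graded Lie $\mathbb Q$-algebras $$\operatorname{Der}_+^\zeta\big(F\ltimes\operatorname{Lie}(\mathbb A^{\mathbb Q})\big)\simeq\mathcal D(\mathbb A^{\mathbb Q},\mathbb Q[F]),$$ where the Lie bracket of two trees $D,E\in\mathcal D(\mathbb A^{\mathbb Q},\mathbb Q[F])$ is $$[D,E]=\sum_{v,w}D\overset{v,w}{\vee}E-\sum_{b,w}D\overset{b,w}{\bot}E+\sum_{v,c}E\overset{c,v}{\bot}D,$$ $v$ (resp. $w$) running over all leaves of $D$ (resp. $E$) and $b$ (resp. $c$) over all beads of $D$ (resp. $E$); here the ''branching leaves-to-leaves'' operation $\vee$ is defined using the intersection operation $\Psi$, and the ''grafting leaves-to-beads'' operation $\bot$ is defined using the intersection operation $\Theta$.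
   Context: Setting: $V$ is an oriented handlebody of genus $g\ge1$, $D_0\subset\partial V$ a closed disk, $\Sigma:=\partial V\setminus\operatorname{int}(D_0)$, $\star\in\partial\Sigma$, $\pi:=\pi_1(\Sigma,\star)$, $F:=\pi_1(V,\star)$, $\varpi:\pi\to F$ induced by inclusion, $\mathsf A:=\ker\varpi$, $\mathbb A:=\mathsf A/[\mathsf A,\mathsf A]$ (a $\mathbb Z[F]$-module by conjugation, ${}^{\varpi(x)}[a]=[xax^{-1}]$), $\mathbb A^{\mathbb Q}:=\mathbb A\otimes\mathbb Q$, $\zeta\in\mathsf A$ the class of $\partial\Sigma$. Fix a basis $(\alpha_1,\dots,\alpha_g,\beta_1,\dots,\beta_g)$ of $\pi$ given by a system of meridians $\alpha_i$ and parallels $\beta_i$: $\mathsf A$ is normally generated by the $\alpha_i$, $x_i:=\varpi(\beta_i)$ form a basis of $F$, $a_i:=[\alpha_i]$ form a $\mathbb Z[F]$-basis of $\mathbb A$, and $\zeta^{-1}=\prod_{i=1}^g[\beta_i^{-1},\alpha_i]$ with $[x,y]=xyx^{-1}y^{-1}$, so $[\zeta]=\sum_i(1-x_i^{-1})\cdot a_i\in\mathbb A$. The free Lie algebra $\operatorname{Lie}(\mathbb A^{\mathbb Q})$ carries the induced $F$-action. Special derivations: for $m\ge1$, a derivation of degree $m$ of $F\ltimes\operatorname{Lie}(\mathbb A^{\mathbb Q})$ is a pair $d=(d_0,d_+)$ where $d_+$ is a degree $m$ derivation of the graded Lie algebra $\operatorname{Lie}(\mathbb A^{\mathbb Q})$,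 $d_0:F\to\operatorname{Lie}_m(\mathbb A^{\mathbb Q})$ is a 1-cocycle, and $d_+({}^fb)={}^f(d_+(b))+[d_0(f),{}^fb]$ for $f\in F$, $b\in\operatorname{Lie}(\mathbb A^{\mathbb Q})$. It is special if $d_+([\zeta])=0$. The bracket is $[d,e]_+=d_+e_+-e_+d_+$, $[d,e]_0(f)=d_+(e_0(f))-e_+(d_0(f))-[d_0(f),e_0(f)]$. Special derivations of degrees $\ge1$ form the graded Lie algebra $\operatorname{Der}_+^\zeta(F\ltimes\operatorname{Lie}(\mathbb A^{\mathbb Q}))$. Notation: bar is the antipode of a group algebra; Sweedler notation $x'\otimes x''$ for coproducts; $\varepsilon$ the augmentation; $z=z^\ell\otimes z^r$ for elements of tensor products, and e.g. $z^{\ell'}\otimes z^{\ell''}$ the coproduct of $z^\ell$. Intersection operations: $\langle-,-\rangle:\mathbb Z[F]\times\mathbb A\to\mathbb Z[F]$ is the map induced by the homotopy intersection form of $\Sigma$; it is the unique $\mathbb Z$-bilinear map with $\langle xy,a\rangle=x\langle y,a\rangle+\langle x,a\rangle\varepsilon(y)$, $\langle x,{}^fa\rangle=\langle x,a\rangle f^{-1}$ ($f\in F$), $\langle x_i,a_j\rangle=-\delta_{ij}$. Then $\Theta:\mathbb Z[F]\times\mathbb A\to\mathbb Z[F]\otimes\mathbb Z[F]$ is $\Theta(x,a)=\overline{\langle x'',a\rangle'}\,x'\otimes\langle x'',a\rangle''$. The map $\Psi:\mathbb A\times\mathbb A\to\mathbb Z[F]\otimes\mathbb A$ is the unique $\mathbb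 Z$-bilinear map with $\Psi(a_i,a_j)=\delta_{ij}\otimes a_i$ and, for $x,y\in F$, $a,b\in\mathbb A$: $\Psi({}^xa,b)=x\Psi(a,b)^\ell\otimes\Psi(a,b)^r-\Theta(x,b)^r\otimes{}^{\Theta(x,b)^\ell}a$ and $\Psi(a,{}^yb)=\Psi(a,b)^\ell y^{-1}\otimes{}^y(\Psi(a,b)^r)-\overline{\langle y,a\rangle}\otimes{}^yb$. The same symbols denote the rational extensions. Trees with beads: let $H$ be a cocommutative Hopf $\mathbb Q$-algebra and $W$ a left $H$-module (here $H=\mathbb Q[F]$, $W=\mathbb A^{\mathbb Q}$). A tree is a finite simply connected graph with only univalent vertices (leaves) and trivalent vertices (nodes); it is oriented if every edge is oriented and every node has a cyclic order of its three incident edges. It is ''on $W$ with $H$-beads'' if its leaves are colored by $W$ and its edges carry finitely many (possibly zero) beads colored by $H$. Its degree is $1+$ the number of nodes. $\mathcal D(W,H)$ is the $\mathbb Q$-vector space generated by such trees modulo: AS (reversing the cyclic order at a node changes the sign); IHX (for an internal edge $e$ without beads: if $T_{A,B,C}$ is a tree with $e$ joining a node with cyclic order $(r,e,C)$ to a node with cyclic order $(e,A,B)$, then $T_{A,B,C}+T_{B,C,A}+T_{C,A,B}=0$); multilinearity in the colors of leaves and beads; Hopf relations (a bead colored $1$ may be erased; consecutive beads $x$ then $y$ along an edge, following its orientation, merge into one bead $xy$; reversing the orientation of an edge carrying a bead $x$ changes it to $\bar x$; a bead $x$ on an edge oriented towards a node may be replaced by beads $x'$ and $x''$ on the two other edges,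 oriented away from the node); bead-out (a bead $x$ on an edge oriented towards its end leaf colored $v$ may be removed while recoloring the leaf by ${}^xv$). It is graded by degree. Branching: for leaves $v$ of $D$, $w$ of $E$, $D\overset{v,w}{\vee}E$ is obtained by gluing the ends $v$ and $w$ of $D$ and $E$ to a new node, whose third edge ends at a new leaf colored by $\Psi(v,w)^r$, adding a bead $\Psi(v,w)^\ell$ on the edge coming from $D$, oriented from $D$ to the new node; the cyclic order at the new node is (edge to the new leaf, edge from $E$, edge from $D$). (Here $v,w$ also denote the colors.) Grafting: for a bead $b$ of $D$ and a leaf $w$ of $E$, $D\overset{b,w}{\bot}E$ is obtained by replacing the bead $b$ by a new node to which the end $w$ of $E$ is glued, with a bead $\Theta(b,w)^r$ on the incoming part of the edge of $D$ (before the node, following the orientation of that edge) and a bead $\Theta(b,w)^\ell$ on the outgoing part; the cyclic order at the new node is (incoming part, outgoing part, edge from $E$). Equivalently: a bead $b''$ on the outgoing part and a bead $\overline{\langle b',w\rangle}$ on the edge from $E$ oriented from $E$ to the node. *)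

(* Defs.v *)
From HB Require Import structures.
From mathcomp Require Import all_boot all_order all_algebra finmap.
From mathcomp Require Import boolp classical_sets functions cardinality fsbigop.
From mathcomp Require Import generic_quotient.

Set Implicit Arguments.
Unset Strict Implicit.
Unset Printing Implicit Defensive.

Import GRing.Theory.

Local Open Scope classical_set_scope.
Local Open Scope ring_scope.
Local Open Scope quotient_scope.

Inductive span (V : lmodType rat) (S : set V) : set V :=
| span0 : span S 0
| spanP c u v : S u -> span S v -> span S (c *: u + v).

Section Span.
Context (V : lmodType rat) (S : set V).

Lemma spanD u v : span S u -> span S v -> span S (u + v).
Proof.
by move=> + sv; elim=> [|c x y Sx _ ih]; rewrite ?add0r// -addrA; apply: spanP.
Qed.

Lemma spanZ c u : span S u -> span S (c *: u).
Proof.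
elim=> [|k x y Sx _ ih]; first by rewrite scaler0; apply: span0.
by rewrite scalerDr scalerA; apply: spanP.
Qed.

Lemma span_gen u : S u -> span S u.
Proof. by move=> Su; rewrite -[u]addr0 -[u]scale1r; apply/spanP/span0. Qed.

Definition in_span : {pred V} := fun u => `[< span S u >].

Fact in_span_submod_closed : subsemimod_closed in_span.
Proof.
split; first split.
- by apply/asboolP; apply: span0.
- by move=> u v /asboolP su /asboolP sv; apply/asboolP; apply: spanD.
- by move=> c u /asboolP su; apply/asboolP; apply: spanZ.
Qed.

HB.instance Definition _ :=
  GRing.isSubmodClosed.Build rat V in_span in_span_submod_closed.

Definition spanned : Type := {u : V | in_span u}.
HB.instance Definition _ := SubChoice.on spanned.
HB.instance Definition _ := [SubChoice_isSubLmodule of spanned by <:].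

Definition span_eq : rel V := fun u v => in_span (u - v).

Fact span_eq_refl : reflexive span_eq.
Proof. by move=> u; rewrite /span_eq subrr; exact: (rpred0 in_span). Qed.

Fact span_eq_sym : symmetric span_eq.
Proof. by move=> u v; rewrite /span_eq -opprB; exact: (rpredN in_span). Qed.

Fact span_eq_trans : transitive span_eq.
Proof.
move=> v u w uv vw; rewrite /span_eq -(subrKA v); exact: (rpredD uv vw).
Qed.

Canonical span_equiv := EquivRel span_eq span_eq_refl span_eq_sym span_eq_trans.

Definition quotmod : Type := {eq_quot span_eq}.
HB.instance Definition _ := Choice.on quotmod.

Definition cls (u : V) : quotmod := \pi_({eq_quot span_eq}) u.
Definition rep (x : quotmod) : V := repr (x : {eq_quot span_eq}).

Lemma repK x : cls (rep x) = x.
Proof. exact: reprK. Qed.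

Lemma clsP u v : cls u = cls v <-> span S (u - v).
Proof. by split=> [/eqmodP/asboolP|sp]; last by apply/eqmodP/asboolP. Qed.

Lemma span_rep u : span S (rep (cls u) - u).
Proof. by apply/clsP; rewrite repK. Qed.

Let qadd (x y : quotmod) := cls (rep x + rep y).
Let qopp (x : quotmod) := cls (- rep x).
Let qscale (c : rat) (x : quotmod) := cls (c *: rep x).

Let qaddE u v : qadd (cls u) (cls v) = cls (u + v).
Proof.
apply/clsP; rewrite opprD addrACA; apply: spanD; exact: span_rep.
Qed.
Let qoppE u : qopp (cls u) = cls (- u).
Proof.
by apply/clsP; have := spanZ (-1) (span_rep u); rewrite scaleN1r opprD.
Qed.
Let qscaleE c u : qscale c (cls u) = cls (c *: u).
Proof. by apply/clsP; rewrite -scalerBr; apply: spanZ; exact: span_rep. Qed.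

Let qaddA : associative qadd.
Proof.
by move=> x y z; rewrite -(repK x) -(repK y) -(repK z) !qaddE addrA.
Qed.
Let qaddC : commutative qadd.
Proof. by move=> x y; rewrite -(repK x) -(repK y) !qaddE addrC. Qed.
Let qadd0 : left_id (cls 0) qadd.
Proof. by move=> x; rewrite -(repK x) !qaddE add0r. Qed.
Let qaddN : left_inverse (cls 0) qopp qadd.
Proof. by move=> x; rewrite -(repK x) qoppE qaddE addNr. Qed.

HB.instance Definition _ :=
  GRing.isZmodule.Build quotmod qaddA qaddC qadd0 qaddN.

Let qscaleA a b x : qscale a (qscale b x) = qscale (a * b) x.
Proof. by rewrite -(repK x) !qscaleE scalerA. Qed.
Let qscale1 : left_id 1 qscale.
Proof. by move=> x; rewrite -(repK x) !qscaleE scale1r. Qed.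
Let qscaleDr : right_distributive qscale +%R.
Proof.
move=> c x y; change (qscale c (qadd x y) = qadd (qscale c x) (qscale c y)).
by rewrite -(repK x) -(repK y) qaddE !qscaleE qaddE scalerDr.
Qed.
Let qscaleDl x : {morph qscale^~ x : a b / a + b}.
Proof. move=> a b; change (qscale (a + b) x = qadd (qscale a x) (qscale b x)).
by rewrite -(repK x) !qscaleE qaddE scalerDl. Qed.

HB.instance Definition _ := GRing.Zmodule_isLmodule.Build rat quotmod
  qscaleA qscale1 qscaleDr qscaleDl.

Fact cls_is_linear : linear cls.
Proof. move=> c u v; change (cls (c *: u + v) = qadd (qscale c (cls u)) (cls v)).
by rewrite qscaleE qaddE. Qed.
HB.instance Definition _ := GRing.isLinear.Build rat V quotmod _ cls cls_is_linear.

End Span.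

Section FinSupp.
Context (X : choiceType) (V : lmodType rat).

Definition fin_supp : {pred X -> V} :=
  fun f => `[< finite_set [set x | f x != 0] >].

Fact fin_supp_submod_closed : subsemimod_closed fin_supp.
Proof.
split; first split.
- apply/asboolP; rewrite (_ : [set _ | _] = set0); first exact: finite_set0.
  by apply/seteqP; split=> x //= /eqP.
- move=> f h /asboolP ff /asboolP fh; apply/asboolP.
  apply: (@sub_finite_set _ _ ([set x | f x != 0] `|` [set x | h x != 0])).
    move=> x /=; case: (eqVneq (f x) 0) => [fx0|]; last by left.
    case: (eqVneq (h x) 0) => [hx0|]; last by right.
    by move=> /eqP; case; rewrite -[RHS](addr0 0) -{1}fx0 -hx0.
  by rewrite finite_setU.
- move=> c f /asboolP ff; apply/asboolP; apply: sub_finite_set ff => x /=.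
  by apply: contra_neq => fx0; rewrite -(scaler0 V c) -fx0.
Qed.

HB.instance Definition _ :=
  GRing.isSubmodClosed.Build rat (X -> V) fin_supp fin_supp_submod_closed.

(* Finitely supported functions X -> V, that is, Q[X] (x) V. *)
Record fmod : Type := FMod { coef :> X -> V; _ : fin_supp coef }.

HB.instance Definition _ := [isSub for coef].
HB.instance Definition _ := [Choice of fmod by <:].
HB.instance Definition _ := [SubChoice_isSubLmodule of fmod by <:].

Fact delta_supp x v : fin_supp (fun y => if y == x then v else 0).
Proof.
apply/asboolP; apply: (@sub_finite_set _ _ [set x]); last exact: finite_set1.
by move=> y; rewrite /mkset; case: (y =P x) => [->|_ /eqP].
Qed.

(* x (x) v *)
Definition delta x v : fmod := FMod (delta_supp x v).

Lemma fmodP (u v : fmod) : (forall x, u x = v x) -> u = v.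
Proof. by move=> uv; apply/val_inj/funext. Qed.

Lemma coef0 x : (0 : fmod) x = 0. Proof. by []. Qed.
Lemma coefD (u v : fmod) x : (u + v) x = u x + v x. Proof. by []. Qed.
Lemma coefZ c (u : fmod) x : (c *: u) x = c *: u x. Proof. by []. Qed.

Lemma delta_linear x : linear (delta x).
Proof.
move=> c v w; apply: fmodP => y; rewrite coefD coefZ /=.
by case: eqP => // _; rewrite scaler0 addr0.
Qed.

Lemma fin_suppP (u : fmod) :
  exists2 r : seq X, uniq r & forall x, u x != 0 -> x \in r.
Proof.
have /asboolP/finite_fsetP[r ur] := valP u; exists r; first exact: fset_uniq.
by move=> x ux; have : [set` r] x by rewrite -ur.
Qed.

End FinSupp.

(* The free Q-module with basis X. *)
Notation freemod X := (fmod X rat^o).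
Notation basis x := (@delta _ rat^o x 1).

(* The linear map with prescribed values on the basis. *)
Definition linext (X : choiceType) (V : lmodType rat) (h : X -> V)
  (u : freemod X) : V := \sum_(x \in [set: X]) u x *: h x.

Lemma linext_seq (X : choiceType) (V : lmodType rat) (h : X -> V)
    (u : freemod X) (r : seq X) : uniq r -> (forall x, u x != 0 -> x \in r) ->
  linext h u = \sum_(x <- r) u x *: h x.
Proof.
move=> ur sr; rewrite /linext (fsbigE r)//.
  by apply: eq_bigl => x; rewrite in_setT.
by move=> x _; apply: contraNeq => uh; apply: sr; apply: contraNneq uh => ->;
  rewrite scale0r.
Qed.

Fact linext_is_linear (X : choiceType) (V : lmodType rat) (h : X -> V) :
  linear (linext h).
Proof.
move=> c u v.
have [r _ ru] := fin_suppP u; have [s _ sv] := fin_suppP v.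
have cov (w : freemod X) : (forall x, w x != 0 -> (u x != 0) || (v x != 0)) ->
    linext h w = \sum_(x <- undup (r ++ s)) w x *: h x.
  move=> wuv; apply: linext_seq => [|x /wuv /orP[/ru xr|/sv xs]].
  - exact: undup_uniq.
  - by rewrite mem_undup mem_cat xr.
  - by rewrite mem_undup mem_cat xs orbT.
rewrite !cov => [|x ->|x ->|x]; rewrite ?orbT//.
  rewrite scaler_sumr -big_split/=; apply: eq_bigr => x _.
  by rewrite scalerDl scalerA.
apply: contra_neqT; rewrite negb_or !negbK coefD coefZ => /andP[/eqP-> /eqP->].
by rewrite scaler0 addr0.
Qed.

HB.instance Definition _ (X : choiceType) (V : lmodType rat) (h : X -> V) :=
  GRing.isLinear.Build rat (freemod X) V _ (linext h) (linext_is_linear h).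

Lemma linextU (X : choiceType) (V : lmodType rat) (h : X -> V) x :
  linext h (basis x) = h x.
Proof.
rewrite (@linext_seq _ _ _ _ [:: x])// => [|y /=].
  by rewrite big_seq1 /= eqxx scale1r.
by rewrite inE; case: (y == x); rewrite ?eqxx.
Qed.

Lemma linear_linext (X : choiceType) (U V : lmodType rat)
    (f : {linear U -> V}) (h : X -> U) u :
  f (linext h u) = linext (fun x => f (h x)) u.
Proof.
have [r ur su] := fin_suppP u; rewrite !(linext_seq _ ur su) linear_sum.
by apply: eq_bigr => x _; rewrite linearZ.
Qed.

Lemma eq_linext (X : choiceType) (V : lmodType rat) (h k : X -> V) :
  h =1 k -> linext h =1 linext k.
Proof. by move=> /funext ->. Qed.

Definition bilinear_map (U V W : lmodType rat) (f : U -> V -> W) : Prop :=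
  (forall v, linear (f^~ v)) /\ (forall u, linear (f u)).

Record is_graded_lie (V : lmodType rat) (br : V -> V -> V)
    (gr : nat -> set V) : Prop := IsGradedLie {
  graded_bilinear : bilinear_map br;
  graded_alternating : forall u, br u u = 0;
  graded_jacobi : forall u v w,
    br u (br v w) + br v (br w u) + br w (br u v) = 0;
  graded_submod : forall n, span (gr n) `<=` gr n;
  graded_span : span (\bigcup_n gr n) = setT;
  graded_indep : forall n (u : 'I_n -> V),
    (forall i : 'I_n, gr i (u i)) -> \sum_i u i = 0 -> forall i, u i = 0;
  graded_bracket : forall m n u v, gr m u -> gr n v -> gr (m + n)%N (br u v)
}.

Inductive mag (W : Type) : Type :=
| MLeaf of W
| MNode of mag W & mag W.

HB.instance Definition _ (W : Type) := gen_eqMixin (mag W).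
HB.instance Definition _ (W : Type) := gen_choiceMixin (mag W).

Fixpoint mag_size (W : Type) (t : mag W) : nat :=
  if t is MNode t1 t2 then (mag_size t1 + mag_size t2)%N else 1%N.

Fixpoint mag_map (W W' : Type) (h : W -> W') (t : mag W) : mag W' :=
  match t with
  | MLeaf w => MLeaf (h w)
  | MNode t1 t2 => MNode (mag_map h t1) (mag_map h t2)
  end.

Section FreeLie.
Context (W : lmodType rat).

(* Product of the free nonassociative algebra on the set W. *)
Definition mag_mul (u v : freemod (mag W)) : freemod (mag W) :=
  linext (fun s => linext (fun t => basis (MNode s t)) v) u.

(* The two-sided ideal making the generators linear in W and the product a Lie
   bracket. *)
Inductive lie_ideal : set (freemod (mag W)) :=
| lie_linear c (v w : W) : lie_ideal
    (basis (MLeaf (c *: v + w)) - (c *: basis (MLeaf v) + basis (MLeaf w)))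
| lie_alt u : lie_ideal (mag_mul u u)
| lie_jacobi u v w : lie_ideal
    (mag_mul u (mag_mul v w) + mag_mul v (mag_mul w u) +
     mag_mul w (mag_mul u v))
| lie_mull u v : lie_ideal v -> lie_ideal (mag_mul u v)
| lie_mulr u v : lie_ideal u -> lie_ideal (mag_mul u v).

Definition freeLie := quotmod lie_ideal.
HB.instance Definition _ := GRing.Lmodule.on freeLie.

Definition lie_gen (w : W) : freeLie := cls lie_ideal (basis (MLeaf w)).

Definition lie_br (x y : freeLie) : freeLie :=
  cls lie_ideal (mag_mul (rep x) (rep y)).

Definition lie_deg (n : nat) : set freeLie :=
  span [set cls lie_ideal (basis t) | t in [set t | mag_size t = n]].

(* The map induced by h : W -> W; it is a Lie morphism when h is linear. *)
Definition lie_map (h : W -> W) (x : freeLie) : freeLie :=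
  cls lie_ideal (linext (fun t => basis (mag_map h t)) (rep x)).

Fact mag_mul_bilinear : bilinear_map mag_mul.
Proof.
split=> [v|u] c x y; first exact: linearP.
have [r ur su] := fin_suppP u; rewrite /mag_mul !(linext_seq _ ur su).
rewrite scaler_sumr -big_split/=; apply: eq_bigr => s _.
by rewrite linearP scalerDr !scalerA mulrC.
Qed.

Lemma lie_brE u v :
  lie_br (cls lie_ideal u) (cls lie_ideal v) = cls lie_ideal (mag_mul u v).
Proof.
have [ml mr] := mag_mul_bilinear.
have mlB x y z : mag_mul (x - y) z = mag_mul x z - mag_mul y z.
  by rewrite addrC -scaleN1r ml scaleN1r addrC.
have mrB x y z : mag_mul x (y - z) = mag_mul x y - mag_mul x z.
  by rewrite addrC -scaleN1r mr scaleN1r addrC.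
have idl x y : span lie_ideal x -> span lie_ideal (mag_mul x y).
  elim=> [|c a b Ia _ ih].
    by rewrite -[X in mag_mul X](subrr 0) mlB subrr; apply: span0.
  by rewrite ml; apply: spanP => //; apply: lie_mulr.
have idr x y : span lie_ideal y -> span lie_ideal (mag_mul x y).
  elim=> [|c a b Ia _ ih].
    by rewrite -[X in mag_mul _ X](subrr 0) mrB subrr; apply: span0.
  by rewrite mr; apply: spanP => //; apply: lie_mull.
apply/clsP; rewrite -(subrKA (mag_mul u (rep (cls lie_ideal v)))).
by rewrite -mlB -mrB; apply: spanD; [apply: idl|apply: idr]; apply: span_rep.
Qed.

Lemma linext_mag_mul (h : W -> W) x y
    (f := linext (fun t => basis (mag_map h t))) :
  f (mag_mul x y) = mag_mul (f x) (f y).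
Proof.
rewrite {}/f /mag_mul !linear_linext/=; apply: eq_linext => s.
rewrite linextU !linear_linext/=; apply: eq_linext => t.
by rewrite !linextU.
Qed.

Lemma lie_ideal_linear (f : {linear (freemod (mag W)) -> (freemod (mag W))}) :
    (forall x y, f (mag_mul x y) = mag_mul (f x) (f y)) ->
    (forall c v w, lie_ideal
       (f (basis (MLeaf (c *: v + w)) - (c *: basis (MLeaf v) + basis (MLeaf w))))) ->
  forall u, lie_ideal u -> lie_ideal (f u).
Proof.
move=> fM fL u; elim=> [||x y z|x y _ ih|x y _ ih]//.
- by move=> x; rewrite fM; apply: lie_alt.
- have E p q r : f (mag_mul p (mag_mul q r)) =
      mag_mul (f p) (mag_mul (f q) (f r)) by rewrite fM fM.
  by rewrite 2!linearD !E; apply: lie_jacobi.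
- by rewrite fM; apply: lie_mull.
- by rewrite fM; apply: lie_mulr.
Qed.

Lemma lie_mapE (h : W -> W) u : linear h ->
  lie_map h (cls lie_ideal u) =
  cls lie_ideal (linext (fun t => basis (mag_map h t)) u).
Proof.
move=> hl; apply/clsP; rewrite -linearB.
elim: (span_rep lie_ideal u) => [|c a b Ia _ ih].
  by rewrite linear0; apply: span0.
rewrite linearP; apply: spanP => // {ih b}.
apply: lie_ideal_linear Ia => [x y|k v w]; first exact: linext_mag_mul.
by rewrite linearB linearD linearZ /= !linextU/= hl; apply: lie_linear.
Qed.

End FreeLie.

Definition is_free_basis (G : groupType) (I : Type) (b : I -> G) : Prop :=
  forall (H : groupType) (f : I -> H),
    exists2 h : {multiplicative G -> H}, (forall i, h (b i) = f i) &
      forall h' : {multiplicative G -> H}, (forall i, h' (b i) = f i) -> h' =1 h.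

Inductive normal_closure (G : groupType) (S : set G) : set G :=
| nclosure_gen x : S x -> normal_closure S x
| nclosure1 : normal_closure S 1%g
| nclosureM x y :
    normal_closure S x -> normal_closure S y -> normal_closure S (x * y)%g
| nclosureV x : normal_closure S x -> normal_closure S x^-1%g
| nclosureJ x y : normal_closure S x -> normal_closure S (y * x * y^-1)%g.

Section GroupAlgebra.
Context (F : groupType).

(* The group algebra Q[F] is the free Q-module on F; its coproduct sends
   basis f to basis f (x) basis f. *)
Notation QF := (freemod F).

Definition gmul (u v : QF) : QF :=
  linext (fun x => linext (fun y => basis (x * y)%g) v) u.

Definition antipode (u : QF) : QF := linext (fun x => basis x^-1%g) u.

Definition augmentation (u : QF) : rat := \sum_(x \in [set: F]) u x.

Context (W : lmodType rat) (act : F -> W -> W).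

Definition galg_act (u : QF) (w : W) : W := linext (fun f => act f w) u.

(* u (x) w, in Q[F] (x) W = fmod F W *)
Definition tensor (u : QF) (w : W) : fmod F W :=
  linext (fun f => delta f w) u.

(* The map sending f (x) w to h f (x) k w *)
Definition tensor_map (h : F -> F) (k : W -> W) (z : fmod F W) : fmod F W :=
  \sum_(f \in [set: F]) delta (h f) (k (z f)).

Section Operations.
Context (g : nat) (x : 'I_g -> F) (a : 'I_g -> W).

Record is_intersection_pairing (pair : QF -> W -> QF) : Prop :=
  IsIntersectionPairing {
  pair_bilinear : bilinear_map pair;
  pairMl u v w :
    pair (gmul u v) w = gmul u (pair v w) + augmentation v *: pair u w;
  pair_act u f w : pair u (act f w) = gmul (pair u w) (basis f^-1%g);
  pair_basis i j :
    pair (basis (x i)) (a j) = if i == j then - basis 1%g else 0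
}.

(* Q[F] (x) Q[F] is identified with the free Q-module on F * F, so that on a
   group element f, where f' = f'' = f, one gets
   Theta(f, w) = \sum_h c_h h^-1 f (x) h for <f, w> = \sum_h c_h h. *)
Definition Theta (pair : QF -> W -> QF) (u : QF) (w : W) : freemod (F * F)%type :=
  linext (fun f =>
    linext (fun h => basis (h^-1 * f, h)%g) (pair (basis f) w)) u.

Record is_Psi (pair : QF -> W -> QF) (Psi : W -> W -> fmod F W) : Prop :=
  IsPsi {
  Psi_bilinear : bilinear_map Psi;
  Psi_basis i j : Psi (a i) (a j) = if i == j then delta 1%g (a i) else 0;
  Psi_actl f u v :
    Psi (act f u) v = tensor_map (fun h => f * h)%g id (Psi u v)
      - linext (fun k => delta k.2 (act k.1 u)) (Theta pair (basis f) v);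
  Psi_actr f u v :
    Psi u (act f v) = tensor_map (fun h => h * f^-1)%g (act f) (Psi u v)
      - tensor (antipode (pair (basis f) u)) (act f v)
}.

End Operations.
End GroupAlgebra.

Section Kernel.
Context (P F : groupType) (w : {multiplicative P -> F}).

Definition kernel : Type := {x : P | w x == 1%g}.
HB.instance Definition _ := SubChoice.on kernel.

Definition ab_rel : set (freemod kernel) :=
  [set u | exists x y z : kernel,
     val z = (val x * val y)%g /\ u = basis z - (basis x + basis y)].

(* Linear maps from AbQ to a Q-module are morphisms from the kernel A to its
   additive group, so that AbQ is A/[A,A] (x) Q. *)
Definition AbQ : Type := quotmod ab_rel.
HB.instance Definition _ := GRing.Lmodule.on AbQ.

(* The class of x in AbQ; 0 by convention when x is not in the kernel. *)
Definition ab_class (x : P) : AbQ :=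
  if insub x is Some k then cls ab_rel (basis (k : kernel)) else 0.

Definition ab_conj (y : P) (u : AbQ) : AbQ :=
  linext (fun k : kernel => ab_class (y * val k * y^-1)%g) (rep u).

(* The action of F by conjugation, through preimages under w. *)
Definition ab_act (f : F) (u : AbQ) : AbQ :=
  ab_conj (xget 1%g [set y | w y = f]) u.

(* The algebraic data of a handlebody V of genus g with a closed disk D0 in its
   boundary: P = pi_1(Sigma), F = pi_1(V) for Sigma the boundary of V minus the
   interior of D0, with w induced by the inclusion and (alpha, beta) given by
   meridians and parallels. *)
Record is_meridian_parallel_system (g : nat) (alpha beta : 'I_g -> P) : Prop :=
  IsMeridianParallelSystem {
  system_free : is_free_basis
    (fun s : 'I_g + 'I_g => match s with inl i => alpha i | inr i => beta i end);
  system_kernel x : w x = 1%g <-> normal_closure (range alpha) x;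
  system_parallels : is_free_basis (fun i => w (beta i))
}.

(* The class zeta of the boundary of Sigma, whose inverse is the product of the
   [beta_i^-1, alpha_i]. Here [x, y] = x y x^-1 y^-1, unlike the library's
   [~ x, y]. *)
Definition boundary_class (g : nat) (alpha beta : 'I_g -> P) : P :=
  ((\prod_(i < g)
     ((beta i)^-1 * alpha i * beta i * (alpha i)^-1))^-1)%g.

Let w1 : w 1%g = 1%g.
Proof. by apply: (@mulgI _ (w 1%g)); rewrite -gmulfM !mulg1. Qed.

Let wV x : w x^-1%g = (w x)^-1%g.
Proof. by apply: (@mulgI _ (w x)); rewrite -gmulfM !mulgV. Qed.

Let wJ x y : w x = 1%g -> w (y * x * y^-1)%g = 1%g.
Proof. by move=> wx; rewrite !gmulfM wx mulg1 wV mulgV. Qed.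

Lemma ab_classE (k : kernel) : ab_class (val k) = cls ab_rel (basis k).
Proof. by rewrite /ab_class valK. Qed.

Lemma ab_classM x y : w x = 1%g -> w y = 1%g ->
  ab_class (x * y)%g = ab_class x + ab_class y.
Proof.
move=> /eqP wx /eqP wy.
have wxy : w (x * y)%g == 1%g by rewrite gmulfM (eqP wx) (eqP wy) mulg1.
pose kx : kernel := exist _ x wx; pose ky : kernel := exist _ y wy.
pose k : kernel := exist _ (x * y)%g wxy.
rewrite (ab_classE k) (ab_classE kx) (ab_classE ky) -linearD.
by apply/clsP/span_gen; exists kx, ky, k.
Qed.

Lemma ab_conj_class y x : w x = 1%g ->
  ab_conj y (ab_class x) = ab_class (y * x * y^-1)%g.
Proof.
move=> /eqP wx; pose k : kernel := exist _ x wx.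
rewrite (ab_classE k) /ab_conj; set h := fun k : kernel => _.
rewrite -[RHS]/(h k) -[RHS]linextU; apply/eqP; rewrite -subr_eq0 -linearB.
apply/eqP; elim: (span_rep ab_rel (basis k)) => [|c u v ru _ ih].
  exact: linear0.
rewrite linearP ih addr0; case: ru => k1 [k2 [k3 [e ->]]].
rewrite linearB linearD /= !linextU /h e.
have wk (i : kernel) := wJ y (eqP (valP i)).
by rewrite -ab_classM ?wk// !mulgA mulgVK subrr scaler0.
Qed.

Lemma ab_act_class y x : w x = 1%g ->
  ab_act (w y) (ab_class x) = ab_class (y * x * y^-1)%g.
Proof.
move=> wx; rewrite /ab_act; set z := xget _ _.
have wz : w z = w y := @xgetPex _ 1%g [set t | w t = w y] (ex_intro _ y erefl).
pose c := (z * y^-1)%g; have wc : w c = 1%g.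
  by rewrite gmulfM wz wV mulgV.
have wcV : w c^-1%g = 1%g by rewrite wV wc invg1.
have -> : ab_conj z (ab_class x) =
    ab_class (c * (y * x * y^-1) * c^-1)%g.
  by rewrite ab_conj_class// /c invgM invgK !mulgA !mulgVK.
set t := (y * x * y^-1)%g; have wt : w t = 1%g by exact: wJ.
have wct : w (c * t)%g = 1%g by rewrite gmulfM wc wt mulg1.
rewrite (ab_classM wct wcV) (ab_classM wc wt) addrAC -(ab_classM wc wcV) mulgV.
suff -> : ab_class 1%g = 0 by rewrite add0r.
have := ab_classM w1 w1; rewrite mulg1.
by move=> h1; rewrite -(subrr (ab_class 1%g)) {2}h1 addrK.
Qed.

End Kernel.

Arguments ab_act {P F} w f u.

Section Derivations.
Context (F : groupType) (W : lmodType rat) (act : F -> W -> W) (zeta : W).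

Notation L := (freeLie W).
Notation "f '.*' b" := (lie_map (act f) b) (at level 40).

Record is_derivation (m : nat) (d : (F -> L) * (L -> L)) : Prop :=
  IsDerivation {
  der_linear : linear d.2;
  der_leibniz b c : d.2 (lie_br b c) = lie_br (d.2 b) c + lie_br b (d.2 c);
  der_deg n b : lie_deg n b -> lie_deg (n + m) (d.2 b);
  der0_deg f : lie_deg m (d.1 f);
  der0_cocycle f h : d.1 (f * h)%g = d.1 f + f .* d.1 h;
  der_act f b : d.2 (f .* b) = f .* d.2 b + lie_br (d.1 f) (f .* b)
}.

Definition is_special (m : nat) (d : (F -> L) * (L -> L)) : Prop :=
  is_derivation m d /\ d.2 (lie_gen zeta) = 0.

Definition der_br (d e : (F -> L) * (L -> L)) : (F -> L) * (L -> L) :=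
  (fun f => d.2 (e.1 f) - e.2 (d.1 f) - lie_br (d.1 f) (e.1 f),
   fun b => d.2 (e.2 b) - e.2 (d.2 b)).

(* Finite sums of homogeneous special derivations of positive degrees. *)
Definition SDer : Type :=
  spanned [set d : (F -> L) * (L -> L) | exists2 m, (0 < m)%N & is_special m d].
HB.instance Definition _ := GRing.Lmodule.on SDer.

Definition SDer_val (d : SDer) : (F -> L) * (L -> L) := val d.

Definition SDer_deg (m : nat) : set SDer :=
  [set d | is_special m (SDer_val d)].

End Derivations.

Section Trees.
Context (F : groupType) (W : lmodType rat).
Notation QF := (freemod F).

(* The beads of an edge are listed following its orientation, which is recorded
   relatively to a traversal of the edge: true if both agree. *)
Definition edge : Type := bool * seq QF.

Definition flip (e : edge) : edge := (~~ e.1, e.2).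

(* A half of a tree cut along an edge. In [Node e1 t1 e2 t2], the edges e1 and
   e2 are traversed away from the node, and the cyclic order at the node is
   (cut edge, e1, e2). *)
Inductive half_tree : Type :=
| Leaf of W
| Node of edge & half_tree & edge & half_tree.

(* An oriented tree with beads, presented by cutting it along one of its edges;
   [cut_edge] is traversed from [cut_left] to [cut_right]. *)
Record tree : Type :=
  Cut { cut_left : half_tree; cut_edge : edge; cut_right : half_tree }.

HB.instance Definition _ := gen_eqMixin tree.
HB.instance Definition _ := gen_choiceMixin tree.

Fixpoint half_nodes (t : half_tree) : nat :=
  if t is Node _ t1 _ t2 then (half_nodes t1 + half_nodes t2).+1 else 0%N.

Definition degree (T : tree) : nat :=
  (half_nodes (cut_left T) + half_nodes (cut_right T)).+1.

(* The presentations of [Cut t e s] obtained by cutting along an edge of t. *)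
Fixpoint half_cuts (t : half_tree) (e : edge) (s : half_tree) : seq tree :=
  if t is Node e1 t1 e2 t2 then
    let T1 := Cut t1 (flip e1) (Node e2 t2 e s) in
    let T2 := Cut t2 (flip e2) (Node e s e1 t1) in
    T1 :: half_cuts t1 (cut_edge T1) (cut_right T1) ++
    T2 :: half_cuts t2 (cut_edge T2) (cut_right T2)
  else [::].

(* One presentation of T for each of its edges. *)
Definition cuts (T : tree) : seq tree :=
  let: Cut t e s := T in
  T :: half_cuts t e s ++ half_cuts s (flip e) t.

(* The leaves, each as (color, edge traversed from the leaf, rest of the tree) *)
Definition leaves (T : tree) : seq (W * edge * half_tree) :=
  flatten [seq
    (if cut_left C is Leaf v then [:: (v, cut_edge C, cut_right C)] else [::]) ++
    (if cut_right C is Leaf v then [:: (v, flip (cut_edge C), cut_left C)]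
     else [::])
  | C <- cuts T].

(* The beads, each as (incoming half of the tree, beads before, bead, beads
   after, outgoing half), following the orientation of the edge *)
Definition beads (T : tree) :
    seq (half_tree * seq QF * QF * seq QF * half_tree) :=
  flatten [seq
    let: (t, s) := if (cut_edge C).1 then (cut_left C, cut_right C)
                   else (cut_right C, cut_left C) in
    let bs := (cut_edge C).2 in
    [seq (t, take i bs, nth 0 bs i, drop i.+1 bs, s) | i <- iota 0 (size bs)]
  | C <- cuts T].

Context (act : F -> W -> W).

Notation "[ T ]" := (basis (T : tree)).

(* The defining relations. Every edge of a tree can be made the cut edge with
   the help of [rel_swap] and [rel_cut], so that it is enough to state the other
   relations at the cut edge. *)
Inductive tree_rel : set (freemod tree) :=
| rel_swap t e s : tree_rel ([Cut t e s] - [Cut s (flip e) t])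
| rel_cut e1 t1 e2 t2 e s :
    tree_rel ([Cut (Node e1 t1 e2 t2) e s] -
              [Cut t1 (flip e1) (Node e2 t2 e s)])
| rel_AS t e e1 t1 e2 t2 :
    tree_rel ([Cut t e (Node e1 t1 e2 t2)] + [Cut t e (Node e2 t2 e1 t1)])
(* the cut edge joins nodes with cyclic orders (cut edge, C, r) and
   (cut edge, A, B) *)
| rel_IHX o er tr ea ta eb tb ec tc :
    let T ea ta eb tb ec tc :=
      Cut (Node ec tc er tr) (o, [::]) (Node ea ta eb tb) in
    tree_rel ([T ea ta eb tb ec tc] + [T eb tb ec tc ea ta] +
              [T ec tc ea ta eb tb])
| rel_leaf t e c v w :
    tree_rel ([Cut t e (Leaf (c *: v + w))] -
              (c *: [Cut t e (Leaf v)] + [Cut t e (Leaf w)]))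
| rel_bead t o bs c x y bs' s :
    tree_rel ([Cut t (o, bs ++ (c *: x + y) :: bs') s] -
              (c *: [Cut t (o, bs ++ x :: bs') s] +
               [Cut t (o, bs ++ y :: bs') s]))
| rel_one t o bs bs' s :
    tree_rel ([Cut t (o, bs ++ basis 1%g :: bs') s] - [Cut t (o, bs ++ bs') s])
| rel_mul t o bs x y bs' s :
    tree_rel ([Cut t (o, bs ++ x :: y :: bs') s] -
              [Cut t (o, bs ++ gmul x y :: bs') s])
| rel_reverse t o bs s :
    tree_rel ([Cut t (o, bs) s] -
              [Cut t (~~ o, rev [seq antipode x | x <- bs]) s])
(* the coproduct of x = \sum_f c_f f is \sum_f c_f f (x) f *)
| rel_node t bs x bs1 t1 bs2 t2 :
    tree_rel ([Cut t (true, rcons bs x) (Node (true, bs1) t1 (true, bs2) t2)] -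
      linext (fun f : F => [Cut t (true, bs)
        (Node (true, basis f :: bs1) t1 (true, basis f :: bs2) t2)]) x)
| rel_out t bs x v :
    tree_rel ([Cut t (true, rcons bs x) (Leaf v)] -
              [Cut t (true, bs) (Leaf (galg_act act x v))]).

Definition treemod : Type := quotmod tree_rel.
HB.instance Definition _ := GRing.Lmodule.on treemod.

Definition tree_class (T : tree) : treemod := cls tree_rel [T].

Definition tree_deg (m : nat) : set treemod :=
  span [set tree_class T | T in [set T | degree T = m]].

Context (Theta : QF -> W -> freemod (F * F)%type) (Psi : W -> W -> fmod F W).

(* A bead x oriented towards the start of the traversal of e, added there. *)
Definition add_bead (e : edge) (x : QF) : edge :=
  if e.1 then (true, antipode x :: e.2) else (false, rcons e.2 x).

Definition branch_at (p q : W * edge * half_tree) : freemod tree :=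
  let: (v, eD, D) := p in
  let: (w, eE, E) := q in
  \sum_(f \in [set f | Psi v w f != 0])
    [Cut (Leaf (Psi v w f)) (true, [::]) (Node eE E (add_bead eD (basis f)) D)].

Definition graft_at (p : half_tree * seq QF * QF * seq QF * half_tree)
    (q : W * edge * half_tree) : freemod tree :=
  let: (t, bs, b, bs', s) := p in
  let: (w, eE, E) := q in
  linext (fun k : F * F =>
    [Cut t (true, rcons bs (basis k.2))
       (Node (true, basis k.1 :: bs') s eE E)]) (Theta b w).

Definition branching (D E : tree) : freemod tree :=
  \sum_(p <- leaves D) \sum_(q <- leaves E) branch_at p q.

Definition grafting (D E : tree) : freemod tree :=
  \sum_(p <- beads D) \sum_(q <- leaves E) graft_at p q.

Definition tree_br (D E : tree) : treemod :=
  cls tree_rel (branching D E - grafting D E + grafting E D).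

End Trees.

Arguments tree_class {F W} act T.
Arguments tree_deg {F W} act m _.

(* Main.v *)
Require Import Defs.
From HB Require Import structures.
From mathcomp Require Import all_boot all_order all_algebra finmap.
From mathcomp Require Import boolp classical_sets functions fsbigop.
From mathcomp Require Import zify.

Set Implicit Arguments.
Unset Strict Implicit.
Unset Printing Implicit Defensive.

Import GRing.Theory.
Import Defs.

Local Open Scope ring_scope.

(** Write L for the free Lie algebra on the module W = AbQ. A tree cut along an edge
    is a pair of Lie words, one for each half, whose beads have been pushed to the
    leaves. With the relations of the tree module, this makes [join] the universal
    symmetric bilinear form B on L that is invariant, B([x, y], z) = B(x, [y, z]), and
    invariant under F: a linear map out of the tree module is such a form
    ([tree_ext], [class_join], [tree_ext_join]). Forms of this kind arise as sums over
    leaves. For any bilinear G, let [tree_sum G] add up the values G(v, t) over the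
    leaves v of a tree, where t is the word of the rest of the tree planted at v. It
    is symmetric and invariant for free, and it is F-invariant as soon as G is so up
    to a function of the bracket [v, t], because the sum of the [v, t] over the leaves
    of a tree vanishes. [tree_functional_class] expresses it on a tree with beads by a
    sum over its leaves and a sum over its beads.

    A tree D is sent to the derivation given on F by the sum of - <f, v> t, and on a
    generator b of L by the sum of the brackets of the left component of Psi(v, b),
    through the antipode, acting on t, with its right component. The rules satisfied
    by Psi say exactly that this is well defined on the tree module and is a
    derivation of the semidirect product. It kills the class zeta of the boundary
    because Psi(v, zeta) = 1 (x) v, so that the value on zeta is again a sum of
    brackets [v, t] over all leaves.

    Surjectivity: given a special derivation d of degree m, the tree
    u = sum_i join(a_i, d(x_i)) has for its cocycle m + 1 times that of d
    ([cocycle_tree_cocycle]). The leaf a_i contributes d(x_i) by the duality of the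
    x_i and the a_i. The other leaves contribute m d(x_i): for any invariant G, the
    sums over leaves satisfy
    leaf_sum G y (euler x) - leaf_sum G x (euler y) = residue G [x, y],
    and the sum of the residues vanishes since d kills zeta. Moreover a special
    derivation of positive degree is determined by its cocycle ([special_unique]): if
    the cocycle is zero, then the sum of the (1 - x_i^-1) d(a_i) is zero, and Fox
    calculus separates its terms. Injectivity: substituting the cocycle of a tree of
    degree m into the sum above gives m + 1 times that tree ([recover_deg]), since
    each leaf gets replaced by its expression in the basis of the a_i.

    The bracket of trees D and E is defined as the result of applying the derivation
    of D to E leaf by leaf ([bracket]). When the formula for trees with beads is
    applied to both trees, leaves against leaves give the branchings and leaves
    against beads give the two sorts of graftings ([tree_br_bracket]). That it
    corresponds to the bracket of derivations is checked on cocycles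
    ([tree_cocycle_bracket]). There it reduces to an identity relating Psi and the
    pairing, [exch_defect0], which holds because both sides obey the same rules and
    agree on the bases. The Lie algebra axioms then follow from those of derivations. *)

(** * Linear maps, free modules and quotients *)

Section LinearMaps.
Context (U V : lmodType rat) (f : U -> V).
Hypothesis hf : linear f.

Definition linear_pack : {linear U -> V} :=
  HB.pack f (GRing.isLinear.Build rat U V _ f hf).

Lemma linD u v : f (u + v) = f u + f v. Proof. exact: (linearD linear_pack). Qed.
Lemma linZ c u : f (c *: u) = c *: f u. Proof. exact: (linearZZ linear_pack). Qed.
Lemma lin0 : f 0 = 0. Proof. exact: (linear0 linear_pack). Qed.
Lemma linN u : f (- u) = - f u. Proof. exact: (linearN linear_pack). Qed.
Lemma linB u v : f (u - v) = f u - f v. Proof. exact: (linearB linear_pack). Qed.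
Lemma lin_sum I (r : seq I) (P : pred I) F :
  f (\sum_(i <- r | P i) F i) = \sum_(i <- r | P i) f (F i).
Proof. exact: (linear_sum linear_pack). Qed.

End LinearMaps.

Section BilinearMaps.
Context (U V M : lmodType rat) (f : U -> V -> M).
Hypothesis hf : bilinear_map f.

Lemma bilDl u u' v : f (u + u') v = f u v + f u' v.
Proof. exact: linD (hf.1 v) u u'. Qed.
Lemma bilDr u v v' : f u (v + v') = f u v + f u v'.
Proof. exact: linD (hf.2 u) v v'. Qed.
Lemma bilBl u u' v : f (u - u') v = f u v - f u' v.
Proof. exact: linB (hf.1 v) u u'. Qed.
Lemma bilBr u v v' : f u (v - v') = f u v - f u v'.
Proof. exact: linB (hf.2 u) v v'. Qed.
Lemma bilNl u v : f (- u) v = - f u v. Proof. exact: linN (hf.1 v) u. Qed.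
Lemma bilNr u v : f u (- v) = - f u v. Proof. exact: linN (hf.2 u) v. Qed.
Lemma bilZl c u v : f (c *: u) v = c *: f u v. Proof. exact: linZ (hf.1 v) c u. Qed.
Lemma bilZr c u v : f u (c *: v) = c *: f u v. Proof. exact: linZ (hf.2 u) c v. Qed.
Lemma bil0l v : f 0 v = 0. Proof. exact: lin0 (hf.1 v). Qed.
Lemma bil0r u : f u 0 = 0. Proof. exact: lin0 (hf.2 u). Qed.
Lemma bil_suml I (r : seq I) (P : pred I) F v :
  f (\sum_(i <- r | P i) F i) v = \sum_(i <- r | P i) f (F i) v.
Proof. exact: (lin_sum (hf.1 v)). Qed.
Lemma bil_sumr I (r : seq I) (P : pred I) F u :
  f u (\sum_(i <- r | P i) F i) = \sum_(i <- r | P i) f u (F i).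
Proof. exact: (lin_sum (hf.2 u)). Qed.

End BilinearMaps.

Lemma linear_comp (U V M : lmodType rat) (f : V -> M) (h : U -> V) :
  linear f -> linear h -> linear (fun u => f (h u)).
Proof. by move=> lf lh c u v; rewrite lh lf. Qed.

Lemma linear_lincomb (U V : lmodType rat) (f h : U -> V) c :
  linear f -> linear h -> linear (fun u => c *: f u + h u).
Proof.
move=> lf lh k u v.
by rewrite lf lh !scalerDr !scalerA mulrC addrACA.
Qed.

Lemma linear_add (U V : lmodType rat) (f h : U -> V) :
  linear f -> linear h -> linear (fun u => f u + h u).
Proof. by move=> lf lh c u v; rewrite lf lh scalerDr addrACA. Qed.

Lemma linear_bigsum (U V : lmodType rat) (I : Type) (r : seq I) (f : I -> U -> V) :
  (forall i, linear (f i)) -> linear (fun u => \sum_(i <- r) f i u).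
Proof.
move=> lf c u v; rewrite scaler_sumr -big_split.
by apply: eq_bigr => i _ /=; rewrite lf.
Qed.

Lemma linear_opp (U V : lmodType rat) (f : U -> V) :
  linear f -> linear (fun u => - f u).
Proof. by move=> lf c u v; rewrite lf opprD scalerN. Qed.

Lemma linear_id (U : lmodType rat) : linear (fun u : U => u). Proof. by []. Qed.

Lemma linear_zero (U V : lmodType rat) : linear (fun _ : U => 0 : V).
Proof. by move=> c u v; rewrite scaler0 addr0. Qed.

Lemma bilinear_add (U V M : lmodType rat) (f h : U -> V -> M) :
  bilinear_map f -> bilinear_map h -> bilinear_map (fun u v => f u v + h u v).
Proof. by move=> [f1 f2] [h1 h2]; split=> v; apply: linear_add. Qed.

Lemma bilinear_comp (U V M M' : lmodType rat) (f : M -> M') (h : U -> V -> M) :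
  linear f -> bilinear_map h -> bilinear_map (fun u v => f (h u v)).
Proof. by move=> lf [h1 h2]; split=> v; apply: linear_comp. Qed.

Lemma eq_oppr_eq0 (V : lmodType rat) (v : V) : v = - v -> v = 0.
Proof.
move=> /eqP; rewrite -addr_eq0 -mulr2n -scaler_nat scaler_eq0 => /orP[]//.
by move/eqP.
Qed.

Section FreeModules.
Context (X : choiceType) (V : lmodType rat).

Lemma fmod_ind (P : fmod X V -> Prop) :
  P 0 -> (forall x v u, P u -> P (delta x v + u)) -> forall u, P u.
Proof.
move=> P0 PS u; have [r ur su] := fin_suppP u.
have -> : u = \sum_(x <- r) delta x (u x).
  apply: fmodP => y; have coef_sum (s : seq X) :
      (\sum_(x <- s) delta x (u x)) y = \sum_(x <- s) (if y == x then u x else 0).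
    by elim: s => [|x s ih]; rewrite ?big_nil// !big_cons coefD ih.
  rewrite coef_sum; have [yr|yr] := boolP (y \in r).
    rewrite (bigD1_seq y)//= eqxx big1 ?addr0// => x xy.
    by rewrite eq_sym (negbTE xy).
  rewrite big1_seq => [|x /andP[_ xr]].
    by apply/eqP; apply: contraNT yr => /su.
  by case: eqP => // yx; rewrite -yx (negbTE yr) in xr.
by elim: r {ur su} => [|x r ih]; rewrite ?big_nil// big_cons; apply: PS.
Qed.

Lemma fmod_eq (M : lmodType rat) (f h : fmod X V -> M) :
    linear f -> linear h -> (forall x v, f (delta x v) = h (delta x v)) ->
  f =1 h.
Proof.
move=> lf lh fh; apply: fmod_ind => [|x v u ih]; first by rewrite !lin0.
by rewrite !linD// fh ih.
Qed.

(** The map out of Q[X] (x) V which is [k x] on x (x) V. *)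
Definition fmod_ext (M : lmodType rat) (k : X -> V -> M) (u : fmod X V) : M :=
  \sum_(x \in [set: X]) k x (u x).

Section FmodExt.
Context (M : lmodType rat) (k : X -> V -> M).
Hypothesis hk : forall x, linear (k x).

Lemma fmod_ext_seq (u : fmod X V) (r : seq X) :
    uniq r -> (forall x, u x != 0 -> x \in r) ->
  fmod_ext k u = \sum_(x <- r) k x (u x).
Proof.
move=> ur sr; rewrite /fmod_ext (fsbigE r)//.
  by apply: eq_bigl => x; rewrite in_setT.
move=> x _; apply: contraNeq => uh; apply: sr; apply: contraNneq uh => ->.
by rewrite lin0.
Qed.

Lemma fmod_ext_linear : linear (fmod_ext k).
Proof.
move=> c u v.
have [r _ ru] := fin_suppP u; have [s _ sv] := fin_suppP v.
have cov (w : fmod X V) : (forall x, w x != 0 -> (u x != 0) || (v x != 0)) ->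
    fmod_ext k w = \sum_(x <- undup (r ++ s)) k x (w x).
  move=> wuv; apply: fmod_ext_seq => [|x /wuv /orP[/ru xr|/sv xs]].
  - exact: undup_uniq.
  - by rewrite mem_undup mem_cat xr.
  - by rewrite mem_undup mem_cat xs orbT.
rewrite !cov => [|x ->|x ->|x]; rewrite ?orbT//.
  rewrite scaler_sumr -big_split/=; apply: eq_bigr => x _.
  exact: hk.
apply: contra_neqT; rewrite negb_or !negbK coefD coefZ => /andP[/eqP-> /eqP->].
by rewrite scaler0 addr0.
Qed.

Lemma fmod_ext_delta x v : fmod_ext k (delta x v) = k x v.
Proof.
rewrite (@fmod_ext_seq _ [:: x])// => [|y /=].
  by rewrite big_seq1 /= eqxx.
by rewrite inE; case: (y == x); rewrite ?eqxx.
Qed.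

End FmodExt.

Lemma lin_fmod_ext (M M' : lmodType rat) (f : M -> M') (k : X -> V -> M) u :
    linear f -> (forall x, linear (k x)) ->
  f (fmod_ext k u) = fmod_ext (fun x v => f (k x v)) u.
Proof.
move=> lf lk.
apply: (fmod_eq (linear_comp lf (fmod_ext_linear lk)) (h := fmod_ext _)) => [|x v].
  by apply: fmod_ext_linear => x; apply: (linear_comp lf (lk x)).
by rewrite !fmod_ext_delta// => y; apply: (linear_comp lf (lk y)).
Qed.

Lemma eq_fmod_ext (M : lmodType rat) (k k' : X -> V -> M) u :
  (forall x v, k x v = k' x v) -> fmod_ext k u = fmod_ext k' u.
Proof. by move=> e; have -> : k = k' by apply/funext => x; apply/funext => v. Qed.

Lemma fmod_ext_lincomb (M : lmodType rat) (k k' : X -> V -> M) c u :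
    (forall x, linear (k x)) -> (forall x, linear (k' x)) ->
  fmod_ext (fun x v => c *: k x v + k' x v) u = c *: fmod_ext k u + fmod_ext k' u.
Proof.
move=> lk lk'; have lkk x := linear_lincomb c (lk x) (lk' x).
apply: (fmod_eq (fmod_ext_linear lkk)
  (linear_lincomb c (fmod_ext_linear lk) (fmod_ext_linear lk'))) => x v.
by rewrite !fmod_ext_delta.
Qed.

Lemma fmod_extD (M : lmodType rat) (k k' : X -> V -> M) u :
    (forall x, linear (k x)) -> (forall x, linear (k' x)) ->
  fmod_ext (fun x v => k x v + k' x v) u = fmod_ext k u + fmod_ext k' u.
Proof.
move=> lk lk'; rewrite -[fmod_ext k u]scale1r -fmod_ext_lincomb//.
by apply: eq_fmod_ext => x v; rewrite scale1r.
Qed.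

End FreeModules.

Lemma deltaE (X : choiceType) (x : X) (c : rat^o) :
  delta x c = c *: basis x :> freemod X.
Proof. by rewrite -(linZ (@delta_linear X rat^o x)) [_ *: _]mulr1. Qed.

Lemma freemod_ind (X : choiceType) (P : freemod X -> Prop) :
  P 0 -> (forall c x u, P u -> P (c *: basis x + u)) -> forall u, P u.
Proof. by move=> P0 PS; apply: fmod_ind => // x c u /PS; rewrite deltaE; apply. Qed.

Lemma freemod_eq (X : choiceType) (M : lmodType rat) (f h : freemod X -> M) :
  linear f -> linear h -> (forall x, f (basis x) = h (basis x)) -> f =1 h.
Proof.
by move=> lf lh fh; apply: fmod_eq => // x c; rewrite deltaE !linZ// fh.
Qed.

Lemma linext_linear (X : choiceType) (V : lmodType rat) (h : X -> V) :
  linear (linext h).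
Proof. exact: linearP. Qed.

Lemma lin_linext (X : choiceType) (U V : lmodType rat) (f : U -> V) (h : X -> U) u :
  linear f -> f (linext h u) = linext (fun x => f (h x)) u.
Proof. by move=> lf; rewrite -(linear_linext (linear_pack lf)). Qed.

Lemma linext_lincomb (X : choiceType) (V : lmodType rat) (h k : X -> V) c u :
  linext (fun x => c *: h x + k x) u = c *: linext h u + linext k u.
Proof.
have lr : linear (fun u => c *: linext h u + linext k u).
  by apply: linear_lincomb; apply: linext_linear.
by apply: (freemod_eq (linext_linear _) lr) => x; rewrite !linextU.
Qed.

Lemma linextD (X : choiceType) (V : lmodType rat) (h k : X -> V) u :
  linext (fun x => h x + k x) u = linext h u + linext k u.
Proof.
rewrite -[linext h u]scale1r -linext_lincomb.
by apply: eq_linext => x; rewrite scale1r.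
Qed.

Lemma linext0 (X : choiceType) (V : lmodType rat) u :
  linext (fun _ : X => 0 : V) u = 0.
Proof.
rewrite -(lin_linext (fun _ => 0 : V) u (@linear_zero V V)).
exact.
Qed.

Lemma linextN (X : choiceType) (V : lmodType rat) (h : X -> V) u :
  linext (fun x => - h x) u = - linext h u.
Proof. by rewrite -(@lin_linext _ _ _ -%R)//; apply: linear_opp => c v w. Qed.

Lemma linext_sum (X : choiceType) (V : lmodType rat) (I : Type) (r : seq I)
    (h : I -> X -> V) u :
  linext (fun x => \sum_(i <- r) h i x) u = \sum_(i <- r) linext (h i) u.
Proof.
elim: r => [|i r ih].
  by rewrite big_nil -[RHS](linext0 V u); apply: eq_linext => y; rewrite big_nil.
by rewrite big_cons -ih -linextD; apply: eq_linext => y; rewrite big_cons.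
Qed.

Lemma linextB (X : choiceType) (V : lmodType rat) (h k : X -> V) u :
  linext (fun x => h x - k x) u = linext h u - linext k u.
Proof. by rewrite linextD linextN. Qed.

Lemma linext_comp (X Y : choiceType) (V : lmodType rat) (h : Y -> V) (k : X -> freemod Y) u :
  linext h (linext k u) = linext (fun x => linext h (k x)) u.
Proof. by rewrite (lin_linext _ _ (@linext_linear _ _ h)). Qed.

Lemma linext_basis (X Y : choiceType) (V : lmodType rat) (h : Y -> V) (k : X -> Y) u :
  linext h (linext (fun x => basis (k x)) u) = linext (fun x => h (k x)) u.
Proof. by rewrite linext_comp; apply: eq_linext => x; rewrite linextU. Qed.

Lemma exchange_linext (X Y : choiceType) (V : lmodType rat) (h : X -> Y -> V) u v :
  linext (fun x => linext (h x) v) u = linext (fun y => linext (h^~ y) u) v.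
Proof.
have lr : linear (fun u => linext (fun y => linext (h^~ y) u) v).
  move=> c u1 u2; rewrite -linext_lincomb; apply: eq_linext => y.
  exact: linext_linear.
apply: (freemod_eq (linext_linear _) lr) => x.
by rewrite linextU; apply: eq_linext => y; rewrite linextU.
Qed.

Lemma linext_rot (X Y Z : choiceType) (V : lmodType rat) (h : X -> Y -> Z -> V) u v w :
  linext (fun b => linext (fun c => linext (fun a => h a b c) u) w) v =
  linext (fun a => linext (fun b => linext (h a b) w) v) u.
Proof.
rewrite -(exchange_linext (fun b a => linext (h a b) w) v u).
apply: eq_linext => b.
exact: (exchange_linext (fun c a => h a b c) w u).
Qed.

Section Quotients.
Context (V M : lmodType rat) (S : set V) (f : V -> M).
Hypotheses (lf : linear f) (fS : forall v, S v -> f v = 0).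

Lemma span_vanish v : span S v -> f v = 0.
Proof. by elim=> [|c u w /fS fu _ fw]; rewrite ?lin0// lf fu fw scaler0 addr0. Qed.

Lemma quot_extE v : f (rep (cls S v)) = f v.
Proof.
by apply/eqP; rewrite -subr_eq0 -linB//; apply/eqP/span_vanish/span_rep.
Qed.

Lemma quot_ext_linear : linear (fun x : quotmod S => f (rep x)).
Proof.
move=> c x y; rewrite -{1}(repK x) -{1}(repK y).
rewrite -(cls_is_linear S c (rep x) (rep y)).
by rewrite quot_extE lf.
Qed.

End Quotients.

Lemma clsS (V : lmodType rat) (S : set V) v : S v -> cls S v = 0.
Proof.
move=> Sv; rewrite -(linear0 (cls S)); apply/clsP.
by rewrite subr0; apply: span_gen.
Qed.

Lemma spanS (V : lmodType rat) (S T : set V) v : 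
  (forall u, S u -> span T u) -> span S v -> span T v.
Proof.
move=> ST; elim=> [|c u w /ST Tu _ Tw]; first exact: span0.
by apply: spanD => //; apply: spanZ.
Qed.

Lemma spanN (V : lmodType rat) (S : set V) v : span S v -> span S (- v).
Proof. by move=> /(spanZ (-1)); rewrite scaleN1r. Qed.

Lemma span_sum (V : lmodType rat) (S : set V) I (r : seq I) (P : pred I) F :
  (forall i, P i -> span S (F i)) -> span S (\sum_(i <- r | P i) F i).
Proof.
by move=> h; apply: big_ind => //; [exact: span0 | exact: spanD].
Qed.

Lemma span_linext (X : choiceType) (V : lmodType rat) (S : set V) (h : X -> V) u :
  (forall x, span S (h x)) -> span S (linext h u).
Proof.
move=> hS; elim/freemod_ind: u => [|c x u ih].
  by rewrite linear0; apply: span0.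
by rewrite (linext_linear h) linextU; apply: spanD => //; apply: spanZ.
Qed.

Lemma span_image (U V : lmodType rat) (S : set U) (T : set V) (f : U -> V) u :
    linear f -> (forall v, S v -> span T (f v)) ->
  span S u -> span T (f u).
Proof.
move=> lf fS; elim=> [|c v w /fS Tv _ Tw]; first by rewrite lin0//; apply: span0.
by rewrite lf; apply: spanD => //; apply: spanZ.
Qed.

(** This is how gradings are shown to be direct: their pieces are eigenspaces of
    an operator that multiplies by the degree. Applying [f - c ord_max] to the sum
    removes its last term. *)
Lemma eigen_indep (V : lmodType rat) (f : V -> V) n (u : 'I_n -> V) (c : 'I_n -> rat) :
    linear f -> injective c -> (forall i, f (u i) = c i *: u i) ->
  \sum_i u i = 0 -> forall i, u i = 0.
Proof.
move=> lf cinj; elim: n u c cinj => [|n ih] u c cinj fu su; first by case.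
have widenE (j : 'I_n) : widen_ord (leqnSn n) j = lift ord_max j.
  by apply: val_inj; rewrite /= /bump leqNgt ltn_ord.
have um i : u (lift ord_max i) = 0.
  have : (c (lift ord_max i) - c ord_max) *: u (lift ord_max i) = 0.
    apply: (ih (fun i => (c (lift ord_max i) - c ord_max) *: u (lift ord_max i))
               (fun i => c (lift ord_max i))).
    - by move=> j k /cinj /lift_inj.
    - by move=> j; rewrite linZ// fu !scalerA mulrC.
    - have : f (\sum_i u i) - c ord_max *: \sum_i u i = 0.
        by rewrite su lin0// scaler0 subr0.
      rewrite (lin_sum lf) scaler_sumr -sumrB.
      under eq_bigr do rewrite fu -scalerBl.
      rewrite big_ord_recr/= subrr scale0r addr0 => E; rewrite -[RHS]E.
      by apply: eq_bigr => j _; rewrite widenE.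
  move/eqP; rewrite scaler_eq0 subr_eq0 => /orP[/eqP/cinj/eqP|/eqP//].
  by rewrite eq_sym (negbTE (neq_lift _ _)).
move=> i; case: (unliftP ord_max i) => [j ->|->]; first exact: um.
move: su; rewrite big_ord_recr/= big1 ?add0r// => k _.
by rewrite widenE um.
Qed.
(** * A decision procedure for identities between signed sums *)

Inductive zexpr : Type :=
| ZZero
| ZVar of nat
| ZAdd of zexpr & zexpr
| ZOpp of zexpr.

Fixpoint zeval (V : zmodType) (s : seq V) (e : zexpr) : V :=
  match e with
  | ZZero => 0
  | ZVar i => s`_i
  | ZAdd e1 e2 => zeval s e1 + zeval s e2
  | ZOpp e1 => - zeval s e1
  end.

Fixpoint zcoef (e : zexpr) (i : nat) : int :=
  match e with
  | ZZero => 0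
  | ZVar j => (i == j)%:R
  | ZAdd e1 e2 => zcoef e1 i + zcoef e2 i
  | ZOpp e1 => - zcoef e1 i
  end.

Lemma zevalE (V : zmodType) (s : seq V) e :
  zeval s e = \sum_(i < size s) s`_i *~ zcoef e i.
Proof.
elim: e => [|j|e1 ih1 e2 ih2|e ih] /=.
- by rewrite big1 => // i _; rewrite mulr0z.
- have [js|sj] := ltnP j (size s).
    rewrite (bigD1 (Ordinal js))//= eqxx mulr1z big1 ?addr0// => i.
    by rewrite -val_eqE/= => /negbTE ->; rewrite mulr0z.
  rewrite nth_default// big1// => i _; rewrite ltn_eqF ?mulr0z//.
  exact: leq_trans (ltn_ord i) sj.
- by rewrite ih1 ih2 -big_split/=; apply: eq_bigr => i _; rewrite mulrzDr.
- by rewrite ih -sumrN; apply: eq_bigr => i _; rewrite mulrNz.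
Qed.

Lemma zeval_eq (V : zmodType) (s : seq V) n e1 e2 : size s = n ->
    all (fun i => zcoef e1 i == zcoef e2 i) (iota 0 n) ->
  zeval s e1 = zeval s e2.
Proof.
move=> <- /allP h; rewrite !zevalE; apply: eq_bigr => i _.
by rewrite (eqP (h i _))// mem_iota add0n ltn_ord.
Qed.

(* The two scalings may go through different instances on the same module. *)
Ltac zmod_same a b :=
  first [ constr_eq a b
        | lazymatch a with @GRing.scale _ _ ?c ?v =>
            lazymatch b with @GRing.scale _ _ ?d ?w =>
              unify c d; zmod_same v w end end ].

Ltac zmod_index s v :=
  lazymatch s with
  | ?w :: ?t => match constr:(tt) with
      | _ => let _ := match constr:(tt) with _ => zmod_same w v end in constr:(0%N)
      | _ => let i := zmod_index t v in constr:(i.+1)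
      end
  end.

Ltac zmod_add s v :=
  match constr:(tt) with
  | _ => let i := zmod_index s v in constr:(s)
  | _ => constr:(v :: s)
  end.

Ltac zmod_atoms s e :=
  lazymatch e with
  | ?a + ?b => let s1 := zmod_atoms s a in zmod_atoms s1 b
  | - ?a => zmod_atoms s a
  | 0 => constr:(s)
  | _ => zmod_add s e
  end.

Ltac zmod_reify s e :=
  lazymatch e with
  | ?a + ?b => let x := zmod_reify s a in let y := zmod_reify s b in
               constr:(ZAdd x y)
  | - ?a => let x := zmod_reify s a in constr:(ZOpp x)
  | 0 => constr:(ZZero)
  | _ => let i := zmod_index s e in constr:(ZVar i)
  end.

Ltac zmod_size s :=
  lazymatch s with
  | _ :: ?t => let n := zmod_size t in constr:(n.+1)
  | _ => constr:(0%N)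
  end.

(** Both sides are reified as integer combinations of the same atoms, and their
    coefficients are compared by computation. *)
Ltac zmod :=
  cbv beta;
  lazymatch goal with
  | |- @eq ?T ?l ?r =>
    let s0 := zmod_atoms (@nil T) l in
    let s := zmod_atoms s0 r in
    let e1 := zmod_reify s l in
    let e2 := zmod_reify s r in
    let n := zmod_size s in
    refine (@zeval_eq _ s n e1 e2 erefl _); vm_compute; reflexivity
  end.

(** * The free Lie algebra *)

(** Locked copies of the operations of the free Lie algebra: unification would
    otherwise compare them by unfolding the quotient. *)
HB.lock Definition lbr (W : lmodType rat) (x y : freeLie W) : freeLie W := lie_br x y.
HB.lock Definition lgen (W : lmodType rat) (w : W) : freeLie W := lie_gen w.
HB.lock Definition lmap (W : lmodType rat) (h : W -> W) (x : freeLie W) : freeLie W :=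
  lie_map h x.

Notation "{[ a , b ]}" := (lbr a b) (at level 0, format "{[ a ,  b ]}").

Section FreeLieAlgebra.
Context (W : lmodType rat).
Notation L := (freeLie W).
Notation pi := (cls (@lie_ideal W)).

Lemma lbrE u v : {[pi u, pi v]} = pi (mag_mul u v).
Proof. by rewrite lbr.unlock lie_brE. Qed.

Lemma lgenE w : lgen w = pi (basis (MLeaf w)).
Proof. by rewrite lgen.unlock. Qed.

Fixpoint word (t : mag W) : L :=
  match t with
  | MLeaf w => lgen w
  | MNode s t => {[word s, word t]}
  end.

Lemma wordE t : word t = pi (basis t).
Proof.
elim: t => [w|s ihs t iht] /=; first exact: lgenE.
by rewrite ihs iht lbrE /mag_mul !linextU.
Qed.

Lemma lgen_linear : linear (@lgen W).
Proof.
move=> c v w; apply/eqP; rewrite -subr_eq0; apply/eqP.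
rewrite !lgenE -linearP -linearB; exact/clsS/lie_linear.
Qed.

Lemma lbr_bilinear : bilinear_map (@lbr W).
Proof.
have [ml mr] := mag_mul_bilinear W; split=> v c x y.
  rewrite -(repK x) -(repK y) -(repK v) -linearP !lbrE ml.
  exact: linearP.
rewrite -(repK x) -(repK y) -(repK v) -linearP !lbrE mr.
exact: linearP.
Qed.

Lemma lbrxx x : {[x, x]} = 0 :> L.
Proof. by rewrite -(repK x) lbrE; apply/clsS/lie_alt. Qed.

Lemma lbrC x y : {[x, y]} = - {[y, x]} :> L.
Proof.
apply/eqP; rewrite -addr_eq0; apply/eqP; have := lbrxx (x + y).
rewrite (bilDl lbr_bilinear) !(bilDr lbr_bilinear) !lbrxx.
by rewrite add0r addr0.
Qed.

Lemma lbr_jacobi x y z :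
  {[x, {[y, z]}]} + {[y, {[z, x]}]} + {[z, {[x, y]}]} = 0 :> L.
Proof.
have := clsS (lie_jacobi (rep x) (rep y) (rep z)).
by rewrite !(linD (@cls_is_linear _ (@lie_ideal W))) -!lbrE !repK.
Qed.

Lemma lbr_jacl x y z :
  {[{[x, y]}, z]} = {[x, {[y, z]}]} + {[y, {[z, x]}]} :> L.
Proof.
have := lbr_jacobi x y z; rewrite [{[{[x, y]}, z]}]lbrC => /eqP.
by rewrite addr_eq0 => /eqP.
Qed.

Lemma word_ind (P : L -> Prop) :
    P 0 -> (forall c x y, P x -> P y -> P (c *: x + y)) -> (forall t, P (word t)) ->
  forall x, P x.
Proof.
move=> P0 PL Pw x; rewrite -(repK x).
elim/freemod_ind: (rep x) => [|c t u ih]; first by rewrite linear0.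
by rewrite (@cls_is_linear _ (@lie_ideal W)) -wordE; apply: PL.
Qed.

Lemma word_eq (M : lmodType rat) (f h : L -> M) : linear f -> linear h ->
  (forall t, f (word t) = h (word t)) -> f =1 h.
Proof.
move=> lf lh fh; apply: word_ind => //; first by rewrite !lin0.
by move=> c x y fx fy; rewrite lf lh fx fy.
Qed.

Lemma lie_ind (P : L -> Prop) :
    P 0 -> (forall c x y, P x -> P y -> P (c *: x + y)) ->
    (forall w, P (lgen w)) -> (forall x y, P x -> P y -> P {[x, y]}) ->
  forall x, P x.
Proof.
move=> P0 PL Pg Pb; apply: word_ind => //.
by elim=> [w|s ihs t iht]; [exact: Pg|exact: Pb].
Qed.

(** The recursion on brackets is left open, so as to cover morphisms and
    derivations alike. *)
Lemma lie_eq (M : lmodType rat) (f h : L -> M) : linear f -> linear h ->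
    (forall w, f (lgen w) = h (lgen w)) ->
    (forall x y, f x = h x -> f y = h y -> f {[x, y]} = h {[x, y]}) ->
  f =1 h.
Proof.
move=> lf lh fg fb; apply: lie_ind => //; first by rewrite !lin0.
by move=> c x y fx fy; rewrite lf lh fx fy.
Qed.

End FreeLieAlgebra.

(** ** Derivations into a representation *)

Fixpoint mag_der (W N : lmodType rat) (act : freeLie W -> N -> N) (h : W -> N)
    (t : mag W) : N :=
  match t with
  | MLeaf w => h w
  | MNode s t => act (word s) (mag_der act h t) - act (word t) (mag_der act h s)
  end.

(** The derivation with values in the representation [act] of the free Lie algebra
    that extends [h]. *)
HB.lock Definition lie_der (W N : lmodType rat) (act : freeLie W -> N -> N)
    (h : W -> N) (x : freeLie W) : N := linext (mag_der act h) (rep x).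

(** The laws of a representation are only asked on a subspace [S]: for the sums over
    leaves below, [N] consists of all functions on a representation, and the laws
    hold for the linear ones. *)
Section DerivationExtension.
Context (W N : lmodType rat) (act : freeLie W -> N -> N) (S : set N) (h : W -> N).
Notation L := (freeLie W).
Notation pi := (cls (@lie_ideal W)).
Notation mag_der := (mag_der act h).
Notation lie_der := (lie_der act h).
Hypotheses (S0 : S 0) (SL : forall c n n', S n -> S n' -> S (c *: n + n')).
Hypothesis Sact : forall x n, S n -> S (act x n).
Hypothesis act_linr : forall x, linear (act x).
Hypothesis act_linl : forall n, S n -> linear (act^~ n).
Hypothesis act_br : forall x y n, S n ->
  act {[x, y]} n = act x (act y n) - act y (act x n).
Hypotheses (Sh : forall w, S (h w)) (lh : linear h).

Let D := linext mag_der.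

Let SB n n' : S n -> S n' -> S (n - n').
Proof. by move=> Sn Sn'; rewrite addrC -scaleN1r; apply: SL. Qed.

Let Smag t : S (mag_der t).
Proof. by elim: t => //= s ihs t iht; apply: SB; apply: Sact. Qed.

Let SD u : S (D u).
Proof.
elim/freemod_ind: u => [|c t u ih]; first by rewrite /D linear0.
by rewrite /D (linext_linear mag_der) linextU; apply: SL.
Qed.

Let D_mul u v : D (mag_mul u v) = act (pi u) (D v) - act (pi v) (D u).
Proof.
have [ml mr] := mag_mul_bilinear W; have lD := linext_linear mag_der.
have lact v' : linear (fun u => act (pi u) (D v')).
  exact: (linear_comp (act_linl (SD v')) (cls_is_linear _)).
have lact' v' : linear (fun u => act (pi v') (D u)).
  exact: (linear_comp (act_linr _) lD).
have lmul v' : linear (fun u => act (pi u) (D v') - act (pi v') (D u)).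
  exact: (linear_add (lact v') (linear_opp (lact' v'))).
have lmul' u' : linear (fun v => act (pi u') (D v) - act (pi v) (D u')).
  exact: (linear_add (lact' u') (linear_opp (lact u'))).
apply: (freemod_eq (linear_comp lD (ml v)) (lmul v)) => s.
apply: (freemod_eq (linear_comp lD (mr (basis s))) (lmul' _)) => t.
by rewrite /mag_mul /D !linextU /= !wordE.
Qed.

(* The Jacobi relation is sent to zero because [act] represents brackets. *)
Let D_ideal u : lie_ideal u -> D u = 0.
Proof.
have act0 n : S n -> act 0 n = 0 by move=> Sn; exact: (lin0 (act_linl Sn)).
have actD n x y : S n -> act (x + y) n = act x n + act y n.
  by move=> Sn; exact: (linD (act_linl Sn)).
have lD : linear D := linext_linear mag_der.
elim=> {u} [c v w|u|u v w|u v Iv Dv|u v Iu Du].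
- by rewrite /D linearB linearD linearZ_LR /= !linextU /= lh subrr.
- by rewrite D_mul subrr.
- rewrite !(linD lD) !D_mul -!lbrE.
  rewrite !(act_br _ _ (SD _)) !(linB (act_linr _)).
  zmod.
- by rewrite D_mul Dv lin0// clsS// act0 ?subrr.
- by rewrite D_mul Du lin0// clsS// act0 ?subrr.
Qed.

Lemma lie_der_linear : linear lie_der.
Proof. rewrite lie_der.unlock; exact: (quot_ext_linear (linext_linear mag_der) D_ideal). Qed.

Lemma lie_der_gen w : lie_der (lgen w) = h w.
Proof.
by rewrite lie_der.unlock lgenE (quot_extE (linext_linear mag_der) D_ideal) linextU.
Qed.

Lemma lie_der_br x y :
  lie_der {[x, y]} = act x (lie_der y) - act y (lie_der x).
Proof.
rewrite -{1}(repK x) -{1}(repK y) lbrE.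
by rewrite lie_der.unlock (quot_extE (linext_linear mag_der) D_ideal) -/D D_mul !repK.
Qed.

Lemma lie_der_stable x : S (lie_der x).
Proof. by rewrite lie_der.unlock; apply: SD. Qed.

End DerivationExtension.

(** ** Derivations of the free Lie algebra and its grading *)

Definition is_lie_derivation (W : lmodType rat) (d : freeLie W -> freeLie W) :=
  linear d /\ forall x y, d {[x, y]} = {[d x, y]} + {[x, d y]}.

Section LieDerivations.
Context (W : lmodType rat).
Notation L := (freeLie W).

Definition lie_derivation (h : W -> L) : L -> L := lie_der (@lbr W) h.

Section Extension.
Context (h : W -> L).
Hypothesis lh : linear h.

Let act_br (x y n : L) : setT n -> {[{[x, y]}, n]} = {[x, {[y, n]}]} - {[y, {[x, n]}]}.
Proof. by move=> _; rewrite lbr_jacl [{[n, x]}]lbrC (bilNr (lbr_bilinear W)). Qed.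

Lemma lie_derivation_gen w : lie_derivation h (lgen w) = h w.
Proof.
by apply: (@lie_der_gen W L _ setT) => //; case: (lbr_bilinear W).
Qed.

Lemma lie_derivationP : is_lie_derivation (lie_derivation h).
Proof.
have [bl br] := lbr_bilinear W; split=> [|x y].
  exact: (@lie_der_linear W L _ setT).
rewrite /lie_derivation (@lie_der_br W L _ setT)//.
by rewrite [{[y, _]}]lbrC opprK addrC.
Qed.

End Extension.

Lemma lie_derivation_eq (d d' : L -> L) :
    is_lie_derivation d -> is_lie_derivation d' ->
  (forall w, d (lgen w) = d' (lgen w)) -> d =1 d'.
Proof.
move=> [ld db] [ld' db'] dd'; apply: lie_eq => // x y dx dy.
by rewrite db db' dx dy.
Qed.

Lemma is_lie_derivation_lincomb c (d d' : L -> L) :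
    is_lie_derivation d -> is_lie_derivation d' ->
  is_lie_derivation (fun x => c *: d x + d' x).
Proof.
have lb := lbr_bilinear W; move=> [ld db] [ld' db'].
split=> [|x y]; first exact: linear_lincomb.
rewrite db db' !scalerDr (bilDl lb) (bilDr lb) (bilZl lb) (bilZr lb).
by rewrite addrACA.
Qed.

Lemma lie_deg_word (t : mag W) : lie_deg (mag_size t) (word t).
Proof. by rewrite wordE; apply: span_gen; exists t. Qed.

Lemma lie_deg_ind n (P : L -> Prop) :
    P 0 -> (forall c x y, P x -> P y -> P (c *: x + y)) ->
    (forall t, mag_size t = n -> P (word t)) ->
  forall x, lie_deg n x -> P x.
Proof.
move=> P0 PL Pw x; elim=> // c u v [t tn <-] _ Pv.
by apply: PL => //; rewrite -wordE; exact: Pw.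
Qed.

Lemma lie_deg_gen (w : W) : lie_deg 1 (lgen w).
Proof. exact: (lie_deg_word (MLeaf w)). Qed.

Lemma lie_deg_br m n (x y : L) :
  lie_deg m x -> lie_deg n y -> lie_deg (m + n) {[x, y]}.
Proof.
have lb := lbr_bilinear W => dx dy; move: x dx.
apply: lie_deg_ind => [|c x x' dx dx'|s sm].
- by rewrite (bil0l lb); apply: span0.
- by rewrite lb.1; apply: spanD => //; apply: spanZ.
move: y dy; apply: lie_deg_ind => [|c y y' dy dy'|t tn].
- by rewrite (bil0r lb); apply: span0.
- by rewrite lb.2; apply: spanD => //; apply: spanZ.
by rewrite -sm -tn; apply: lie_deg_word (MNode s t).
Qed.

Definition euler : L -> L := lie_derivation (@lgen W).

Lemma eulerP : is_lie_derivation euler.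
Proof. exact/lie_derivationP/lgen_linear. Qed.

Lemma euler_gen w : euler (lgen w) = lgen w.
Proof. exact/lie_derivation_gen/lgen_linear. Qed.

Lemma euler_deg n x : lie_deg n x -> euler x = n%:R *: x.
Proof.
have [le eb] := eulerP; have lb := lbr_bilinear W.
move: x; apply: lie_deg_ind => [|c x y ex ey|t <-].
- by rewrite lin0// scaler0.
- by rewrite le ex ey scalerDr !scalerA mulrC.
elim: t => [w|s ihs t iht]; first by rewrite euler_gen scale1r.
rewrite /= eb ihs iht (bilZl lb) (bilZr lb) -scalerDl.
by rewrite -natrD.
Qed.

End LieDerivations.
(** * Sums over the leaves of a tree *)

Section LeafSumsInModule.
Context (W Q M : lmodType rat) (mu : freeLie W -> Q -> Q) (G : W -> Q -> M).
Notation L := (freeLie W).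
Hypotheses (hmu : bilinear_map mu) (hG : bilinear_map G).
Hypothesis mu_br : forall x y q, mu {[x, y]} q = mu x (mu y q) - mu y (mu x q).

(** The derivation extending [G], with values in the contragredient of [Q]. When
    [Q] is the Lie algebra itself, this is a sum over leaves; enlarging [Q] allows to
    plant words on other objects. *)
Definition mod_leaf_sum : L -> Q -> M :=
  lie_der (N := (Q -> M)) (fun x n q => - n (mu x q)) G.

Let N : lmodType rat := (Q -> M).
Let act (x : L) (n : N) : N := fun q => - n (mu x q).
Let S : set N := [set n | linear n].

Let S0 : S 0. Proof. exact: linear_zero. Qed.
Let SL c n n' : S n -> S n' -> S (c *: n + n').
Proof. exact: linear_lincomb. Qed.
Let Sact x n : S n -> S (act x n).
Proof. by move=> Sn; apply/linear_opp/(linear_comp Sn)/hmu.2. Qed.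
Let act_linr x : linear (act x).
Proof. by move=> c n n'; apply/funext => q; rewrite /act /= opprD scalerN. Qed.
Let act_linl n : S n -> linear (act^~ n).
Proof.
by move=> Sn c x y; apply/funext => q; rewrite /act hmu.1 Sn opprD scalerN.
Qed.
Let act_br x y n : S n -> act {[x, y]} n = act x (act y n) - act y (act x n).
Proof.
move=> Sn; apply/funext => q; rewrite /act mu_br (linB Sn) opprB.
by rewrite -[RHS]/(- - _ - - - _) !opprK.
Qed.
Let SG w : S (G w). Proof. exact: hG.2. Qed.
Let lG : linear (G : W -> N).
Proof. by move=> c v w; apply/funext => q; apply: hG.1. Qed.

Lemma mod_leaf_sum_gen w q : mod_leaf_sum (lgen w) q = G w q.
Proof.
have := lie_der_gen S0 SL Sact act_linr act_linl act_br SG lG w.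
by move/(congr1 (fun n => n q)).
Qed.

Lemma mod_leaf_sum_br x y q :
  mod_leaf_sum {[x, y]} q = mod_leaf_sum x (mu y q) - mod_leaf_sum y (mu x q).
Proof.
have := lie_der_br S0 SL Sact act_linr act_linl act_br SG lG x y.
move/(congr1 (fun n => n q)); rewrite -/mod_leaf_sum => ->.
by rewrite addrC -[LHS]/(- - _ - _) opprK.
Qed.

Lemma mod_leaf_sum_bilinear : bilinear_map mod_leaf_sum.
Proof.
split=> [q c x y|x].
  have := lie_der_linear S0 SL Sact act_linr act_linl act_br SG lG c x y.
  by move/(congr1 (fun n => n q)).
exact: (lie_der_stable S0 SL Sact SG x).
Qed.

End LeafSumsInModule.

Section LeafSums.
Context (W : lmodType rat).
Notation L := (freeLie W).
Let lb := lbr_bilinear W.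

Let lie_mod (x y q : L) : {[{[x, y]}, q]} = {[x, {[y, q]}]} - {[y, {[x, q]}]}.
Proof. by rewrite lbr_jacl [{[q, x]}]lbrC (bilNr lb). Qed.

Section Definitions.
Context (M : lmodType rat) (G : W -> L -> M).

(** If the Lie word [p] is a tree with a root, and [q] is planted at the root,
    this is the sum of [G v t] over the leaves [v] of [p], where [t] is the rest
    of the tree, rooted at [v]. *)
Definition leaf_sum : L -> L -> M := mod_leaf_sum (@lbr W) G.

(** The sum over all the leaves of the tree that joins the roots of [p], [q]. *)
Definition tree_sum (p q : L) : M := leaf_sum p q + leaf_sum q p.

End Definitions.

Section Basics.
Context (M : lmodType rat) (G : W -> L -> M).
Hypothesis hG : bilinear_map G.

Lemma leaf_sum_gen w q : leaf_sum G (lgen w) q = G w q.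
Proof. exact: mod_leaf_sum_gen. Qed.

Lemma leaf_sum_bilinear : bilinear_map (leaf_sum G).
Proof. exact: mod_leaf_sum_bilinear. Qed.

Lemma leaf_sum_br x y q :
  leaf_sum G {[x, y]} q = leaf_sum G x {[y, q]} + leaf_sum G y {[q, x]}.
Proof.
rewrite [{[q, x]}]lbrC (bilNr leaf_sum_bilinear).
exact: mod_leaf_sum_br.
Qed.

Lemma leaf_sum_eq (E : L -> L -> M) :
    (forall q, linear (E^~ q)) -> (forall w q, E (lgen w) q = G w q) ->
    (forall x y q, E {[x, y]} q = E x {[y, q]} + E y {[q, x]}) ->
  forall p q, E p q = leaf_sum G p q.
Proof.
move=> lE Eg Eb; have ll := leaf_sum_bilinear; elim/lie_ind => [q|c x y ex ey q|w q|x y ex ey q].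
- by rewrite (lin0 (lE q)) (bil0l ll).
- by rewrite lE ll.1 ex ey.
- by rewrite Eg leaf_sum_gen.
- by rewrite Eb leaf_sum_br ex ey.
Qed.

Lemma tree_sum_sym p q : tree_sum G p q = tree_sum G q p.
Proof. exact: addrC. Qed.

Lemma tree_sum_bilinear : bilinear_map (tree_sum G).
Proof.
have [ll lr] := leaf_sum_bilinear.
by split=> v; apply: linear_add.
Qed.

(** Both sides run over the leaves of the tree with three branches x, y, z. *)
Lemma tree_sum_invariant x y z :
  tree_sum G {[x, y]} z = tree_sum G x {[y, z]}.
Proof. by rewrite /tree_sum !leaf_sum_br addrA. Qed.

End Basics.

Lemma eq_leaf_sum (M : lmodType rat) (G G' : W -> L -> M) p q :
  (forall w q, G w q = G' w q) -> leaf_sum G p q = leaf_sum G' p q.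
Proof. by move=> e; have -> : G = G' by apply/funext => w; apply/funext => t. Qed.

Lemma eq_tree_sum (M : lmodType rat) (G G' : W -> L -> M) p q :
  (forall w q, G w q = G' w q) -> tree_sum G p q = tree_sum G' p q.
Proof. by move=> e; rewrite /tree_sum !(eq_leaf_sum _ _ e). Qed.

Section Operations.
Context (M M' : lmodType rat) (G G' : W -> L -> M) (f : M -> M').
Hypotheses (hG : bilinear_map G) (hG' : bilinear_map G') (lf : linear f).

Lemma leaf_sum_lincomb c p q :
  leaf_sum (fun w q => c *: G w q + G' w q) p q =
  c *: leaf_sum G p q + leaf_sum G' p q.
Proof.
have [l r] := leaf_sum_bilinear hG; have [l' r'] := leaf_sum_bilinear hG'.
have hGG' : bilinear_map (fun w q => c *: G w q + G' w q).
  have [? ?] := hG; have [? ?] := hG'.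
  by split=> v; apply: linear_lincomb.
apply/esym/(@leaf_sum_eq _ _ hGG' (fun p q => c *: leaf_sum G p q + leaf_sum G' p q)) => //.
- by move=> v; apply: linear_lincomb.
- by move=> w t; rewrite !leaf_sum_gen.
- by move=> x y t; rewrite !leaf_sum_br// !scalerDr; zmod.
Qed.

Lemma leaf_sum_comp p q : leaf_sum (fun w q => f (G w q)) p q = f (leaf_sum G p q).
Proof.
have [l r] := leaf_sum_bilinear hG.
have hfG : bilinear_map (fun w q => f (G w q)).
  by have [? ?] := hG; split=> v; apply: linear_comp.
apply/esym/(@leaf_sum_eq _ _ hfG (fun p q => f (leaf_sum G p q))) => //.
- by move=> v; apply: linear_comp.
- by move=> w t; rewrite !leaf_sum_gen.
- by move=> x y t; rewrite leaf_sum_br// linD.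
Qed.

Lemma tree_sum_lincomb c p q :
  tree_sum (fun w q => c *: G w q + G' w q) p q =
  c *: tree_sum G p q + tree_sum G' p q.
Proof. by rewrite /tree_sum !leaf_sum_lincomb scalerDr addrACA. Qed.

Lemma tree_sum_comp p q : tree_sum (fun w q => f (G w q)) p q = f (tree_sum G p q).
Proof. by rewrite /tree_sum !leaf_sum_comp linD. Qed.

End Operations.

Lemma tree_sumD (M : lmodType rat) (G G' : W -> L -> M) p q :
    bilinear_map G -> bilinear_map G' ->
  tree_sum (fun w q => G w q + G' w q) p q = tree_sum G p q + tree_sum G' p q.
Proof.
move=> hG hG'; rewrite -[tree_sum G p q]scale1r -tree_sum_lincomb//.
by apply: eq_tree_sum => w t; rewrite scale1r.
Qed.

Lemma tree_sumB (M : lmodType rat) (G G' : W -> L -> M) p q :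
    bilinear_map G -> bilinear_map G' ->
  tree_sum (fun w q => G w q - G' w q) p q = tree_sum G p q - tree_sum G' p q.
Proof.
move=> hG hG'; rewrite [RHS]addrC -scaleN1r -tree_sum_lincomb//.
by apply: eq_tree_sum => w t; rewrite scaleN1r addrC.
Qed.

Lemma tree_sum_sum (M : lmodType rat) n (G : 'I_n -> W -> L -> M) p q :
    (forall i, bilinear_map (G i)) ->
  tree_sum (fun w q => \sum_i G i w q) p q = \sum_i tree_sum (G i) p q.
Proof.
move=> hG; have hS : bilinear_map (fun w q => \sum_i G i w q).
  by split=> v; apply: linear_bigsum => i; have [l r] := hG i.
have sE y z : \sum_i leaf_sum (G i) y z = leaf_sum (fun w q => \sum_i G i w q) y z.
  apply: (leaf_sum_eq hS (E := fun y z => \sum_i leaf_sum (G i) y z)) => [t|w t|u v t].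
  - by apply: linear_bigsum => i; have [l r] := leaf_sum_bilinear (hG i).
  - by apply: eq_bigr => i _; rewrite leaf_sum_gen.
  - by rewrite -big_split; apply: eq_bigr => i _; rewrite leaf_sum_br.
by rewrite /tree_sum -!sE -big_split.
Qed.

Lemma tree_sum_linext (X : choiceType) (M : lmodType rat) (G : X -> W -> L -> M) z p q :
    (forall i, bilinear_map (G i)) ->
  tree_sum (fun w q => linext (fun i => G i w q) z) p q =
  linext (fun i => tree_sum (G i) p q) z.
Proof.
move=> hG; have hS : bilinear_map (fun w q => linext (fun i => G i w q) z).
  split=> v c u u'; rewrite -linext_lincomb; apply: eq_linext => i.
    exact: (hG i).1.
  exact: (hG i).2.
have sE y t : linext (fun i => leaf_sum (G i) y t) z =
    leaf_sum (fun w q => linext (fun i => G i w q) z) y t.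
  apply: (leaf_sum_eq hS (E := fun y t => linext (fun i => leaf_sum (G i) y t) z)).
  - move=> v c u u'; rewrite -linext_lincomb; apply: eq_linext => i.
    exact: (leaf_sum_bilinear (hG i)).1.
  - by move=> w v; apply: eq_linext => i; rewrite leaf_sum_gen.
  - by move=> u v w; rewrite -linextD; apply: eq_linext => i; rewrite leaf_sum_br.
by rewrite /tree_sum -!sE -linextD.
Qed.

Lemma tree_sumN (M : lmodType rat) (G : W -> L -> M) p q :
  bilinear_map G -> tree_sum (fun w q => - G w q) p q = - tree_sum G p q.
Proof. by move=> hG; rewrite -(tree_sum_comp hG)// => c x y; rewrite opprD scalerN. Qed.

Lemma leaf_sum_lie (p q : L) : leaf_sum (fun w q => {[lgen w, q]}) p q = {[p, q]}.
Proof.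
apply/esym/(@leaf_sum_eq _ _ _ (@lbr W)) => //.
- split=> v; last exact: lb.2.
  exact: (linear_comp (lb.1 v) (@lgen_linear W)).
- exact: lb.1.
- by move=> x y z; rewrite lbr_jacl.
Qed.

(** In a tree, the sum of [v, t] over all leaves v, with t the rest of the tree,
    vanishes: this is why what depends on a leaf up to such brackets only is
    well defined on trees. *)
Lemma tree_sum_lie (p q : L) : tree_sum (fun w q => {[lgen w, q]}) p q = 0.
Proof. by rewrite /tree_sum !leaf_sum_lie [X in _ + X]lbrC subrr. Qed.

Section Derivations.
Context (M : lmodType rat) (d : L -> L).
Hypothesis hd : is_lie_derivation d.
Let ld := hd.1.
Let db := hd.2.

(** A derivation acts on a word leaf by leaf, and the invariance of [B] carries the
    branches that surround a leaf to the other side. *)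
Lemma leaf_sum_form (B : L -> L -> M) p q :
    bilinear_map B -> (forall x y z, B {[x, y]} z = B x {[y, z]}) ->
  leaf_sum (fun w q => B (d (lgen w)) q) p q = B (d p) q.
Proof.
move=> hB iB; have [Bl Br] := hB.
apply/esym/(@leaf_sum_eq _ _ _ (fun p q => B (d p) q)) => //.
- split=> v; last exact: Br.
  exact: (linear_comp (linear_comp (Bl v) ld) (@lgen_linear W)).
- by move=> v; apply: (linear_comp (Bl v) ld).
- move=> x y z; rewrite db (bilDl hB) !iB; congr (_ + _).
  by rewrite -iB [{[x, d y]}]lbrC (bilNl hB) iB -(bilNr hB) -lbrC.
Qed.

Context (G : W -> L -> M).
Hypothesis hG : bilinear_map G.

(** Applying a derivation to a tree with root, leaf by leaf: either the selected
    leaf is transformed, or it lies elsewhere. *)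
Lemma leaf_sum_derivation p q :
  leaf_sum G (d p) q + leaf_sum G p (d q) =
  leaf_sum (fun w q => leaf_sum G (d (lgen w)) q + G w (d q)) p q.
Proof.
have hl := leaf_sum_bilinear hG; have [ll lr] := hl; have [Gl Gr] := hG.
apply: (@leaf_sum_eq _ _ _ (fun p q => leaf_sum G (d p) q + leaf_sum G p (d q))).
- split=> v; apply: linear_add => //.
  + exact: (linear_comp (linear_comp (ll v) ld) (@lgen_linear W)).
  + exact: (linear_comp (Gr v) ld).
- by move=> v; apply: linear_add => //; apply: (linear_comp (ll v) ld).
- by move=> w t; rewrite leaf_sum_gen.
- move=> x y t; rewrite !db (bilDl hl) !leaf_sum_br// !(bilDr hl).
  zmod.
Qed.

(** Both sides run over the ordered pairs of leaves of a tree, one of which is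
    transformed by the derivation and the other one selected by [G]. *)
Lemma two_leaves p q :
  tree_sum (fun w t => leaf_sum G t (d (lgen w))) p q =
  tree_sum (fun w t => G w (d t)) p q.
Proof.
have hl := leaf_sum_bilinear hG; have [ll lr] := hl; have [Gl Gr] := hG.
have hT := tree_sum_bilinear hG.
pose A w t := leaf_sum G (d (lgen w)) t.
pose B w t := leaf_sum G t (d (lgen w)).
have hA : bilinear_map A.
  by split=> v; [exact: (linear_comp (linear_comp (ll v) ld) (@lgen_linear W))|exact: lr].
have hB : bilinear_map B.
  by split=> v; [exact: (linear_comp (linear_comp (lr v) ld) (@lgen_linear W))|exact: ll].
have hC : bilinear_map (fun w t => G w (d t)).
  by split=> v; [exact: Gl|exact: (linear_comp (Gr v) ld)].
(* Once the pairs of equal leaves are added, both sides are the derivative by [d] of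
   the invariant form [tree_sum G]. *)
apply: (addrI (tree_sum A p q)); rewrite -!tree_sumD//.
rewrite [RHS]/tree_sum -!leaf_sum_derivation.
rewrite /tree_sum !(leaf_sum_form _ _ hT (tree_sum_invariant hG)) /tree_sum.
zmod.
Qed.

End Derivations.
End LeafSums.
(** ** The residue of a sum over leaves *)

Lemma subr_scale0 (V : lmodType rat) (a b x y : V) :
  a - 0 *: x - (b - 0 *: y) = a - b.
Proof. by rewrite !scale0r !subr0. Qed.

Lemma subr_scale0r (V : lmodType rat) (a x : V) : a - 0 *: x = a.
Proof. by rewrite scale0r subr0. Qed.

Lemma sub0_scale1 (V : lmodType rat) (x : V) : 0 - 1 *: x = - x.
Proof. by rewrite scale1r sub0r. Qed.

Section Residue.
Context (W M : lmodType rat) (G : W -> freeLie W -> M).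
Notation L := (freeLie W).
Hypothesis hG : bilinear_map G.
Let lb := lbr_bilinear W.

(* L is extended by an element E = (0, 1) such that [x, E] = - euler x. *)
Let Q : lmodType rat := (L * rat^o)%type.
Let mu (x : L) (q : Q) : Q := ({[x, q.1]} - q.2 *: euler x, 0).
Let GQ (w : W) (q : Q) : M := G w q.1.

Let Q_eq (q r : Q) : q.1 = r.1 -> q.2 = r.2 -> q = r.
Proof. by case: q => q1 q2; case: r => r1 r2 /= -> ->. Qed.

Let muP : bilinear_map mu.
Proof.
have [ll lr] := lb; have [le _] := eulerP W.
split=> [q c x y|x c q r]; apply: Q_eq.
- rewrite -[RHS]/(c *: ({[x, q.1]} - q.2 *: euler x) + ({[y, q.1]} - q.2 *: euler y)).
  rewrite -[LHS]/({[c *: x + y, q.1]} - q.2 *: euler (c *: x + y)).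
  rewrite ll le scalerBr scalerDr !scalerA [c * _]mulrC.
  by rewrite opprD addrACA.
- by rewrite -[RHS]/(c *: (0 : rat^o) + 0) scaler0 addr0.
- rewrite -[RHS]/(c *: ({[x, q.1]} - q.2 *: euler x) + ({[x, r.1]} - r.2 *: euler x)).
  rewrite -[LHS]/({[x, c *: q.1 + r.1]} - (c * q.2 + r.2) *: euler x).
  rewrite lr scalerBr scalerDl !scalerA.
  by rewrite opprD addrACA.
- by rewrite -[RHS]/(c *: (0 : rat^o) + 0) scaler0 addr0.
Qed.

Let mu_br x y q : mu {[x, y]} q = mu x (mu y q) - mu y (mu x q).
Proof.
have [_ eb] := eulerP W; apply: Q_eq.
  rewrite -[RHS]/(({[x, {[y, q.1]} - q.2 *: euler y]} - 0 *: euler x) -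
                  ({[y, {[x, q.1]} - q.2 *: euler x]} - 0 *: euler y)).
  rewrite -[LHS]/({[{[x, y]}, q.1]} - q.2 *: euler {[x, y]}).
  rewrite [RHS]subr_scale0 !(bilBr lb) !(bilZr lb) eb scalerDr lbr_jacl.
  rewrite [{[q.1, x]}]lbrC [{[euler x, y]}]lbrC (bilNr lb) scalerN.
  zmod.
by rewrite -[RHS]/((0 : rat^o) - 0) subr0.
Qed.

Let hGQ : bilinear_map GQ.
Proof.
have [Gl Gr] := hG; split=> [q|w]; first exact: Gl.
by apply: (linear_comp (Gr w)).
Qed.

Let muQ : Q := (0, 1).

(** Planting the word [{[x, y]}] on E instead of a root compares the sum over the
    leaves of [x], the Euler derivation being applied to [y], with the sum where the
    roles of [x] and [y] are exchanged. Hence the difference of these sums only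
    depends on [{[x, y]}]; this is what allows to solve for the value of a cocycle. *)
Definition residue (p : L) : M := mod_leaf_sum mu GQ p muQ.

Let mod_leaf_sum0 p q : mod_leaf_sum mu GQ p (q, 0) = leaf_sum G p q.
Proof.
have [ml mr] := mod_leaf_sum_bilinear muP hGQ mu_br.
apply: (@leaf_sum_eq _ _ _ hG (fun p q => mod_leaf_sum mu GQ p (q, 0))) => //.
  by move=> w t; rewrite mod_leaf_sum_gen.
move=> x y t; rewrite mod_leaf_sum_br// [{[t, x]}]lbrC.
have mu0 z r : mu z (r, 0) = ({[z, r]}, 0) by apply: Q_eq => //=; apply: subr_scale0r.
rewrite !mu0; have -> : (- {[x, t]}, 0) = - ({[x, t]}, 0) :> Q.
  by apply: Q_eq => //; rewrite -[RHS]/(- (0 : rat^o)) oppr0.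
by rewrite (linN (mr _)).
Qed.

Lemma residue_linear : linear residue.
Proof. by have [ml _] := mod_leaf_sum_bilinear muP hGQ mu_br; apply: ml. Qed.

Lemma residue_gen w : residue (lgen w) = 0.
Proof. by rewrite /residue mod_leaf_sum_gen// /GQ (bil0r hG). Qed.

Lemma residue_br x y :
  residue {[x, y]} = leaf_sum G y (euler x) - leaf_sum G x (euler y).
Proof.
have mu1 z : mu z muQ = (- euler z, 0).
  apply: Q_eq => //=; rewrite (bil0r lb); exact: sub0_scale1.
by rewrite /residue mod_leaf_sum_br// !mu1 !mod_leaf_sum0 !(bilNr (leaf_sum_bilinear hG)) opprK addrC.
Qed.

End Residue.

Lemma leaf_sum_deg (W : lmodType rat) (G : W -> freeLie W -> freeLie W) k i j n p q :
    bilinear_map G -> (forall w j q, lie_deg j q -> lie_deg (j + k) (G w q)) ->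
    lie_deg i p -> lie_deg j q -> (i + j + k)%N = n.+1 ->
  lie_deg n (leaf_sum G p q).
Proof.
move=> hG dG dp; have lG := leaf_sum_bilinear hG.
elim/lie_deg_ind: p / dp j q => [|c x y dx dy|t <-] j q dq e.
- by rewrite (bil0l lG); apply: span0.
- by rewrite lG.1; apply: spanD; [apply: spanZ|]; [exact: dx e|exact: dy e].
elim: t j q dq e => [w|s ihs t iht] j q dq e.
  rewrite leaf_sum_gen//; have <- : (j + k)%N = n by case: e.
  exact: dG.
have [ds dt] := (lie_deg_word s, lie_deg_word t).
rewrite /= leaf_sum_br//; apply: spanD.
  apply: (ihs _ _ (lie_deg_br dt dq)); rewrite -e /=.
  by rewrite !addnA.
by apply: (iht _ _ (lie_deg_br dq ds)); rewrite -e /=; lia.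
Qed.

Lemma tree_sum_deg (W : lmodType rat) (G : W -> freeLie W -> freeLie W) k i j n p q :
    bilinear_map G -> (forall w j q, lie_deg j q -> lie_deg (j + k) (G w q)) ->
    lie_deg i p -> lie_deg j q -> (i + j + k)%N = n.+1 ->
  lie_deg n (tree_sum G p q).
Proof.
move=> hG dG dp dq e; apply: spanD; first exact: leaf_sum_deg e.
by apply: (leaf_sum_deg hG dG dq dp); rewrite [(j + i)%N]addnC.
Qed.

(** * Group actions *)

Record is_action (F : groupType) (M : lmodType rat) (op : F -> M -> M) : Prop :=
  IsAction {
  action_linear f : linear (op f);
  action1 u : op 1%g u = u;
  actionM f h u : op (f * h)%g u = op f (op h u)
}.

Section Actions.
Context (F : groupType) (M : lmodType rat) (op : F -> M -> M).
Hypothesis hop : is_action op.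
Notation QF := (freemod F).

Lemma actionK f u : op f (op f^-1%g u) = u.
Proof. by rewrite -actionM// mulgV action1. Qed.

Lemma actionKV f u : op f^-1%g (op f u) = u.
Proof. by rewrite -actionM// mulVg action1. Qed.

Section Cocycles.
Context (c : F -> M).
Hypothesis hc : forall f h, c (f * h)%g = c f + op f (c h).

Lemma cocycle1 : c 1%g = 0.
Proof.
have := hc 1%g 1%g; rewrite mulg1 (action1 hop) => /eqP.
by rewrite -subr_eq0 opprD addrA subrr sub0r oppr_eq0 => /eqP.
Qed.

Lemma cocycleV f : c f^-1%g = - op f^-1%g (c f).
Proof. by apply/eqP; rewrite -addr_eq0 -hc mulVg cocycle1. Qed.

End Cocycles.

Lemma galg_bilinear : bilinear_map (galg_act op).
Proof.
split=> [u|z]; first exact: linext_linear.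
move=> c u v; rewrite /galg_act -linext_lincomb; apply: eq_linext => f.
exact: action_linear.
Qed.

Lemma galg_basis f u : galg_act op (basis f) u = op f u.
Proof. exact: linextU. Qed.

Lemma galg_mul (y z : QF) u : galg_act op (gmul y z) u = galg_act op y (galg_act op z u).
Proof.
rewrite /galg_act /gmul linext_comp; apply: eq_linext => f.
rewrite linext_basis (lin_linext _ _ (action_linear hop f)).
by apply: eq_linext => h; rewrite actionM.
Qed.

End Actions.

Section GroupAlgebraFacts.
Context (F : groupType).
Notation QF := (freemod F).

Lemma gmul_bilinear : bilinear_map (@gmul F).
Proof.
split=> [u|z]; first exact: linext_linear.
move=> c u v; rewrite /gmul -linext_lincomb; apply: eq_linext => f.
exact: linext_linear.
Qed.

Lemma gmul_basis (f h : F) : gmul (basis f) (basis h) = basis (f * h)%g.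
Proof. by rewrite /gmul !linextU. Qed.

Lemma antipode_linear : linear (@antipode F).
Proof. exact: linext_linear. Qed.

Lemma antipode_basis (f : F) : antipode (basis f) = basis f^-1%g.
Proof. exact: linextU. Qed.

Lemma antipodeK (z : QF) : antipode (antipode z) = z.
Proof.
apply: (freemod_eq (linear_comp antipode_linear antipode_linear) (h := id)) => // f.
by rewrite !antipode_basis invgK.
Qed.

Lemma antipode1 : antipode (basis 1%g) = basis 1%g :> QF.
Proof. by rewrite antipode_basis invg1. Qed.

Lemma antipode_mul (y z : QF) : antipode (gmul y z) = gmul (antipode z) (antipode y).
Proof.
have [ml mr] := gmul_bilinear; have la := antipode_linear.
apply: (freemod_eq (f := fun y => antipode (gmul y z))
                   (h := fun y => gmul (antipode z) (antipode y))) => [||f].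
- exact: linear_comp (ml z).
- exact: (linear_comp (mr _) la).
apply: (freemod_eq (f := fun z => antipode (gmul (basis f) z))
                   (h := fun z => gmul (antipode z) (antipode (basis f)))) => [||h].
- exact: linear_comp (mr _).
- exact: (linear_comp (ml _) la).
by rewrite gmul_basis !antipode_basis gmul_basis invgM.
Qed.

Lemma augmentation_basis (f : F) : augmentation (basis f) = 1.
Proof. by apply: (@fmod_ext_delta F rat^o rat^o (fun _ => id)). Qed.

End GroupAlgebraFacts.

Section LieAction.
Context (F : groupType) (W : lmodType rat) (act : F -> W -> W).
Hypothesis hact : is_action act.
Notation L := (freeLie W).
Notation "f '.*' b" := (lmap (act f) b) (at level 40).

Lemma lact_word f t : f .* word t = word (mag_map (act f) t).
Proof. by rewrite lmap.unlock !wordE lie_mapE ?linextU//; apply: action_linear. Qed.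

Lemma lact_gen f w : f .* lgen w = lgen (act f w).
Proof. exact: (lact_word f (MLeaf w)). Qed.

Lemma lact_linear f : linear (lmap (act f)).
Proof.
have lf := action_linear hact f.
move=> c x y; rewrite lmap.unlock -(repK x) -(repK y) -linearP !lie_mapE//.
by rewrite -linearP; congr cls; apply: linext_linear.
Qed.

Lemma lact_br f x y : f .* {[x, y]} = {[f .* x, f .* y]}.
Proof.
have lf := action_linear hact f.
rewrite lmap.unlock -(repK x) -(repK y) lbrE !lie_mapE//.
by rewrite linext_mag_mul lbrE.
Qed.

Lemma lact_action : is_action (fun f => lmap (act f)).
Proof.
split=> [|x|f h x]; first exact: lact_linear.
- apply: (lie_eq (lact_linear 1%g) (h := id)) => // [w|y z ey ez].
    by rewrite lact_gen action1.
  by rewrite lact_br ey ez.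
- apply: (lie_eq (lact_linear (f * h)%g) (linear_comp (lact_linear f) (lact_linear h))).
    by move=> w; rewrite !lact_gen actionM.
  by move=> y z ey ez; rewrite lact_br lact_br lact_br ey ez.
Qed.

Lemma lactM f h x : (f * h)%g .* x = f .* (h .* x).
Proof. exact: actionM lact_action f h x. Qed.

Lemma lactK f x : f .* (f^-1%g .* x) = x.
Proof. exact: actionK lact_action f x. Qed.

Lemma lactKV f x : f^-1%g .* (f .* x) = x.
Proof. exact: actionKV lact_action f x. Qed.

Lemma lact1 x : 1%g .* x = x.
Proof. exact: action1 lact_action x. Qed.

Lemma lact_deg n f x : lie_deg n x -> lie_deg n (f .* x).
Proof.
have lf := lact_linear f.
move: x; apply: lie_deg_ind => [|c x y dx dy|t <-].
- by rewrite (lin0 lf); apply: span0.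
- by rewrite lf; apply: spanD => //; apply: spanZ.
rewrite lact_word; have -> : mag_size t = mag_size (mag_map (act f) t).
  by elim: t => //= s -> t ->.
exact: lie_deg_word.
Qed.

Lemma lact_euler f x : euler (f .* x) = f .* euler x.
Proof.
have [le eb] := eulerP W.
apply: (lie_eq (linear_comp le (lact_linear f)) (linear_comp (lact_linear f) le)).
  by move=> w; rewrite lact_gen !euler_gen lact_gen.
move=> y z ey ez; rewrite lact_br !eb (linD (lact_linear f)) !lact_br.
by rewrite ey ez.
Qed.

Definition zact : freemod F -> L -> L := galg_act (fun f => lmap (act f)).

Lemma zact_bilinear : bilinear_map zact.
Proof. exact: galg_bilinear lact_action. Qed.

Lemma zact_basis f x : zact (basis f) x = f .* x.
Proof. exact: galg_basis. Qed.

Lemma zact_mul y z x : zact (gmul y z) x = zact y (zact z x).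
Proof. exact: galg_mul lact_action _ _ _. Qed.

Lemma zact_gen z w : zact z (lgen w) = lgen (galg_act act z w).
Proof.
rewrite /zact /galg_act (lin_linext _ _ (@lgen_linear W)).
by apply: eq_linext => f; rewrite lact_gen.
Qed.

Lemma zact_deg n z x : lie_deg n x -> lie_deg n (zact z x).
Proof. by move=> dx; apply: span_linext => f; apply: lact_deg. Qed.

Section Equivariance.
Context (M : lmodType rat) (G : W -> L -> M) (f : F).
Hypothesis hG : bilinear_map G.

Lemma leaf_sum_equivariant (tau : M -> M) (kappa : L -> M) :
    linear tau -> linear kappa ->
    (forall w q, G (act f w) (f .* q) = tau (G w q) + kappa {[lgen w, q]}) ->
  forall p q, leaf_sum G (f .* p) (f .* q) = tau (leaf_sum G p q) + kappa {[p, q]}.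
Proof.
move=> lt lk e; have lG := leaf_sum_bilinear hG.
have lf := lact_linear f; have lb := lbr_bilinear W.
elim/lie_ind => [q|c x y ex ey q|w q|x y ex ey q].
- by rewrite (lin0 lf) !(bil0l lG) (bil0l lb) (lin0 lt) (lin0 lk) addr0.
- by rewrite lf !(bilDl lG) !(bilZl lG) ex ey lb.1 lt lk !scalerDr addrACA.
- by rewrite lact_gen !leaf_sum_gen.
rewrite lact_br !leaf_sum_br// -!lact_br ex ey lbr_jacl (linD lt) (linD lk).
by rewrite addrACA.
Qed.

Lemma residue_equivariant (tau : M -> M) : linear tau ->
    (forall w q, G (act f w) (f .* q) = tau (G w q)) ->
  forall p, residue G (f .* p) = tau (residue G p).
Proof.
move=> lt e; have lf := lact_linear f; have lr := residue_linear hG.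
have es p q : leaf_sum G (f .* p) (f .* q) = tau (leaf_sum G p q).
  rewrite (leaf_sum_equivariant lt (@linear_zero L M)) ?addr0// => w t.
  by rewrite e addr0.
apply: (lie_eq (linear_comp lr lf) (linear_comp lt lr)).
  by move=> w; rewrite lact_gen !residue_gen// (lin0 lt).
move=> x y _ _; rewrite lact_br !residue_br// !lact_euler !es.
by rewrite (linB lt).
Qed.

End Equivariance.
End LieAction.
(** * Trees as the universal invariant form *)

(** A form on the free Lie algebra with the symmetries of the tree that joins two
    rooted trees by their roots. *)
Record is_invariant_form (F : groupType) (W M : lmodType rat) (act : F -> W -> W)
    (B : freeLie W -> freeLie W -> M) : Prop := IsInvariantForm {
  form_bilinear : bilinear_map B;
  form_sym x y : B x y = B y x;
  form_lie x y z : B {[x, y]} z = B x {[y, z]};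
  form_act f x y : B (lmap (act f) x) (lmap (act f) y) = B x y
}.

Section TreeValues.
Context (F : groupType) (W : lmodType rat) (act : F -> W -> W).
Hypothesis hact : is_action act.
Notation L := (freeLie W).
Notation QF := (freemod F).
Notation zact := (zact act).

Definition bead_act (bs : seq QF) (x : L) : L := foldr zact x bs.

Definition edge_beads (e : edge F) : seq QF :=
  if e.1 then e.2 else rev [seq antipode b | b <- e.2].

Definition edge_act (e : edge F) : L -> L := bead_act (edge_beads e).

Lemma edge_act_fwd bs x : edge_act (true, bs) x = bead_act bs x.
Proof. by []. Qed.

Lemma edge_act_bwd bs x :
  edge_act (false, bs) x = bead_act (rev [seq antipode b | b <- bs]) x.
Proof. by []. Qed.

(** The Lie word of a rooted tree, its beads being pushed to the leaves. *)
Fixpoint tree_val (t : half_tree F W) : L :=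
  match t with
  | Leaf v => lgen v
  | Node e1 t1 e2 t2 => {[edge_act e1 (tree_val t1), edge_act e2 (tree_val t2)]}
  end.

Lemma bead_act_cat bs bs' x : bead_act (bs ++ bs') x = bead_act bs (bead_act bs' x).
Proof. exact: foldr_cat. Qed.

Lemma bead_act_linear bs : linear (bead_act bs).
Proof.
elim: bs => [|b bs ih] c x y //=.
by rewrite ih (zact_bilinear hact).2.
Qed.

Lemma edge_act_mid o bs m bs' x :
  edge_act (o, bs ++ m ++ bs') x =
  bead_act (if o then bs else rev [seq antipode b | b <- bs'])
    (edge_act (o, m)
      (bead_act (if o then bs' else rev [seq antipode b | b <- bs]) x)).
Proof.
by case: o; rewrite /edge_act /edge_beads /= -!bead_act_cat ?map_cat ?rev_cat ?catA.
Qed.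

Lemma bead_act_deg bs n x : lie_deg n x -> lie_deg n (bead_act bs x).
Proof. by move=> dx; elim: bs => //= b bs ih; apply: zact_deg. Qed.

Lemma edge_beads_flip e :
  edge_beads (flip e) = rev [seq antipode b | b <- edge_beads e].
Proof.
case: e => [[] bs]; rewrite /edge_beads//=.
rewrite map_rev revK -map_comp -[LHS]map_id; apply: eq_map => b /=.
by rewrite antipodeK.
Qed.

Lemma tree_val_deg t : lie_deg (half_nodes t).+1 (tree_val t).
Proof.
elim: t => [v|e1 t1 ih1 e2 t2 ih2] /=; first exact: lie_deg_gen.
rewrite -addSn -addnS; apply: lie_deg_br; exact: bead_act_deg.
Qed.

Section Forms.
Context (M : lmodType rat) (B : L -> L -> M).
Hypothesis hB : is_invariant_form act B.

Lemma form_zact z x y : B (zact z x) y = B x (zact (antipode z) y).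
Proof.
have [Bl Br] := form_bilinear hB; have [zl zr] := zact_bilinear hact.
apply: (freemod_eq (f := fun z => B (zact z x) y)
                   (h := fun z => B x (zact (antipode z) y))).
- exact: (linear_comp (Bl y) (zl x)).
- apply: (linear_comp (Br x) (linear_comp (zl y) (@antipode_linear F))).
move=> f; rewrite antipode_basis !zact_basis//.
by rewrite -[RHS](form_act hB f) (lactK hact).
Qed.

Lemma form_bead bs x y :
  B (bead_act bs x) y = B x (bead_act (rev [seq antipode b | b <- bs]) y).
Proof.
elim: bs x y => [|b bs ih] x y //=.
by rewrite form_zact ih rev_cons -cats1 bead_act_cat.
Qed.

Lemma form_edge e x y : B (edge_act e x) y = B x (edge_act (flip e) y).
Proof. by rewrite /edge_act form_bead edge_beads_flip. Qed.

Definition tree_form (T : tree F W) : M :=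
  B (tree_val (cut_left T)) (edge_act (cut_edge T) (tree_val (cut_right T))).

Lemma tree_formE t e s :
  tree_form (Cut t e s) = B (tree_val t) (edge_act e (tree_val s)).
Proof. by []. Qed.

(** Each relation between trees is a property of the form: symmetry and invariance
    for the choice of the cut edge, antisymmetry and the Jacobi identity of the
    bracket for AS and IHX, invariance under [F] for the beads. *)
Lemma tree_form_rel u : tree_rel act u -> linext tree_form u = 0.
Proof.
have hb := form_bilinear hB; have ht := linext_linear tree_form.
have zb := zact_bilinear hact; have ha bs := bead_act_linear bs.
case=> {u} [t e s|e1 t1 e2 t2 e s|t e e1 t1 e2 t2|o er tr ea ta eb tb ec tc T
  |t e c v w|t o bs c x y bs' s|t o bs bs' s|t o bs x y bs' s|t o bs s
  |t bs x bs1 t1 bs2 t2|t bs x v].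
- rewrite (linB ht) !linextU !tree_formE.
  by rewrite (form_sym hB) form_edge subrr.
- rewrite (linB ht) !linextU !tree_formE /=.
  by rewrite (form_lie hB) form_edge subrr.
- rewrite (linD ht) !linextU !tree_formE /= /edge_act.
  by rewrite [{[bead_act _ (tree_val t2), _]}]lbrC (linN (ha _)) (bilNr hb) subrr.
- rewrite !(linD ht) !linextU !tree_formE /=.
  have eo X : edge_act (o, [::]) X = X by case: o {T}.
  rewrite !eo.
  set A := edge_act ea _; set C := edge_act ec _; set D := edge_act eb _.
  set R := edge_act er _.
  rewrite ![{[_, R]}]lbrC !(bilNl hb) !(form_lie hB) -!opprD -!(bilDr hb).
  by rewrite lbr_jacobi (bil0r hb) oppr0.
- rewrite (linB ht) (linD ht) (linZ ht) !linextU !tree_formE /edge_act /=.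
  by rewrite lgen_linear (ha _) hb.2 subrr.
- rewrite (linB ht) (linD ht) (linZ ht) !linextU !tree_formE.
  rewrite -[_ :: bs']cat1s -[x :: bs']cat1s -[y :: bs']cat1s !edge_act_mid.
  have -> : edge_act (o, [:: c *: x + y]) =1
      (fun X => c *: edge_act (o, [:: x]) X + edge_act (o, [:: y]) X).
    by move=> X; case: o; rewrite /edge_act /= ?antipode_linear zb.1.
  by rewrite (ha _) hb.2 subrr.
- rewrite (linB ht) !linextU !tree_formE.
  rewrite -[_ :: bs']cat1s edge_act_mid.
  have := edge_act_mid o bs [::] bs' (tree_val s); rewrite cat0s => ->.
  have -> : edge_act (o, [:: basis 1%g]) =1 edge_act (o, [::]).
    by move=> X; case: o; rewrite /edge_act /= ?antipode1 zact_basis lact1.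
  by rewrite subrr.
- rewrite (linB ht) !linextU !tree_formE.
  rewrite -[x :: y :: bs']/([:: x; y] ++ bs') -[_ x y :: bs']cat1s !edge_act_mid.
  have -> : edge_act (o, [:: x; y]) =1 edge_act (o, [:: gmul x y]).
    move=> X; case: o; rewrite /edge_act /=; first by rewrite [RHS]zact_mul.
    by rewrite antipode_mul [RHS]zact_mul.
  by rewrite subrr.
- rewrite (linB ht) !linextU !tree_formE /edge_act.
  rewrite /edge_beads /=; case: o => /=; last by rewrite subrr.
  by rewrite map_rev revK -map_comp (eq_map (g := id)) ?map_id ?subrr// => b /=; rewrite antipodeK.
- rewrite (linB ht) linextU linext_basis tree_formE /= /edge_act /=.
  rewrite -cats1 bead_act_cat /= /zact /galg_act.
  have lX : linear (fun X => B (tree_val t) (bead_act bs X)).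
    exact: (linear_comp (hb.2 _) (ha _)).
  rewrite (lin_linext _ _ lX) -linextB /=.
  rewrite (eq_linext (k := fun _ => 0)) ?linext0// => f.
  by rewrite tree_formE /= lact_br// /edge_act /= !zact_basis subrr.
- rewrite (linB ht) !linextU !tree_formE /edge_act /=.
  by rewrite /edge_beads /= -cats1 bead_act_cat /= (zact_gen hact) subrr.
Qed.

Definition tree_ext (u : treemod act) : M := linext tree_form (rep u).

Lemma tree_ext_linear : linear tree_ext.
Proof. exact: (quot_ext_linear (linext_linear _) tree_form_rel). Qed.

Lemma tree_ext_class T : tree_ext (tree_class act T) = tree_form T.
Proof. by rewrite /tree_ext (quot_extE (linext_linear _) tree_form_rel) linextU. Qed.

End Forms.

(** ** The form with values in trees *)

Fixpoint bare_tree (t : mag W) : half_tree F W :=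
  match t with
  | MLeaf w => Leaf F w
  | MNode s t => Node (true, [::]) (bare_tree s) (true, [::]) (bare_tree t)
  end.

Notation tc := (tree_class act).
Notation cut0 s t := (Cut s (true, [::]) t).

Lemma tree_classE T : tc T = cls (tree_rel act) (basis T). Proof. by []. Qed.

Let class_linear := @cls_is_linear _ (tree_rel act).

Lemma class_eq (T T' : tree F W) :
  tree_rel act (basis T - basis T') -> tc T = tc T'.
Proof.
by move=> /clsS /eqP; rewrite (linB class_linear) subr_eq0 => /eqP.
Qed.

Lemma class_swap t e s : tc (Cut t e s) = tc (Cut s (flip e) t).
Proof. exact/class_eq/rel_swap. Qed.

Lemma class_cut e1 t1 e2 t2 e s :
  tc (Cut (Node e1 t1 e2 t2) e s) = tc (Cut t1 (flip e1) (Node e2 t2 e s)).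
Proof. exact/class_eq/rel_cut. Qed.

Lemma class_AS t e e1 t1 e2 t2 :
  tc (Cut t e (Node e1 t1 e2 t2)) = - tc (Cut t e (Node e2 t2 e1 t1)).
Proof.
apply/eqP; rewrite -addr_eq0 !tree_classE -(linD class_linear).
exact/eqP/clsS/rel_AS.
Qed.

Lemma class_reverse t o bs s :
  tc (Cut t (o, bs) s) = tc (Cut t (~~ o, rev [seq antipode x | x <- bs]) s).
Proof. exact/class_eq/rel_reverse. Qed.

Lemma class_orient t o s : tc (Cut t (o, [::]) s) = tc (cut0 t s).
Proof. by case: o => //; rewrite class_reverse. Qed.

Lemma class_sym t s : tc (cut0 t s) = tc (cut0 s t).
Proof. by rewrite class_swap; apply: class_orient. Qed.

Lemma class_move t1 t2 s :
  tc (cut0 (Node (true, [::]) t1 (true, [::]) t2) s) =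
  tc (cut0 t1 (Node (true, [::]) t2 (true, [::]) s)).
Proof. by rewrite class_cut; apply: class_orient. Qed.

Lemma flipK e : flip (flip e) = e :> edge F.
Proof. by case: e => o bs; rewrite /flip negbK. Qed.

(* Cutting along the first or the second branch of the right half. *)
Lemma class_left t e e1 t1 e2 t2 :
  tc (Cut t e (Node e1 t1 e2 t2)) = tc (Cut (Node e2 t2 (flip e) t) e1 t1).
Proof. by rewrite class_swap class_cut class_swap flipK. Qed.

Lemma class_right t e e1 t1 e2 t2 :
  tc (Cut t e (Node e1 t1 e2 t2)) = tc (Cut (Node (flip e) t e1 t1) e2 t2).
Proof. by rewrite class_swap class_cut class_left flipK. Qed.

Lemma class_leaf_linear t e : linear (fun v => tc (Cut t e (Leaf F v))).
Proof.
move=> c v w; apply/eqP; rewrite -subr_eq0 !tree_classE -class_linear.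
rewrite -(linB class_linear); exact/eqP/clsS/rel_leaf.
Qed.

Lemma class_bead_linear t o bs bs' s :
  linear (fun b => tc (Cut t (o, bs ++ b :: bs') s)).
Proof.
move=> c x y; apply/eqP; rewrite -subr_eq0 !tree_classE -class_linear.
rewrite -(linB class_linear); exact/eqP/clsS/rel_bead.
Qed.

Lemma class_out t bs b v :
  tc (Cut t (true, rcons bs b) (Leaf F v)) =
  tc (Cut t (true, bs) (Leaf F (galg_act act b v))).
Proof. exact/class_eq/rel_out. Qed.

Lemma class_node t bs f bs1 t1 bs2 t2 :
  tc (Cut t (true, rcons bs (basis f)) (Node (true, bs1) t1 (true, bs2) t2)) =
  tc (Cut t (true, bs) (Node (true, basis f :: bs1) t1 (true, basis f :: bs2) t2)).
Proof.
by have := rel_node act t bs (basis f) bs1 t1 bs2 t2; rewrite linextU => /class_eq.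
Qed.

Lemma class_IHX r a b c :
  tc (cut0 (Node (true, [::]) r (true, [::]) c) (Node (true, [::]) a (true, [::]) b)) +
  tc (cut0 (Node (true, [::]) r (true, [::]) a) (Node (true, [::]) b (true, [::]) c)) +
  tc (cut0 (Node (true, [::]) r (true, [::]) b) (Node (true, [::]) c (true, [::]) a)) = 0.
Proof.
have flip_node x y z : tc (cut0 (Node (true, [::]) x (true, [::]) y) z) =
    - tc (cut0 (Node (true, [::]) y (true, [::]) x) z).
  by rewrite class_sym class_AS class_sym.
have := clsS (rel_IHX act true (true, [::]) r (true, [::]) a (true, [::]) b
                      (true, [::]) c).
rewrite !(linD class_linear) -!tree_classE => e.
by rewrite !(flip_node r) -!opprD e oppr0.
Qed.

Let half_form (t : half_tree F W) : freemod (mag W) -> treemod act :=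
  linext (fun s => tc (cut0 t (bare_tree s))).

Let half_form_linear t : linear (half_form t) := linext_linear _.

Let half_form_mul t u v :
  half_form t (mag_mul u v) =
  linext (fun s => half_form (Node (true, [::]) t (true, [::]) (bare_tree s)) v) u.
Proof.
rewrite /half_form /mag_mul linext_comp; apply: eq_linext => s.
rewrite linext_basis; apply: eq_linext => r /=.
by rewrite class_move.
Qed.

Let half_form_anti t u v : half_form t (mag_mul u v) = - half_form t (mag_mul v u).
Proof.
rewrite !half_form_mul /half_form exchange_linext -linextN.
apply: eq_linext => s; rewrite -linextN; apply: eq_linext => r.
by rewrite !class_move class_AS.
Qed.

(* AS and IHX kill the relations of the free Lie algebra. *)
Let half_form_ideal u : lie_ideal u -> forall t, half_form t u = 0.
Proof.
have lh := half_form_linear.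
elim=> {u} [c v w|u|u v w|u v Iv hv|u v Iu hu] t.
- rewrite (linB (lh t)) (linD (lh t)) (linZ (lh t)) /half_form !linextU /=.
  by rewrite class_leaf_linear subrr.
- exact: (eq_oppr_eq0 (half_form_anti t u u)).
- pose J a b c := tc (cut0 (Node (true, [::]) t (true, [::]) (bare_tree a))
    (Node (true, [::]) (bare_tree b) (true, [::]) (bare_tree c))).
  have E x y z : half_form t (mag_mul x (mag_mul y z)) =
      linext (fun a => linext (fun b => linext (J a b) z) y) x.
    rewrite half_form_mul; apply: eq_linext => a.
    rewrite /half_form /mag_mul linext_comp; apply: eq_linext => b.
    by rewrite linext_basis.
  rewrite !(linD (lh t)) !E.
  rewrite (linext_rot (fun a b c => J b c a) u v w).
  rewrite -(linext_rot (fun c a b => J c a b) w u v).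
  rewrite -!linextD -[RHS](linext0 _ u); apply: eq_linext => a.
  rewrite -!linextD -[RHS](linext0 _ v); apply: eq_linext => b.
  rewrite -!linextD -[RHS](linext0 _ w); apply: eq_linext => c.
  exact: class_IHX.
- rewrite half_form_mul -[RHS](linext0 _ u); apply: eq_linext => s.
  exact: hv.
- rewrite half_form_anti half_form_mul -[RHS]oppr0 -(linext0 _ v); congr (- _).
  by apply: eq_linext => s; apply: hu.
Qed.

Definition tree_half (t : half_tree F W) (x : L) : treemod act := half_form t (rep x).

Lemma tree_half_linear t : linear (tree_half t).
Proof.
by apply: (quot_ext_linear (half_form_linear t)) => u Iu; apply: half_form_ideal.
Qed.

Lemma tree_half_word t s : tree_half t (word s) = tc (cut0 t (bare_tree s)).
Proof.
rewrite wordE /tree_half (quot_extE (half_form_linear t)) => [|u Iu].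
  exact: linextU.
exact: half_form_ideal.
Qed.

(* Beads travel to the leaves by the relations at nodes and the bead-out relation. *)
Let class_push t bs f s :
  tc (Cut t (true, rcons bs (basis f)) (bare_tree s)) =
  tc (Cut t (true, bs) (bare_tree (mag_map (act f) s))).
Proof.
elim: s t bs => [w|s1 ih1 s2 ih2] t bs /=; first by rewrite class_out galg_basis.
rewrite class_node class_left -[[:: basis f]]/(rcons [::] (basis f)) ih1 -class_left.
by rewrite class_right ih2 -class_right.
Qed.

Let class_bare t e s :
  tc (Cut t e (bare_tree s)) = tree_half t (edge_act e (word s)).
Proof.
have -> : tc (Cut t e (bare_tree s)) = tc (Cut t (true, edge_beads e) (bare_tree s)).
  by case: e => [[] bs] //; rewrite class_reverse.
rewrite /edge_act; elim/last_ind: (edge_beads e) s => [|bs b ih] s.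
  by rewrite tree_half_word.
rewrite -cats1 bead_act_cat /= /zact /galg_act.
have lX : linear (fun X => tree_half t (bead_act bs X)).
  exact: (linear_comp (tree_half_linear t) (bead_act_linear bs)).
rewrite (lin_linext _ _ lX).
apply: (freemod_eq (class_bead_linear t true bs [::] (bare_tree s)) (linext_linear _)).
by move=> f; rewrite linextU cats1 class_push ih lact_word.
Qed.

Let tree_half_node t e x e2 t2 :
    (forall T e', tc (Cut T e' t2) = tree_half T (edge_act e' (tree_val t2))) ->
  tree_half (Node e2 t2 (flip e) t) x =
  tree_half t (edge_act e {[x, edge_act e2 (tree_val t2)]}).
Proof.
have [bl br] := lbr_bilinear W.
have lE e' : linear (edge_act e') := bead_act_linear _.
move=> h2; apply: (word_eq (tree_half_linear _)
  (linear_comp (tree_half_linear t) (linear_comp (lE e) (bl _)))) => u.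
rewrite tree_half_word -class_left class_right h2.
apply: (word_eq (tree_half_linear _)
  (linear_comp (tree_half_linear t) (linear_comp (lE e) (br _)))) => v.
by rewrite tree_half_word -class_right -[RHS](class_bare t e (MNode u v)).
Qed.

Let class_half t e s : tc (Cut t e s) = tree_half t (edge_act e (tree_val s)).
Proof.
elim: s t e => [v|e1 t1 ih1 e2 t2 ih2] t e; first exact: (class_bare t e (MLeaf v)).
by rewrite class_left ih1 tree_half_node.
Qed.

(** The tree that joins the roots of two Lie words, as a bilinear form. *)
Definition join (x y : L) : treemod act :=
  linext (fun s => tree_half (bare_tree s) y) (rep x).

Let join_word x t : join x (word t) = tree_half (bare_tree t) x.
Proof.
rewrite /join /tree_half; apply: eq_linext => s.
by rewrite -/(tree_half _ _) tree_half_word class_sym.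
Qed.

Let join_linr x : linear (join x).
Proof.
move=> c y z; rewrite /join -linext_lincomb; apply: eq_linext => s.
exact: tree_half_linear.
Qed.

Let join_linl y : linear (join^~ y).
Proof.
move=> c x x'; apply: (word_eq (f := join (c *: x + x'))
    (h := fun y => c *: join x y + join x' y)) => [||t].
- exact: join_linr.
- by apply: linear_lincomb; apply: join_linr.
- by rewrite !join_word tree_half_linear.
Qed.

(** The cut edge of a tree joins the Lie words of its two halves: the tree module is
    spanned by the values of [join], and [tree_ext_join] makes [join] the universal
    invariant form. *)
Lemma class_join T :
  tc T = join (tree_val (cut_left T)) (edge_act (cut_edge T) (tree_val (cut_right T))).
Proof.
case: T => t e s /=; rewrite class_half.
apply: (word_eq (tree_half_linear t) (join_linr _)) => u.
by rewrite tree_half_word class_sym class_half join_word.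
Qed.

Let join_words s t : join (word s) (word t) = tc (cut0 (bare_tree s) (bare_tree t)).
Proof. by rewrite join_word tree_half_word class_sym. Qed.

Lemma tree_ext_join (M : lmodType rat) (B : L -> L -> M) x y :
  is_invariant_form act B -> tree_ext B (join x y) = B x y.
Proof.
move=> hB; have lt := tree_ext_linear hB; have [Bl Br] := form_bilinear hB.
have val_bare t : tree_val (bare_tree t) = word t.
  by elim: t => //= s -> t ->.
apply: (word_eq (linear_comp lt (join_linl y)) (Bl y)) => s.
apply: (word_eq (linear_comp lt (join_linr (word s))) (Br _)) => t.
by rewrite join_words tree_ext_class// tree_formE !val_bare.
Qed.

Lemma join_deg i j n x y : lie_deg i x -> lie_deg j y -> (i + j)%N = n.+1 ->
  tree_deg act n (join x y).
Proof.
have nodes (t : mag W) : (half_nodes (bare_tree t)).+1 = mag_size t.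
  by elim: t => //= s <- t <-; rewrite addSn addnS.
move=> dx dy e; elim/lie_deg_ind: x / dx => [|c x x' dx dx'|s si].
- by rewrite (lin0 (join_linl y)); apply: span0.
- by rewrite join_linl; apply: spanD => //; apply: spanZ.
elim/lie_deg_ind: y / dy => [|c y y' dy dy'|t tj].
- by rewrite (lin0 (join_linr _)); apply: span0.
- by rewrite join_linr; apply: spanD => //; apply: spanZ.
rewrite join_words; apply: span_gen; eexists; last by [].
move: e; rewrite -si -tj -!nodes /degree /=; lia.
Qed.

Lemma join_form : is_invariant_form act join.
Proof.
have [bl br] := lbr_bilinear W.
have jsym x y : join x y = join y x.
  apply: (word_eq (join_linl y) (join_linr y)) => s.
  apply: (word_eq (join_linr (word s)) (join_linl (word s))) => t.
  by rewrite !join_words class_sym.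
split=> // [x y z|f x y].
- apply: (word_eq (linear_comp (join_linl z) (bl y)) (join_linl _)) => a.
  apply: (word_eq (linear_comp (join_linl z) (br (word a)))
                  (linear_comp (join_linr (word a)) (bl z))) => b.
  apply: (word_eq (join_linr _) (linear_comp (join_linr (word a)) (br (word b)))) => c.
  by rewrite (join_words (MNode a b) c) (join_words a (MNode b c)) class_move.
- have lf := lact_linear hact f.
  apply: (word_eq (linear_comp (join_linl _) lf) (join_linl y)) => s.
  apply: (word_eq (linear_comp (join_linr _) lf) (join_linr (word s))) => t.
  rewrite !lact_word// join_words -(class_push _ [::]) class_swap /flip /=.
  rewrite class_reverse /= antipode_basis (class_push _ [::]) class_sym -join_words.
  by rewrite -!(lact_word hact) (lactKV hact).
Qed.

Lemma treemod_ind (P : treemod act -> Prop) :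
    P 0 -> (forall c u v, P u -> P v -> P (c *: u + v)) -> (forall T, P (tc T)) ->
  forall u, P u.
Proof.
move=> P0 PL PT u; rewrite -(repK u).
elim/freemod_ind: (rep u) => [|c t v ih]; first by rewrite linear0.
by rewrite class_linear; apply: PL; [exact: PT|exact: ih].
Qed.

Lemma treemod_eq (M : lmodType rat) (f h : treemod act -> M) :
  linear f -> linear h -> (forall T, f (tc T) = h (tc T)) -> f =1 h.
Proof.
move=> lf lh fh; apply: treemod_ind => //; first by rewrite !lin0.
by move=> c u v fu fv; rewrite lf lh fu fv.
Qed.

Lemma join_ind (P : treemod act -> Prop) :
    P 0 -> (forall c u v, P u -> P v -> P (c *: u + v)) -> (forall x y, P (join x y)) ->
  forall u, P u.
Proof.
by move=> P0 PL PJ; apply: treemod_ind => // T; rewrite class_join; apply: PJ.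
Qed.

Lemma tree_eq (M : lmodType rat) (f h : treemod act -> M) : linear f -> linear h ->
  (forall x y, f (join x y) = h (join x y)) -> f =1 h.
Proof.
move=> lf lh fh; apply: join_ind => //; first by rewrite !lin0.
by move=> c x y fx fy; rewrite lf lh fx fy.
Qed.

Lemma tree_deg_ind m (P : treemod act -> Prop) :
    P 0 -> (forall c u v, P u -> P v -> P (c *: u + v)) ->
    (forall i j y z, lie_deg i y -> lie_deg j z -> (i + j)%N = m.+1 -> P (join y z)) ->
  forall u, tree_deg act m u -> P u.
Proof.
move=> P0 PL PJ u; elim=> // c v w [T Tm <-] _ Pw; apply: PL => //.
rewrite class_join; apply: PJ.
- exact: tree_val_deg.
- exact/bead_act_deg/tree_val_deg.
by rewrite addSn addnS; congr _.+1.
Qed.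

End TreeValues.
(** * Functionals on trees given by a sum over leaves *)

(** [kappa] measures the failure of [G] to be invariant. *)
Record is_leaf_map (F : groupType) (W M : lmodType rat) (act : F -> W -> W)
    (G : W -> freeLie W -> M) (kappa : F -> freeLie W -> M) : Prop := IsLeafMap {
  leaf_map_bilinear : bilinear_map G;
  leaf_map_linear f : linear (kappa f);
  leaf_map_act f w q :
    G (act f w) (lmap (act f) q) = G w q + kappa f {[lgen w, q]}
}.

Section TreeFunctionals.
Context (F : groupType) (W : lmodType rat) (act : F -> W -> W).
Hypothesis hact : is_action act.
Notation L := (freeLie W).
Notation QF := (freemod F).
Notation zact := (zact act).
Notation "f '.*' b" := (lmap (act f) b) (at level 40).
Notation edge_act := (edge_act act).
Notation bead_act := (bead_act act).
Notation tree_val := (tree_val act).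
Notation back bs := (rev [seq antipode b | b <- bs]).

Section Functional.
Context (M : lmodType rat) (G : W -> L -> M) (kappa : F -> L -> M).
Hypothesis hG : is_leaf_map act G kappa.
Let bG := leaf_map_bilinear hG.
Let lk := leaf_map_linear hG.
Let ls := leaf_sum_bilinear bG.

Lemma leaf_sum_lact f p q :
  leaf_sum G (f .* p) (f .* q) = leaf_sum G p q + kappa f {[p, q]}.
Proof.
apply: (leaf_sum_equivariant hact bG (tau := id)) => // w t.
exact: (leaf_map_act hG).
Qed.

(** The defects of the two leaf sums cancel by antisymmetry of the bracket. *)
Lemma tree_sum_form : is_invariant_form act (tree_sum G).
Proof.
split=> [||x y z|f x y].
- exact: tree_sum_bilinear.
- exact: tree_sum_sym.
- exact: tree_sum_invariant.
rewrite /tree_sum !leaf_sum_lact [{[y, x]}]lbrC (linN (lk f)).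
by rewrite addrACA subrr addr0.
Qed.

Definition tree_functional : treemod act -> M := tree_ext (tree_sum G).

Lemma tree_functional_linear : linear tree_functional.
Proof. exact: (tree_ext_linear hact tree_sum_form). Qed.

(** ** Explicit form on trees with beads *)

Definition leaf_term (l : W * edge F * half_tree F W) : M :=
  let: (v, e, t) := l in G v (edge_act e (tree_val t)).

Definition bead_term (b : half_tree F W * seq QF * QF * seq QF * half_tree F W) : M :=
  let: (t, bs, b, bs', s) := b in
  linext (fun f => kappa f
    {[bead_act bs' (tree_val s), f^-1%g .* bead_act (back bs) (tree_val t)]}) b.

(* The defect of moving the beads bs, which lead from y to x, from x to y. *)
Let cross (bs : seq QF) (x y : L) : M :=
  \sum_(i <- iota 0 (size bs)) linext (fun f => kappa f
    {[bead_act (drop i.+1 bs) x, f^-1%g .* bead_act (back (take i bs)) y]}) (nth 0 bs i).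

Let cross_cons b bs x y :
  cross (b :: bs) x y =
  linext (fun f => kappa f {[bead_act bs x, f^-1%g .* y]}) b +
  cross bs x (zact (antipode b) y).
Proof.
rewrite /cross /= big_cons drop0 /=; congr (_ + _).
rewrite (iotaDl 1) big_map; apply: eq_bigr => i _ /=.
by rewrite rev_cons -cats1; apply: eq_linext => f; rewrite bead_act_cat.
Qed.

Let leaf_sum_bead b x y :
  leaf_sum G (zact b x) y = leaf_sum G x (zact (antipode b) y) +
  linext (fun f => kappa f {[x, f^-1%g .* y]}) b.
Proof.
have [ll lr] := ls.
rewrite /zact /galg_act (lin_linext _ _ (ll y)).
rewrite /antipode linext_basis (lin_linext _ _ (lr x)) -linextD.
by apply: eq_linext => f; rewrite -leaf_sum_lact (lactK hact).
Qed.

Let leaf_sum_back b x y :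
  leaf_sum G (zact (antipode b) x) y = leaf_sum G x (zact b y) +
  linext (fun f => kappa f {[y, f^-1%g .* x]}) b.
Proof.
have [ll lr] := ls.
rewrite /zact /galg_act /antipode linext_basis (lin_linext _ _ (ll y)).
rewrite (lin_linext _ _ (lr x)) -linextD; apply: eq_linext => f.
rewrite -{2}(lactK hact f x) leaf_sum_lact [{[y, _]}]lbrC (linN (lk f)).
by rewrite -addrA subrr addr0.
Qed.

Let leaf_sum_edge e x y :
  leaf_sum G (edge_act e x) y = leaf_sum G x (edge_act (flip e) y) +
  (if e.1 then cross e.2 x y else cross e.2 y x).
Proof.
have [ll lr] := ls.
case: e => [[] bs]; rewrite /flip /= ?edge_act_fwd ?edge_act_bwd.
  elim: bs x y => [|b bs ih] x y /=; first by rewrite /cross /= big_nil addr0.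
  rewrite leaf_sum_bead ih cross_cons.
  rewrite rev_cons -cats1 bead_act_cat /=.
  by rewrite -!addrA; congr (_ + _); rewrite addrC.
elim: bs x y => [|b bs ih] x y /=; first by rewrite /cross /= big_nil addr0.
rewrite rev_cons -cats1 bead_act_cat /= ih leaf_sum_back cross_cons.
by rewrite -!addrA.
Qed.

(* A presentation T of a tree stands for its cut edge, whose contribution to the sum is
   made of its leaves at either end and of its beads. *)
Let left_term (T : tree F W) : M :=
  if cut_left T is Leaf v then G v (edge_act (cut_edge T) (tree_val (cut_right T)))
  else 0.

Let flip_cut (T : tree F W) := Cut (cut_right T) (flip (cut_edge T)) (cut_left T).

Let bead_terms (T : tree F W) : M :=
  if (cut_edge T).1
  then cross (cut_edge T).2 (tree_val (cut_right T)) (tree_val (cut_left T))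
  else cross (cut_edge T).2 (tree_val (cut_left T)) (tree_val (cut_right T)).

Let sum_leaves T : \sum_(l <- leaves T) leaf_term l =
  \sum_(C <- cuts T) (left_term C + left_term (flip_cut C)).
Proof.
rewrite /leaves big_flatten big_map; apply: eq_bigr => -[t e s] _ /=.
rewrite big_cat /left_term /=; congr (_ + _).
  by case: t => [v|e1 t1 e2 t2]; rewrite ?big_seq1 ?big_nil.
by case: s => [v|e1 t1 e2 t2]; rewrite ?big_seq1 ?big_nil.
Qed.

Let sum_beads T : \sum_(b <- beads T) bead_term b = \sum_(C <- cuts T) bead_terms C.
Proof.
rewrite /beads big_flatten big_map; apply: eq_bigr => -[t [o bs] s] _ /=.
by rewrite /bead_terms /=; case: o; rewrite big_map.
Qed.

Let half_cuts_right t e s C : C \in half_cuts t e s -> left_term (flip_cut C) = 0.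
Proof.
elim: t e s => //= e1 t1 ih1 e2 t2 ih2 e s; rewrite inE => /orP[/eqP->//|].
rewrite mem_cat inE => /orP[/ih1//|/orP[/eqP->//|/ih2//]].
Qed.

Let half_cuts_sum t e s :
  left_term (Cut t e s) + \sum_(C <- half_cuts t e s) (left_term C + bead_terms C) =
  leaf_sum G (tree_val t) (edge_act e (tree_val s)).
Proof.
elim: t e s => [v|e1 t1 ih1 e2 t2 ih2] e s /=.
  by rewrite big_nil addr0 /left_term /= leaf_sum_gen.
rewrite big_cons big_cat big_cons /= leaf_sum_br// !leaf_sum_edge.
have edge_terms e' t' s' : (if e'.1 then cross e'.2 (tree_val t') (tree_val s')
    else cross e'.2 (tree_val s') (tree_val t')) = bead_terms (Cut t' (flip e') s').
  by case: e' => [[] bs].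
rewrite (edge_terms e1 t1 (Node e2 t2 e s)) (edge_terms e2 t2 (Node e s e1 t1)).
rewrite -(ih1 (flip e1) (Node e2 t2 e s)) -(ih2 (flip e2) (Node e s e1 t1)).
rewrite [left_term (Cut (Node _ _ _ _) _ _)]/left_term /= add0r.
by rewrite -!addrA; congr (_ + _); rewrite addrCA; do 3!congr (_ + _); rewrite addrC.
Qed.

(** Every leaf is transported along the edges to the place where it is seen as a
    root; this produces one defect for each bead on the way, and the defects of a
    bead seen from both of its sides add up to a single term. *)
Theorem tree_sum_beads T :
  tree_sum G (tree_val (cut_left T)) (edge_act (cut_edge T) (tree_val (cut_right T))) =
  \sum_(l <- leaves T) leaf_term l + \sum_(b <- beads T) bead_term b.
Proof.
rewrite sum_leaves sum_beads -big_split; case: T => t e s /=.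
rewrite big_cons big_cat /= /tree_sum leaf_sum_edge -!half_cuts_sum.
have half_cutsE t' e' s' : \sum_(C <- half_cuts t' e' s')
      (left_term C + left_term (flip_cut C) + bead_terms C) =
    \sum_(C <- half_cuts t' e' s') (left_term C + bead_terms C).
  by apply: eq_big_seq => C /half_cuts_right ->; rewrite addr0.
rewrite !half_cutsE {1}/flip_cut /= [bead_terms (Cut t e s)]/bead_terms /=.
zmod.
Qed.

Lemma tree_functional_class T :
  tree_functional (tree_class act T) =
  \sum_(l <- leaves T) leaf_term l + \sum_(b <- beads T) bead_term b.
Proof.
rewrite /tree_functional (tree_ext_class hact tree_sum_form).
exact: tree_sum_beads.
Qed.

Lemma tree_functional_join x y :
  tree_functional (join act x y) = tree_sum G x y.
Proof. exact: (tree_ext_join hact _ _ tree_sum_form). Qed.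

End Functional.
End TreeFunctionals.
(** * Intersection operations *)

(** What is used of the handlebody: [F] is generated by the [x i], the module [W]
    by the [a i], and [zeta] is the class of the boundary. *)
Record is_intersection_data (F : groupType) (W : lmodType rat) (act : F -> W -> W)
    (g : nat) (x : 'I_g -> F) (a : 'I_g -> W) (pair : freemod F -> W -> freemod F)
    (Psi : W -> W -> fmod F W) (zeta : W) : Prop := IsIntersectionData {
  data_action : is_action act;
  data_pair : is_intersection_pairing act x a pair;
  data_Psi : is_Psi act a pair Psi;
  data_genF (P : F -> Prop) : P 1%g -> (forall i f, P f -> P (x i * f)%g) ->
    (forall i f, P f -> P ((x i)^-1 * f)%g) -> forall f, P f;
  data_genW w : span (fun w => exists f i, w = act f (a i)) w;
  data_zeta : zeta = \sum_i (a i - act (x i)^-1%g (a i))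
}.

Section IntersectionOperations.
Context (F : groupType) (W : lmodType rat) (act : F -> W -> W).
Context (g : nat) (x : 'I_g -> F) (a : 'I_g -> W).
Context (pair : freemod F -> W -> freemod F) (Psi : W -> W -> fmod F W) (zeta : W).
Hypothesis data : is_intersection_data act x a pair Psi zeta.
Notation L := (freeLie W).
Notation QF := (freemod F).
Notation zact := (zact act).
Notation "f '.*' b" := (lmap (act f) b) (at level 40).

Let hact := data_action data.
Let pairP := data_pair data.
Let PsiP := data_Psi data.
Let pairB := pair_bilinear pairP.
Let PsiB := Psi_bilinear PsiP.
Let pb := pairB.
Let lact f := action_linear hact f.

Lemma genW_ind (P : W -> Prop) :
    P 0 -> (forall c v w, P v -> P w -> P (c *: v + w)) ->
    (forall f i, P (act f (a i))) -> forall w, P w.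
Proof.
move=> P0 PL Pa w; elim: (data_genW data w) => // c u v [f [i ->]] _ Pv.
exact: PL.
Qed.

Lemma cocycle_eq (M : lmodType rat) (op : F -> M -> M) (c c' : F -> M) :
    is_action op ->
    (forall f h, c (f * h)%g = c f + op f (c h)) ->
    (forall f h, c' (f * h)%g = c' f + op f (c' h)) ->
    (forall i, c (x i) = c' (x i)) ->
  c =1 c'.
Proof.
move=> hop hc hc' e.
apply: (data_genF data) => [|i f ih|i f ih].
- by rewrite (cocycle1 hop hc) (cocycle1 hop hc').
- by rewrite hc hc' e ih.
- by rewrite hc hc' (cocycleV hop hc) (cocycleV hop hc') e ih.
Qed.

Notation pr f w := (pair (basis f) w).

Lemma pairM (f h : F) w : pr (f * h)%g w = gmul (basis f) (pr h w) + pr f w.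
Proof. by rewrite -gmul_basis (pairMl pairP) augmentation_basis scale1r. Qed.

Lemma pair1 w : pr 1%g w = 0.
Proof.
have := pairM 1%g 1%g w; rewrite mulg1.
have -> z : gmul (basis 1%g) z = z :> QF.
  apply: (freemod_eq ((gmul_bilinear F).2 _) (h := id)) => // f.
  by rewrite gmul_basis mul1g.
by move/eqP; rewrite -subr_eq0 opprD addrA subrr sub0r oppr_eq0 => /eqP.
Qed.

Lemma pair_lact (f h : F) w : pr f (act h w) = gmul (pr f w) (basis h^-1%g).
Proof. exact: pair_act pairP _ _ _. Qed.

Lemma pair_gen i j : pr (x i) (a j) = if i == j then - basis 1%g else 0.
Proof. exact: pair_basis pairP _ _. Qed.

Lemma zact_pairM (f h : F) w q : zact (pr (f * h)%g w) q = zact (pr f w) q + f .* zact (pr h w) q.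
Proof.
rewrite pairM addrC ((linD ((zact_bilinear hact).1 q))) zact_mul//.
by rewrite zact_basis.
Qed.

Lemma zact_pair_lact (f h : F) w q : zact (pr f (act h w)) q = zact (pr f w) (h^-1%g .* q).
Proof. by rewrite pair_lact zact_mul// zact_basis. Qed.

(** The pairings with the [x i] are the coordinates in the basis [a], up to the sign
    and the antipode; the [a i] being orthogonal to the other [x j], this is checked
    on generators. *)
Lemma pair_coordinates w :
  \sum_i galg_act act (antipode (pr (x i) w)) (a i) = - w.
Proof.
have la i : linear (fun w => galg_act act (antipode (pr (x i) w)) (a i)).
  apply: (linear_comp ((galg_bilinear hact).1 (a i))).
  exact: (linear_comp (@antipode_linear F) (pb.2 _)).
move: w; apply: genW_ind => [|c v w ev ew|f j].
- by rewrite oppr0 big1// => i _; rewrite (lin0 (la i)).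
- under eq_bigr do rewrite la.
  by rewrite big_split/= -scaler_sumr ev ew scalerN opprD.
rewrite (bigD1 j)//= big1 => [|i ij].
  rewrite addr0 pair_lact pair_gen eqxx (bilNl (gmul_bilinear F)) gmul_basis mul1g.
  rewrite (linN (@antipode_linear F)) antipode_basis invgK.
  by rewrite (bilNl (galg_bilinear hact)) galg_basis.
rewrite pair_lact pair_gen (negbTE ij) (bil0l (gmul_bilinear F)).
by rewrite (lin0 (@antipode_linear F)) (bil0l (galg_bilinear hact)).
Qed.

Lemma gmul_action : is_action (fun f => gmul (basis f) : QF -> QF).
Proof.
have [gl gr] := gmul_bilinear F; split=> // [z|f h z].
  apply: (freemod_eq (gr _) (h := id)) => // f.
  by rewrite gmul_basis mul1g.
apply: (freemod_eq (gr _) (linear_comp (gr _) (gr _))) => k.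
by rewrite !gmul_basis mulgA.
Qed.

(** The fundamental formula of Fox calculus: both sides are cocycles in [f], and
    only the [i]-th term of the sum over the boundary pairs with [x i]. *)
Lemma pair_zeta (f : F) : pr f zeta = basis f - basis 1%g.
Proof.
have gb := gmul_bilinear F.
apply: (cocycle_eq (c := fun f => pr f zeta) (c' := fun f => basis f - basis 1%g) gmul_action).
- by move=> u v; rewrite pairM addrC.
- move=> u v; rewrite (bilBr gb) !gmul_basis mulg1; zmod.
move=> j; rewrite (data_zeta data) (bil_sumr pb) (bigD1 j)//= big1 => [|i ij].
  rewrite addr0 (bilBr pb) pair_lact pair_gen eqxx invgK (bilNl gb) gmul_basis.
  by rewrite mul1g opprK addrC.
by rewrite (bilBr pb) pair_lact pair_gen eq_sym (negbTE ij) (bil0l gb) subrr.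
Qed.

(** ** The operation Psi, evaluated by linear maps on the tensor product *)

Section PsiEvaluation.
Context (M : lmodType rat) (k : F -> W -> M).
Hypothesis lk : forall f, linear (k f).

Lemma Psi_ext_linl v : linear (fun u => fmod_ext k (Psi u v)).
Proof. exact: (linear_comp (fmod_ext_linear lk) (PsiB.1 v)). Qed.

Lemma Psi_ext_linr u : linear (fun v => fmod_ext k (Psi u v)).
Proof. exact: (linear_comp (fmod_ext_linear lk) (PsiB.2 u)). Qed.

Lemma Psi_ext_gen i j :
  fmod_ext k (Psi (a i) (a j)) = if i == j then k 1%g (a i) else 0.
Proof.
rewrite (Psi_basis PsiP); case: eqP => _; first by rewrite fmod_ext_delta.
by rewrite (lin0 (fmod_ext_linear lk)).
Qed.

Let fmod_ext_comp (j : F -> W -> fmod F W) z : (forall f, linear (j f)) ->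
  fmod_ext k (fmod_ext j z) = fmod_ext (fun f w => fmod_ext k (j f w)) z.
Proof.
move=> lj; apply: (fmod_eq (f := fun z => fmod_ext k (fmod_ext j z))) => [||f w].
- exact: (linear_comp (fmod_ext_linear lk) (fmod_ext_linear lj)).
- by apply: fmod_ext_linear => f; apply: (linear_comp (fmod_ext_linear lk) (lj f)).
rewrite !fmod_ext_delta// => h; exact: (linear_comp (fmod_ext_linear lk) (lj h)).
Qed.

Lemma Psi_ext_actl f u v :
  fmod_ext k (Psi (act f u) v) = fmod_ext (fun h => k (f * h)%g) (Psi u v) -
    linext (fun h => k h (act (h^-1 * f)%g u)) (pr f v).
Proof.
rewrite (Psi_actl PsiP) (linB (fmod_ext_linear lk)); congr (_ - _).
  apply: etrans (@fmod_ext_comp (fun h => delta (f * h)%g) (Psi u v) _) _.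
    by move=> h; apply: delta_linear.
  by congr fmod_ext; apply/funext => h; apply/funext => w; rewrite fmod_ext_delta.
rewrite (lin_linext _ _ (fmod_ext_linear lk)) /Theta linextU linext_basis.
by apply: eq_linext => h; rewrite fmod_ext_delta.
Qed.

Lemma Psi_ext_actr f u v :
  fmod_ext k (Psi u (act f v)) =
    fmod_ext (fun h w => k (h * f^-1)%g (act f w)) (Psi u v) -
    linext (fun h => k h^-1%g (act f v)) (pr f u).
Proof.
rewrite (Psi_actr PsiP) (linB (fmod_ext_linear lk)); congr (_ - _).
  apply: etrans (@fmod_ext_comp (fun h w => delta (h * f^-1)%g (act f w)) (Psi u v) _) _.
    by move=> h; apply: (linear_comp (@delta_linear _ _ _) (lact f)).
  by congr fmod_ext; apply/funext => h; apply/funext => w; rewrite fmod_ext_delta.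
rewrite /tensor /antipode (lin_linext _ _ (fmod_ext_linear lk)) linext_basis.
by apply: eq_linext => h; rewrite fmod_ext_delta.
Qed.

End PsiEvaluation.

(** Psi(v, u) is obtained from Psi(u, v) by the twisted flip h (x) w |-> h^-1 (x) hw:
    the two rules that govern the actions on the two arguments of Psi are exchanged
    by it, and it fixes the values on the basis. *)
Lemma Psi_skew (M : lmodType rat) (k : F -> W -> M) u v :
    (forall f, linear (k f)) ->
  fmod_ext k (Psi v u) = fmod_ext (fun h w => k h^-1%g (act h w)) (Psi u v).
Proof.
move=> lk; pose P u v := forall (k0 : F -> W -> M), (forall f, linear (k0 f)) ->
  fmod_ext k0 (Psi v u) = fmod_ext (fun h w => k0 h^-1%g (act h w)) (Psi u v).
suff: P u v by apply.
have lP (k0 : F -> W -> M) : (forall f, linear (k0 f)) -> forall h, linear (fun w => k0 h^-1%g (act h w)).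
  by move=> l0 h; apply: (linear_comp (l0 _) (lact h)).
have actl f u0 v0 : P u0 v0 -> P (act f u0) v0.
  move=> h k0 l0; rewrite (Psi_ext_actl (lP _ l0)) (Psi_ext_actr l0).
  rewrite (h (fun h w => k0 (h * f^-1)%g (act f w))) => [|i]; last exact: (linear_comp (l0 _) (lact f)).
  congr (_ - _).
    congr fmod_ext; apply/funext => i; apply/funext => w.
    by rewrite invgM -(actionM hact).
  apply: eq_linext => i; rewrite -(actionM hact) mulgA mulgV mul1g.
  by [].
have actr f u0 v0 : P u0 v0 -> P u0 (act f v0).
  move=> h k0 l0; rewrite (Psi_ext_actr (lP _ l0)) (Psi_ext_actl l0).
  rewrite (h (fun h w => k0 (f * h)%g w)) => [|i]; last exact: l0.
  congr (_ - _).
    congr fmod_ext; apply/funext => i; apply/funext => w.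
    by rewrite invgM invgK -!(actionM hact) mulgVK.
  apply: eq_linext => i; rewrite invgK -(actionM hact).
  by [].
have base i j : P (a i) (a j).
  move=> k0 l0; rewrite (Psi_ext_gen l0) (Psi_ext_gen (lP _ l0)) eq_sym.
  by case: eqP => // ->; rewrite invg1 (action1 hact).
have gen0 f i v0 : P (act f (a i)) v0.
  move: v0; apply: genW_ind => [k0 l0|c v1 v2 h1 h2 k0 l0|h j].
  - by rewrite (lin0 (Psi_ext_linl l0 _)) (lin0 (Psi_ext_linr (lP _ l0) _)).
  - by rewrite (Psi_ext_linl l0) (Psi_ext_linr (lP _ l0)) h1 ?h2.
  exact/actl/actr/base.
move: u; apply: genW_ind => [k0 l0|c v1 v2 h1 h2 k0 l0|h j]; last exact: gen0.
- by rewrite (lin0 (Psi_ext_linr l0 _)) (lin0 (Psi_ext_linl (lP _ l0) _)).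
- by rewrite (Psi_ext_linr l0) (Psi_ext_linl (lP _ l0)) h1 ?h2.
Qed.

(** On a generator [a j], only the [j]-th term of [zeta] contributes. When [f] acts on
    the first argument, the correction term is given by the pairing of [f] with
    [zeta], that is f - 1, which turns f (x) a j into 1 (x) f a j. *)
Lemma Psi_zeta (M : lmodType rat) (k : F -> W -> M) v : (forall f, linear (k f)) ->
  fmod_ext k (Psi v zeta) = k 1%g v.
Proof.
move=> lk; have gen (k0 : F -> W -> M) j : (forall f, linear (k0 f)) ->
    fmod_ext k0 (Psi (a j) zeta) = k0 1%g (a j).
  move=> l0; rewrite (data_zeta data) (lin_sum (Psi_ext_linr l0 _)) (bigD1 j)//=.
  have xV i : pr (x i)^-1%g (a j) = if i == j then basis (x i)^-1%g else 0.
    have gb := gmul_bilinear F.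
    have /eqP := pairM (x i)^-1 (x i) (a j); rewrite mulVg pair1 eq_sym addrC addr_eq0.
    move=> /eqP ->; rewrite pair_gen; case: eqP => _; last by rewrite (bil0r gb) oppr0.
    by rewrite (bilNr gb) gmul_basis mulg1 opprK.
  rewrite big1 ?addr0 => [|i ij].
    rewrite (linB (Psi_ext_linr l0 _)) (Psi_ext_gen l0) eqxx (Psi_ext_actr l0).
    rewrite (Psi_ext_gen (k := fun h w => _)) => [|f]; last first.
      exact: (linear_comp (l0 _) (lact _)).
    by rewrite eqxx xV eqxx linextU invgK mul1g subrr subr0.
  rewrite (linB (Psi_ext_linr l0 _)) (Psi_ext_gen l0) (Psi_ext_actr l0).
  rewrite (Psi_ext_gen (k := fun h w => _)) => [|f]; last first.
    exact: (linear_comp (l0 _) (lact _)).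
  by rewrite eq_sym (negbTE ij) xV (negbTE ij) (lin0 (linext_linear _)) !subr0.
move: v; apply: genW_ind => [|c v w ev ew|f j].
- by rewrite (lin0 (Psi_ext_linl lk _)) (lin0 (lk _)).
- by rewrite (Psi_ext_linl lk) lk ev ew.
rewrite (Psi_ext_actl lk) (gen (fun h => k (f * h)%g)) => [|h]; last exact: lk.
rewrite pair_zeta (linB (linext_linear _)) !linextU mulg1 mulVg invg1 mul1g.
by rewrite (action1 hact) subKr.
Qed.

Lemma zactl t : linear (fun z : QF => zact z t).
Proof. exact: (zact_bilinear hact).1. Qed.

Lemma zactr z : linear (zact z).
Proof. exact: (zact_bilinear hact).2. Qed.

Lemma lbrl (y : L) : linear (fun x0 : L => {[x0, y]}).
Proof. exact: (lbr_bilinear W).1. Qed.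

Lemma lbrr (y : L) : linear (lbr y).
Proof. exact: (lbr_bilinear W).2. Qed.

(** ** Exchange of the two operations *)

(** The terms of the identity expressing that composing two derivations, each of
    them given by a leaf, amounts to joining the two leaves by Psi. *)
Section Exchange.
Implicit Types (y : F) (v w : W) (t q : L).

Definition exch_Psi y v w t q : L :=
  fmod_ext (fun h u => zact (pr y u) {[q, h^-1%g .* t]}) (Psi v w).

Definition exch_pair y v w t q : L :=
  linext (fun h => {[zact (pr h v) t, h .* q]}) (pr y w).

Definition exch_br y v w t q : L := {[zact (pr y v) t, zact (pr y w) q]}.

Definition exch_defect y v w t q : L :=
  exch_Psi y v w t q + exch_pair y v w t q - exch_pair y w v q t - exch_br y v w t q.

Let k_lin y t q (h : F) : linear (fun u => zact (pr y u) {[q, h^-1%g .* t]}).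
Proof. exact: (linear_comp (zactl _) (pb.2 _)). Qed.

Lemma exch_defect_linear y w t q : linear (fun v => exch_defect y v w t q).
Proof.
have l1 : linear (fun v => exch_Psi y v w t q).
  by apply: Psi_ext_linl; apply: k_lin.
have l2 : linear (fun v => exch_pair y v w t q).
  move=> c u v; rewrite /exch_pair -linext_lincomb; apply: eq_linext => h.
  exact: (linear_comp (lbrl _) (linear_comp (zactl _) (pb.2 _))).
have l3 : linear (fun v => exch_pair y w v q t).
  exact: (linear_comp (linext_linear _) (pb.2 _)).
have l4 : linear (fun v => exch_br y v w t q).
  exact: (linear_comp (lbrl _) (linear_comp (zactl _) (pb.2 _))).
exact: (linear_add (linear_add (linear_add l1 l2) (linear_opp l3)) (linear_opp l4)).
Qed.

Lemma exch_defect_skew y v w t q : exch_defect y w v q t = - exch_defect y v w t q.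
Proof.
rewrite /exch_defect /exch_br [{[zact (pr y w) q, _]}]lbrC.
have -> : exch_Psi y w v q t = - exch_Psi y v w t q.
  rewrite /exch_Psi (Psi_skew _ _ (k_lin y q t)).
  rewrite (lin_fmod_ext _ (linear_opp (@linear_id L)) (k_lin y t q)).
  apply: eq_fmod_ext => h u; rewrite zact_pair_lact invgK lact_br// (lactKV hact).
  by rewrite lbrC (linN (zactr _)).
zmod.
Qed.

Lemma zact_pairV (f : F) w q : zact (pr f^-1%g w) q = - (f^-1%g .* zact (pr f w) q).
Proof.
have := zact_pairM f^-1 f w q; rewrite mulVg pair1 (lin0 (zactl q)) => /eqP.
by rewrite eq_sym addr_eq0 => /eqP.
Qed.

Lemma exch_defect_act f y v w t q :
  exch_defect y (act f v) w t q = exch_defect y v w (f^-1%g .* t) q.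
Proof.
rewrite /exch_defect.
have -> : exch_br y (act f v) w t q = exch_br y v w (f^-1%g .* t) q.
  by rewrite /exch_br zact_pair_lact.
have -> : exch_pair y (act f v) w t q = exch_pair y v w (f^-1%g .* t) q.
  by apply: eq_linext => h; rewrite zact_pair_lact.
pose E := zact (pr y v) {[zact (pr f^-1%g w) q, f^-1%g .* t]}.
have -> : exch_Psi y (act f v) w t q = exch_Psi y v w (f^-1%g .* t) q + E.
  rewrite /exch_Psi (Psi_ext_actl (k_lin y t q)); congr (_ + _).
    by apply: eq_fmod_ext => h u; rewrite invgM (lactM hact).
  rewrite /E zact_pairV (linN (lbrl _)) (linN (zactr _)); congr (- _).
  rewrite /(zact (pr f w)) /galg_act (lin_linext _ _ (lact_linear hact f^-1%g)).
  rewrite (lin_linext _ _ (linear_comp (zactr (pr y v)) (lbrl _))).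
  apply: eq_linext => h; rewrite zact_pair_lact invgM invgK lact_br//.
  by rewrite !(lactM hact) (lactK hact).
have -> : exch_pair y w (act f v) q t = exch_pair y w v q (f^-1%g .* t) + E.
  rewrite /exch_pair pair_lact /gmul linext_comp /E /(zact (pr y v)) /galg_act -linextD.
  apply: eq_linext => h; rewrite !linextU zact_pairM (linD (lbrl _)).
  by rewrite lact_br// (lactM hact).
zmod.
Qed.

Lemma exch_defect_cocycle (y z : F) v w t q :
  exch_defect (y * z)%g v w t q = exch_defect y v w t q + y .* exch_defect z v w t q.
Proof.
have ly := lact_linear hact y.
rewrite /exch_defect.
have -> : exch_Psi (y * z)%g v w t q = exch_Psi y v w t q + y .* exch_Psi z v w t q.
  rewrite /exch_Psi (lin_fmod_ext _ ly (k_lin z t q)).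
  rewrite -(fmod_extD _ (k_lin y t q)) => [|h]; last exact: (linear_comp ly (k_lin z t q h)).
  by apply: eq_fmod_ext => h u; apply: zact_pairM.
have pairE v0 w0 t0 q0 : exch_pair (y * z)%g v0 w0 t0 q0 = exch_pair y v0 w0 t0 q0 +
    {[zact (pr y v0) t0, y .* zact (pr z w0) q0]} + y .* exch_pair z v0 w0 t0 q0.
  rewrite /exch_pair pairM (linD (linext_linear _)) addrC -addrA; congr (_ + _).
  rewrite /gmul linextU linext_basis /(zact (pr z w0)) /galg_act.
  rewrite (lin_linext _ _ (linear_comp (lbrr _) ly)) (lin_linext _ _ ly) -linextD.
  apply: eq_linext => h; rewrite zact_pairM (linD (lbrl _)) lact_br//.
  by rewrite (lactM hact).
rewrite !pairE /exch_br !zact_pairM !(linB ly) (linD ly) lact_br//.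
rewrite (linD (lbrl _)) !(linD (lbrr _)) [{[zact (pr y w) q, y .* _]}]lbrC.
zmod.
Qed.

(** The defect is a cocycle in [y], it is skew under the exchange of the two leaves,
    and an element acting on a leaf can be moved to the word next to it: it is enough
    to consider generators, where the identity reads off the basis values. *)
Lemma exch_defect0 y v w t q : exch_defect y v w t q = 0.
Proof.
have skew0 v0 w0 t0 q0 : exch_defect y v0 w0 t0 q0 = 0 -> exch_defect y w0 v0 q0 t0 = 0.
  by move=> e; rewrite exch_defect_skew e oppr0.
have base i j t0 q0 : exch_defect y (a i) (a j) t0 q0 = 0.
  apply: (cocycle_eq (c := fun y => exch_defect y (a i) (a j) t0 q0) (c' := fun _ => 0)
    (lact_action hact)) => [f h|f h|k].
  - exact: exch_defect_cocycle.
  - by rewrite (lin0 (lact_linear hact f)) addr0.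
  rewrite /exch_defect /exch_Psi (Psi_ext_gen (k_lin _ _ _)).
  have pair0 v0 i0 t1 q1 : exch_pair (x k) v0 (a i0) t1 q1 = 0.
    rewrite /exch_pair pair_gen; case: eqP => _; last exact: (lin0 (linext_linear _)).
    rewrite (linN (linext_linear _)) linextU pair1 (lin0 (zactl _)).
    by rewrite (lin0 (lbrl _)) oppr0.
  have z1 q1 : zact (- basis 1%g) q1 = - q1.
    by rewrite (linN (zactl _)) zact_basis (lact1 hact).
  rewrite !pair0 /exch_br !pair_gen invg1 (lact1 hact) addr0 subr0.
  have [<-|ij] := eqVneq i j; last first.
    have [->|ki] := eqVneq k i; last by rewrite (lin0 (zactl _)) (lin0 (lbrl _)) subrr.
    by rewrite (negbTE ij) (lin0 (zactl q0)) (lin0 (lbrr _)) subrr.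
  case: eqP => _; last by rewrite !(lin0 (zactl _)) (lin0 (lbrl _)) subrr.
  rewrite !z1 (linN (lbrl _)) (linN (lbrr _)) opprK [{[q0, t0]}]lbrC opprK.
  by rewrite subrr.
have left v0 j t0 q0 : exch_defect y v0 (a j) t0 q0 = 0.
  elim/genW_ind: v0 t0 => [t0|c v1 v2 e1 e2 t0|f i t0].
  - exact: (lin0 (exch_defect_linear y (a j) t0 q0)).
  - by rewrite exch_defect_linear e1 e2 scaler0 addr0.
  by rewrite exch_defect_act.
apply: (skew0); elim/genW_ind: w q => [q0|c v1 v2 e1 e2 q0|f i q0].
- exact: (lin0 (exch_defect_linear y v q0 t)).
- by rewrite exch_defect_linear e1 e2 scaler0 addr0.
by rewrite exch_defect_act; apply: skew0; apply: left.
Qed.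

End Exchange.

End IntersectionOperations.
(** * Special derivations from trees *)

Lemma derivation_act (F : groupType) (W : lmodType rat) (act : F -> W -> W)
    (d : freeLie W -> freeLie W) f c : is_action act -> is_lie_derivation d ->
    (forall b, d (lmap (act f) (lgen b)) =
      lmap (act f) (d (lgen b)) + {[c, lmap (act f) (lgen b)]}) ->
  forall y, d (lmap (act f) y) = lmap (act f) (d y) + {[c, lmap (act f) y]}.
Proof.
move=> hact [ld db] dg; have lb := lbr_bilinear W; have lf := lact_linear hact f.
apply: (lie_eq (linear_comp ld lf) (linear_add (linear_comp lf ld)
  (linear_comp (lb.2 c) lf))) => [|y1 y2 e1 e2]; first exact: dg.
rewrite lact_br// !db (linD lf) !lact_br// e1 e2 (bilDl lb) (bilDr lb).
rewrite lbr_jacl [{[lmap (act f) y2, c]}]lbrC (bilNr lb).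
zmod.
Qed.

Section TreeDerivations.
Context (F : groupType) (W : lmodType rat) (act : F -> W -> W).
Context (g : nat) (x : 'I_g -> F) (a : 'I_g -> W).
Context (pair : freemod F -> W -> freemod F) (Psi : W -> W -> fmod F W) (zeta : W).
Hypothesis data : is_intersection_data act x a pair Psi zeta.
Notation L := (freeLie W).
Notation QF := (freemod F).
Notation zact := (zact act).
Notation "f '.*' b" := (lmap (act f) b) (at level 40).
Notation pr f w := (pair (basis f) w).

Let hact := data_action data.
Let pb := pair_bilinear (data_pair data).
Let PsiB := Psi_bilinear (data_Psi data).
Let lb := lbr_bilinear W.
Let lf := lact_linear hact.
Let zl := zactl data.
Let zr := zactr data.

(** The contributions of a leaf [v], the rest of the tree being [q], to the cocycle
    and to the derivation attached to a tree. *)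
Definition leaf_cocycle (f : F) (v : W) (q : L) : L := - zact (pr f v) q.

Definition leaf_gen (b v : W) (q : L) : L :=
  fmod_ext (fun h u => {[h^-1%g .* q, lgen u]}) (Psi v b).

Lemma leaf_cocycleE f v q : leaf_cocycle f v q = - zact (pr f v) q. Proof. by []. Qed.

Lemma leaf_genE b v q :
  leaf_gen b v q = fmod_ext (fun h u => {[h^-1%g .* q, lgen u]}) (Psi v b).
Proof. by []. Qed.

Let leaf_gen_k q h : linear (fun u => {[h^-1%g .* q, lgen u]}).
Proof. exact: (linear_comp (lb.2 _) (@lgen_linear W)). Qed.

Lemma leaf_cocycle_map f : is_leaf_map act (leaf_cocycle f) (fun _ _ => 0).
Proof.
split=> [|h|h w q]; last 1 first.
- by rewrite /leaf_cocycle (zact_pair_lact data) (lactKV hact) addr0.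
- split=> [q|v]; apply: linear_opp; last exact: zr.
  exact: (linear_comp (zl q) (pb.2 _)).
- exact: linear_zero.
Qed.

Lemma leaf_gen_bilinear b : bilinear_map (leaf_gen b).
Proof.
split=> [q|v]; first exact: (Psi_ext_linl data (leaf_gen_k q)).
move=> c q q'; have lk := leaf_gen_k.
rewrite /leaf_gen -(fmod_ext_lincomb c _ (lk q) (lk q')).
by apply: eq_fmod_ext => h u; rewrite (lf h^-1%g) lb.1.
Qed.

Lemma leaf_gen_linear v q : linear (fun b => leaf_gen b v q).
Proof. exact: (Psi_ext_linr data (leaf_gen_k q)). Qed.

Lemma leaf_gen_map b :
  is_leaf_map act (leaf_gen b) (fun f X => zact (antipode (pr f b)) (f .* X)).
Proof.
split=> [|f|f v q]; first exact: leaf_gen_bilinear.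
  exact: (linear_comp (zr _) (lf f)).
rewrite /leaf_gen (Psi_ext_actl data (leaf_gen_k _)); congr (_ + _).
  by apply: eq_fmod_ext => h u; rewrite -(lactM hact) invgM mulgVK.
rewrite /zact /galg_act /antipode linext_basis -linextN; apply: eq_linext => h.
rewrite -!(lactM hact) -(lact_gen hact) -lact_br// [{[q, _]}]lbrC.
by rewrite (linN (lf _)) opprK.
Qed.

Lemma leaf_gen_act f b v q :
  leaf_gen (act f b) v q =
  f .* leaf_gen b v q + {[leaf_cocycle f v q, f .* lgen b]}.
Proof.
rewrite /leaf_gen (Psi_ext_actr data (leaf_gen_k q)); congr (_ + _).
  rewrite (lin_fmod_ext _ (lf f)) => [|h]; last exact: leaf_gen_k.
  apply: eq_fmod_ext => h u; rewrite invgM invgK (lactM hact).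
  by rewrite lact_br// (lact_gen hact).
rewrite /leaf_cocycle (bilNl lb); congr (- _).
rewrite /zact /galg_act (lin_linext _ _ (lb.1 _)); apply: eq_linext => h.
by rewrite invgK (lact_gen hact).
Qed.

Lemma leaf_gen_zeta v q : leaf_gen zeta v q = - {[lgen v, q]}.
Proof.
by rewrite /leaf_gen (Psi_zeta data _ (leaf_gen_k q)) invg1 (lact1 hact) lbrC.
Qed.

Lemma leaf_cocycleM f h v q :
  leaf_cocycle (f * h)%g v q = leaf_cocycle f v q + f .* leaf_cocycle h v q.
Proof. by rewrite /leaf_cocycle (zact_pairM data) opprD (linN (lf f)). Qed.

(** The special derivation attached to [u] has [tree_cocycle u] for its cocycle and
    [tree_der u] for its derivation of the Lie algebra. Since the defects of
    [leaf_cocycle] and [leaf_gen] only depend on the bracket of the leaf with the rest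
    of the tree, their sums over the leaves make sense on the tree module. *)
Definition tree_cocycle (u : treemod act) (f : F) : L :=
  tree_functional (leaf_cocycle f) u.

Definition tree_gen (u : treemod act) (b : W) : L := tree_functional (leaf_gen b) u.

Definition tree_der (u : treemod act) : L -> L := lie_derivation (tree_gen u).

Notation join := (join act).

Lemma tree_cocycle_linear f : linear (tree_cocycle^~ f).
Proof. exact: (tree_functional_linear hact (leaf_cocycle_map f)). Qed.

Lemma tree_cocycle_join p q f :
  tree_cocycle (join p q) f = tree_sum (leaf_cocycle f) p q.
Proof. exact: (tree_functional_join hact (leaf_cocycle_map f)). Qed.

Lemma tree_gen_linearl b : linear (tree_gen^~ b).
Proof. exact: (tree_functional_linear hact (leaf_gen_map b)). Qed.

Lemma tree_gen_join p q b : tree_gen (join p q) b = tree_sum (leaf_gen b) p q.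
Proof. exact: (tree_functional_join hact (leaf_gen_map b)). Qed.

Lemma tree_gen_linear u : linear (tree_gen u).
Proof.
move=> c b b'; apply: (tree_eq hact (tree_gen_linearl _)
  (linear_lincomb c (tree_gen_linearl b) (tree_gen_linearl b'))) => p q.
rewrite !tree_gen_join -tree_sum_lincomb; try exact: leaf_gen_bilinear.
by apply: eq_tree_sum => v t; apply: leaf_gen_linear.
Qed.

Lemma tree_derP u : is_lie_derivation (tree_der u).
Proof. exact/lie_derivationP/tree_gen_linear. Qed.

Lemma tree_der_gen u b : tree_der u (lgen b) = tree_gen u b.
Proof. exact/lie_derivation_gen/tree_gen_linear. Qed.

Lemma tree_der_linearl y : linear (tree_der^~ y).
Proof.
move=> c u v; apply: (lie_derivation_eq (tree_derP _)
  (is_lie_derivation_lincomb c (tree_derP u) (tree_derP v))) => w.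
by rewrite !tree_der_gen tree_gen_linearl.
Qed.

Definition leaf_der (y : L) (v : W) (q : L) : L :=
  lie_derivation (fun b => leaf_gen b v q) y.

Lemma leaf_derP v q : is_lie_derivation (fun y => leaf_der y v q).
Proof. exact/lie_derivationP/leaf_gen_linear. Qed.

Lemma leaf_der_gen b v q : leaf_der (lgen b) v q = leaf_gen b v q.
Proof. exact: (lie_derivation_gen (leaf_gen_linear v q)). Qed.

Lemma leaf_der_bilinear y : bilinear_map (leaf_der y).
Proof.
split=> [q c v v'|v c q q'].
  apply: (lie_derivation_eq (leaf_derP _ _)
    (is_lie_derivation_lincomb c (leaf_derP v q) (leaf_derP v' q))) => b.
  by rewrite !leaf_der_gen (leaf_gen_bilinear b).1.
apply: (lie_derivation_eq (leaf_derP _ _)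
  (is_lie_derivation_lincomb c (leaf_derP v q) (leaf_derP v q'))) => b.
by rewrite !leaf_der_gen (leaf_gen_bilinear b).2.
Qed.

Lemma tree_der_join p q y : tree_der (join p q) y = tree_sum (leaf_der y) p q.
Proof.
apply: (lie_derivation_eq (tree_derP _) (d' := fun y => tree_sum (leaf_der y) p q)).
  split=> [c y1 y2|y1 y2].
    rewrite -tree_sum_lincomb; try exact: leaf_der_bilinear.
    by apply: eq_tree_sum => v t; rewrite (leaf_derP v t).1.
  rewrite -(tree_sum_comp (leaf_der_bilinear y1) (lb.1 y2)).
  rewrite -(tree_sum_comp (leaf_der_bilinear y2) (lb.2 y1)) -tree_sumD.
  - by apply: eq_tree_sum => v t; rewrite (leaf_derP v t).2.
  - have [l1 l2] := leaf_der_bilinear y1.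
    by split=> z; apply: (linear_comp (lb.1 y2)).
  - have [l1 l2] := leaf_der_bilinear y2.
    by split=> z; apply: (linear_comp (lb.2 y1)).
move=> b; rewrite tree_der_gen tree_gen_join.
by apply: eq_tree_sum => v t; rewrite leaf_der_gen.
Qed.

Lemma tree_cocycleM u f h :
  tree_cocycle u (f * h)%g = tree_cocycle u f + f .* tree_cocycle u h.
Proof.
apply: (tree_eq hact (tree_cocycle_linear _) (linear_add (tree_cocycle_linear f)
  (linear_comp (lf f) (tree_cocycle_linear h)))) => p q.
have [hf hh] := (leaf_map_bilinear (leaf_cocycle_map f), leaf_map_bilinear (leaf_cocycle_map h)).
rewrite !tree_cocycle_join -(tree_sum_comp hh (lf f)) -tree_sumD//.
  by apply: eq_tree_sum => v t; apply: leaf_cocycleM.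
by have [h1 h2] := hh; split=> z; apply: (linear_comp (lf f)).
Qed.

Lemma tree_gen_act u f b :
  tree_gen u (act f b) = f .* tree_gen u b + {[tree_cocycle u f, f .* lgen b]}.
Proof.
apply: (tree_eq hact (tree_gen_linearl _) (linear_add (linear_comp (lf f) (tree_gen_linearl b))
  (linear_comp (lb.1 _) (tree_cocycle_linear f)))) => p q.
have [h1 h2] := leaf_map_bilinear (leaf_cocycle_map f).
have [h3 h4] := leaf_gen_bilinear b.
rewrite !tree_gen_join tree_cocycle_join -(tree_sum_comp (leaf_gen_bilinear b) (lf f)).
rewrite -(tree_sum_comp (leaf_map_bilinear (leaf_cocycle_map f)) (lb.1 (f .* lgen b))).
rewrite -tree_sumD.
- by apply: eq_tree_sum => v t; apply: leaf_gen_act.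
- by split=> z; apply: (linear_comp (lf f)).
- by split=> z; apply: (linear_comp (lb.1 _)).
Qed.

Lemma tree_der_act u f y :
  tree_der u (f .* y) = f .* tree_der u y + {[tree_cocycle u f, f .* y]}.
Proof.
apply: (derivation_act hact (tree_derP u)) => b.
by rewrite (lact_gen hact) !tree_der_gen tree_gen_act (lact_gen hact).
Qed.

Lemma leaf_der_act y v q f :
  leaf_der (f .* y) v q = f .* leaf_der y v q + {[leaf_cocycle f v q, f .* y]}.
Proof.
apply: (derivation_act hact (leaf_derP v q)) => b.
by rewrite (lact_gen hact) !leaf_der_gen leaf_gen_act (lact_gen hact).
Qed.

(** By [leaf_gen_zeta], the value on [zeta] is the sum over the leaves of the bracket
    of the leaf with the rest of the tree, which vanishes. *)
Lemma tree_der_zeta u : tree_der u (lgen zeta) = 0.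
Proof.
rewrite tree_der_gen.
apply: (tree_eq hact (tree_gen_linearl zeta) (@linear_zero _ _)) => p q.
rewrite tree_gen_join -[RHS]oppr0 -(tree_sum_lie p q) -tree_sumN.
  by apply: eq_tree_sum => v t; apply: leaf_gen_zeta.
split=> z; last exact: lb.2.
exact: (linear_comp (lb.1 z) (@lgen_linear W)).
Qed.

End TreeDerivations.
(** * Trees and special derivations correspond *)

Lemma lie_brS (W : lmodType rat) (y z : freeLie W) : lie_br y z = {[y, z]}.
Proof. by rewrite lbr.unlock. Qed.

Lemma lie_genS (W : lmodType rat) (w : W) : lie_gen w = lgen w.
Proof. by rewrite lgen.unlock. Qed.

Lemma lie_mapS (W : lmodType rat) (h : W -> W) y : lie_map h y = lmap h y.
Proof. by rewrite lmap.unlock. Qed.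

Lemma derivation_deg (W : lmodType rat) (d : freeLie W -> freeLie W) m n y :
    is_lie_derivation d -> (forall w, lie_deg m.+1 (d (lgen w))) ->
  lie_deg n y -> lie_deg (n + m) (d y).
Proof.
move=> [ld db] dg; elim/lie_deg_ind => [|c y1 y2 d1 d2|t <-].
- by rewrite (lin0 ld); apply: span0.
- by rewrite ld; apply: spanD => //; apply: spanZ.
elim: t => [w|s ihs t iht] /=; first by rewrite add1n; apply: dg.
rewrite db; apply: spanD.
  by rewrite addnAC; apply: lie_deg_br ihs (lie_deg_word t).
by rewrite -addnA; apply: lie_deg_br (lie_deg_word s) iht.
Qed.

Section Correspondence.
Context (F : groupType) (W : lmodType rat) (act : F -> W -> W).
Context (g : nat) (x : 'I_g -> F) (a : 'I_g -> W).
Context (pair : freemod F -> W -> freemod F) (Psi : W -> W -> fmod F W) (zeta : W).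
Hypothesis data : is_intersection_data act x a pair Psi zeta.
Notation L := (freeLie W).
Notation QF := (freemod F).
Notation zact := (zact act).
Notation "f '.*' b" := (lmap (act f) b) (at level 40).
Notation pr f w := (pair (basis f) w).
Notation join := (join act).
Notation tree_cocycle := (tree_cocycle pair).
Notation tree_der := (tree_der Psi).
Notation leaf_cocycle := (leaf_cocycle act pair).

Let hact := data_action data.
Let pb := pair_bilinear (data_pair data).
Let lb := lbr_bilinear W.
Let lf := lact_linear hact.
Let zl := zactl data.
Let zr := zactr data.
Let hjoin := join_form hact.
Let joinB := form_bilinear hjoin.

Lemma tree_cocycle_deg m u f : tree_deg act m u -> lie_deg m (tree_cocycle u f).
Proof.
have lc := tree_cocycle_linear data f.
elim/(tree_deg_ind hact) => [|c v w dv dw|i j y z dy dz e].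
- by rewrite (lin0 lc); apply: span0.
- by rewrite (lc c v w); apply: (spanD (spanZ c dv) dw).
rewrite (tree_cocycle_join data).
apply: (tree_sum_deg (k := 0) (leaf_map_bilinear (leaf_cocycle_map data f)) _ dy dz).
  by move=> w k q dq; rewrite addn0; apply/spanN/(zact_deg hact).
by rewrite addn0.
Qed.

Lemma tree_gen_deg m u b : tree_deg act m u -> lie_deg m.+1 (tree_gen Psi u b).
Proof.
have lc := tree_gen_linearl data b.
elim/(tree_deg_ind hact) => [|c v w dv dw|i j y z dy dz e].
- by rewrite (lin0 lc); apply: span0.
- by rewrite (lc c v w); apply: (spanD (spanZ c dv) dw).
rewrite (tree_gen_join data).
apply: (tree_sum_deg (k := 1) (leaf_gen_bilinear data b) _ dy dz).
  move=> w k q dq; apply: span_sum => h _.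
  by apply: lie_deg_br (lie_deg_gen _); apply: lact_deg.
by rewrite e addn1.
Qed.

Lemma tree_special m u : tree_deg act m u ->
  is_special act zeta m (tree_cocycle u, tree_der u).
Proof.
move=> du; have dP := tree_derP data u; have [ld db] := dP.
split; last by rewrite lie_genS; apply: tree_der_zeta data u.
split=> //=.
- by move=> b c; rewrite !lie_brS.
- move=> n b; apply: derivation_deg => // w.
  by rewrite (tree_der_gen data); apply: tree_gen_deg.
- by move=> f; apply: tree_cocycle_deg.
- by move=> f h; rewrite lie_mapS; apply: tree_cocycleM data _ _ _.
- by move=> f b; rewrite !lie_mapS lie_brS; apply: tree_der_act data _ _ _.
Qed.

(** ** A special derivation is determined by its cocycle *)

(** Since [W] is free, W (x) L is Q[F] (x) L^g, where F acts on Q[F] only; this is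
    the coordinate of v (x) q with index [j]. *)
Definition coord (j : 'I_g) (v : W) (q : L) : fmod F L :=
  linext (fun h => delta h^-1%g (h .* q)) (pr (x j) v).

Definition shift (f : F) : fmod F L -> fmod F L :=
  fmod_ext (fun h => delta (f * h)%g).

Lemma shift_linear f : linear (shift f).
Proof. by apply: fmod_ext_linear => h; apply: delta_linear. Qed.

Lemma coord_bilinear j : bilinear_map (coord j).
Proof.
split=> [q|v c q q']; first exact: (linear_comp (linext_linear _) (pb.2 _)).
rewrite /coord -linext_lincomb; apply: eq_linext => h.
exact: (linear_comp (@delta_linear _ _ _) (lf h)).
Qed.

Lemma coord_act j f v q : coord j (act f v) (f .* q) = shift f (coord j v q).
Proof.
rewrite /coord (pair_lact data) /gmul linext_comp.
rewrite (lin_linext _ _ (shift_linear f)); apply: eq_linext => h.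
rewrite !linextU /shift fmod_ext_delta => [|k]; last exact: delta_linear.
by rewrite invgM invgK (lactM hact) (lactKV hact).
Qed.

(* A left inverse of W (x) L -> Q[F] (x) L^g, followed by the bracket. *)
Let uncoord (j : 'I_g) : fmod F L -> L :=
  fmod_ext (fun h l => {[h .* lgen (a j), h .* l]}).

Let uncoord_k j h : linear (fun l => {[h .* lgen (a j), h .* l]}).
Proof. exact: (linear_comp (lb.2 _) (lf h)). Qed.

Let uncoord_linear j : linear (uncoord j).
Proof. exact: (fmod_ext_linear (uncoord_k j)). Qed.

Let sum_uncoord (p q : L) :
  \sum_j uncoord j (leaf_sum (coord j) p q) = - {[p, q]}.
Proof.
have lgq (z : L) : linear (fun w : W => {[lgen w, z]}).
  exact: (linear_comp (lb.1 z) (@lgen_linear W)).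
have hG : bilinear_map (fun v (q : L) => - {[lgen v, q]}).
  by split=> z; apply: linear_opp; [exact: lgq|exact: lb.2].
have lsB j := leaf_sum_bilinear (coord_bilinear j).
transitivity (leaf_sum (fun v (q : L) => - {[lgen v, q]}) p q).
  apply: (leaf_sum_eq hG (E := fun p q => \sum_j uncoord j (leaf_sum (coord j) p q))) => //.
  - move=> z c u v; rewrite scaler_sumr -big_split; apply: eq_bigr => j _ /=.
    by rewrite (lsB j).1 uncoord_linear.
  - move=> w z.
    transitivity (\sum_j {[lgen (galg_act act (antipode (pr (x j) w)) (a j)), z]}).
      apply: eq_bigr => j _; rewrite (leaf_sum_gen (coord_bilinear j)) /coord.
      rewrite (lin_linext _ _ (uncoord_linear j)) -zact_gen// /antipode /zact /galg_act.
      rewrite linext_basis (lin_linext _ _ (lb.1 z)); apply: eq_linext => h.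
      by rewrite /uncoord (fmod_ext_delta (uncoord_k j)) (lactKV hact).
    rewrite -(bil_suml lb) -(lin_sum (@lgen_linear W)) (pair_coordinates data).
    by rewrite (linN (@lgen_linear W)) (bilNl lb).
  - move=> y z w; rewrite -big_split; apply: eq_bigr => j _ /=.
    by rewrite (leaf_sum_br (coord_bilinear j)) (linD (uncoord_linear j)).
rewrite (leaf_sum_comp (G := fun v (q : L) => {[lgen v, q]}) (f := -%R)).
- by rewrite leaf_sum_lie.
- by split=> z; [exact: lgq|exact: lb.2].
- exact: (linear_opp (@linear_id L)).
Qed.

(** The residues of the coordinates recover [euler p], which is a nonzero multiple of
    [p]. In degree 1 residues vanish. *)
Lemma residue_coord_inj n p : (1 < n)%N -> lie_deg n p ->
  (forall j, residue (coord j) p = 0) -> p = 0.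
Proof.
move=> n1 dp r0.
have lr j := residue_linear (coord_bilinear j).
suff eu : \sum_j uncoord j (residue (coord j) p) = euler p.
  move: eu; rewrite big1 => [|j _]; last by rewrite r0 (lin0 (uncoord_linear j)).
  rewrite (euler_deg dp) => /esym/eqP; rewrite scaler_eq0 Num.Theory.pnatr_eq0.
  by case: n n1 {dp} => // n _ /= /eqP.
have [le eb] := eulerP W.
move: dp; elim/lie_deg_ind => [|c y z ey ez|t tn].
- rewrite (lin0 le) big1// => j _.
  by rewrite (lin0 (lr j)) (lin0 (uncoord_linear j)).
- rewrite le -ey -ez scaler_sumr -big_split; apply: eq_bigr => j _ /=.
  by rewrite lr uncoord_linear.
case: t tn n1 => [w <-//|s t _ _ /=].
under eq_bigr => j _ do rewrite (residue_br (coord_bilinear j)) (linB (uncoord_linear j)).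
rewrite sumrB !sum_uncoord eb opprK [X in - X + _]lbrC opprK.
by [].
Qed.

(* Pairing with a k on the group coordinate, through the inversion. *)
Let dual (k : 'I_g) : fmod F L -> fmod F L :=
  fmod_ext (fun (h : F) l => linext (fun z => delta z l) (pr h^-1%g (a k))).

Let inv_coord : fmod F L -> fmod F L := fmod_ext (fun (h : F) l => delta h^-1%g l).

Let dual_k k h : linear (fun l : L => linext (fun z => delta z l) (pr h^-1%g (a k))).
Proof.
move=> c l l'; rewrite -linext_lincomb; apply: eq_linext => z.
exact: delta_linear.
Qed.

Let inv_k (h : F) : linear (fun l : L => delta h^-1%g l).
Proof. exact: delta_linear. Qed.

Let dual_shift k i u :
  dual k (shift (x i)^-1%g u) = dual k u - (if i == k then inv_coord u else 0).
Proof.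
have lk := fmod_ext_linear (dual_k k); have li := fmod_ext_linear inv_k.
have lif : linear (fun u => if i == k then inv_coord u else 0).
  by case: eqP => _; [exact: li|exact: linear_zero].
apply: (fmod_eq (linear_comp lk (shift_linear _)) (linear_add lk (linear_opp lif))) => h l.
have dd (z : F) : linear (@delta F L z) by exact: delta_linear.
rewrite /shift (fmod_ext_delta (fun z => dd _)) /dual !(fmod_ext_delta (dual_k k)).
rewrite invgM invgK (pairM data) (pair_gen data) (linD (linext_linear _)) addrC.
congr (_ + _); case: eqP => _; last first.
  by rewrite (bil0r (gmul_bilinear F)) (lin0 (linext_linear _)) oppr0.
rewrite (bilNr (gmul_bilinear F)) (linN (linext_linear _)) gmul_basis mulg1 linextU.
by rewrite /inv_coord (fmod_ext_delta inv_k).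
Qed.

Let inv_coordK u : inv_coord (inv_coord u) = u.
Proof.
have li := fmod_ext_linear inv_k.
apply: (fmod_eq (linear_comp li li) (@linear_id _)) => h l.
by rewrite /inv_coord !(fmod_ext_delta inv_k) invgK.
Qed.

(** Pairing with [a k] is a Fox derivative: it selects the coefficient of
    1 - (x k)^-1. *)
Lemma shift_indep (u : 'I_g -> fmod F L) :
  \sum_i (u i - shift (x i)^-1%g (u i)) = 0 -> forall k, u k = 0.
Proof.
move=> su k; have lk : linear (dual k) := fmod_ext_linear (dual_k k).
have li : linear inv_coord := fmod_ext_linear inv_k.
have := congr1 (dual k) su; rewrite (lin0 lk) (lin_sum lk).
under eq_bigr => i _ do rewrite (linB lk) dual_shift subKr.
rewrite -big_mkcond big_pred1_eq => uk.
by rewrite -[u k]inv_coordK uk (lin0 li).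
Qed.

Lemma special_lincomb m c (d e : (F -> L) * (L -> L)) :
    is_special act zeta m d -> is_special act zeta m e ->
  is_special act zeta m (fun f => c *: d.1 f + e.1 f, fun y => c *: d.2 y + e.2 y).
Proof.
move=> [[dl db dd d0 dc da] dz] [[el eb ed e0 ec ea] ez].
split=> /=; last by rewrite dz ez scaler0 addr0.
split=> /=.
- exact: linear_lincomb.
- move=> y z; rewrite db eb !lie_brS (bilDl lb) (bilDr lb) (bilZl lb) (bilZr lb).
  by rewrite scalerDr addrACA.
- by move=> n y dy; apply: (spanD (spanZ c (dd n y dy)) (ed n y dy)).
- by move=> f; apply: (spanD (spanZ c (d0 f)) (e0 f)).
- move=> f h; rewrite dc ec !lie_mapS (linD (lf f)) (linZ (lf f)) scalerDr.
  by rewrite addrACA.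
- move=> f y; rewrite da ea !lie_mapS !lie_brS (linD (lf f)) (linZ (lf f)).
  by rewrite scalerDr (bilDl lb) (bilZl lb) addrACA.
Qed.

Section SpecialDerivations.
Context (m : nat) (d : (F -> L) * (L -> L)).
Hypothesis hd : is_special act zeta m d.

Lemma special_derivation : is_lie_derivation d.2.
Proof.
have [[ld db _ _ _ _] _] := hd; split=> // y z.
by rewrite -!lie_brS db.
Qed.

Lemma special_cocycle f h : d.1 (f * h)%g = d.1 f + f .* d.1 h.
Proof. by have [[_ _ _ _ dc _] _] := hd; rewrite dc lie_mapS. Qed.

Lemma special_act f y : d.2 (f .* y) = f .* d.2 y + {[d.1 f, f .* y]}.
Proof. by have [[_ _ _ _ _ da] _] := hd; rewrite -!lie_mapS da lie_brS. Qed.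

Lemma special_zeta :
  \sum_i (d.2 (lgen (a i)) - (x i)^-1%g .* d.2 (lgen (a i)) +
          (x i)^-1%g .* {[d.1 (x i), lgen (a i)]}) = 0.
Proof.
have [_ dz] := hd; have [ld _] := special_derivation; rewrite -[RHS]dz lie_genS.
rewrite (data_zeta data) (lin_sum (@lgen_linear W)) (lin_sum ld).
apply: eq_bigr => i _; rewrite (linB (@lgen_linear W)) (linB ld) -(lact_gen hact).
rewrite special_act (cocycleV (lact_action hact) special_cocycle) lact_br//.
by rewrite (bilNl lb) opprD opprK addrA.
Qed.

(** When the cocycle vanishes, [special_zeta] says that the sum of the
    (1 - (x i)^-1) d(a i) is zero. Taking residues of coordinates turns the action of
    [F] on the Lie algebra into its regular action on Q[F], where the elements
    1 - (x i)^-1 are independent. *)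
Lemma special_unique : (0 < m)%N -> (forall i, d.1 (x i) = 0) ->
  (forall f, d.1 f = 0) /\ (forall y, d.2 y = 0).
Proof.
move=> m0 dx; have [ld db] := special_derivation.
have d0 f : d.1 f = 0.
  apply: (cocycle_eq data (c := d.1) (c' := fun _ => 0) (lact_action hact)) => //.
    exact: special_cocycle.
  by move=> f1 f2; rewrite (lin0 (lf f1)) addr0.
split=> //; have dg i : d.2 (lgen (a i)) = 0.
  apply: (residue_coord_inj (n := m.+1)) => // [|j].
    have [[_ _ dd _ _ _] _] := hd.
    by have := dd 1%N _ (lie_deg_gen (a i)); rewrite add1n.
  have lr := residue_linear (coord_bilinear j).
  have inv f p : residue (coord j) (f .* p) = shift f (residue (coord j) p).
    exact: (residue_equivariant hact (coord_bilinear j) (shift_linear f) (coord_act j f)).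
  apply: (shift_indep (u := fun i => residue (coord j) (d.2 (lgen (a i))))).
  under eq_bigr => k _ do rewrite -inv -(linB lr).
  rewrite -(lin_sum lr) -[RHS](lin0 lr) -[in RHS]special_zeta; congr residue.
  apply: eq_bigr => k _.
  by rewrite dx (bil0l lb) (lin0 (lf _)) addr0.
apply: (lie_eq ld (@linear_zero L L)) => [w|y z ey ez]; last first.
  by rewrite db ey ez (bil0l lb) (bil0r lb) addr0.
move: w; apply: (genW_ind data) => [|c v w ev ew|f i].
- by rewrite (lin0 (@lgen_linear W)) (lin0 ld).
- by rewrite lgen_linear ld ev ew scaler0 addr0.
by rewrite -(lact_gen hact) special_act dg d0 (bil0l lb) (lin0 (lf f)) addr0.
Qed.

(** This is a multiple of the preimage of a special derivation with cocycle [c]: the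
    leaf [a i] is only detected by [x i], whose cocycle value is planted on it. *)
Definition cocycle_tree (c : F -> L) : treemod act :=
  \sum_i join (lgen (a i)) (c (x i)).

(** Summing the leaves of this tree other than the [a i] against [x j] gives [m]
    times the value on [x j]: the relation of the boundary makes the residue of the
    sum vanish. *)
Lemma cocycle_tree_cocycle j :
  tree_cocycle (cocycle_tree d.1) (x j) = m.+1%:R *: d.1 (x j).
Proof.
have lt := tree_cocycle_linear data (x j).
pose G := leaf_cocycle (x j).
have hG := leaf_cocycle_map data (x j); have bG := leaf_map_bilinear hG.
have lr := residue_linear bG.
have Ga i q : G (a i) q = if i == j then q else 0.
  rewrite -[G _ _]/(- zact (pr (x j) (a i)) q) (pair_gen data) eq_sym; case: eqP => _.
    by rewrite (linN (zl q)) opprK zact_basis (lact1 hact).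
  by rewrite (lin0 (zl q)) oppr0.
have inv f p : residue G (f .* p) = residue G p.
  apply: (residue_equivariant hact bG (@linear_id L)) => w q.
  by rewrite (leaf_map_act hG) addr0.
have r0 : \sum_i residue G {[d.1 (x i), lgen (a i)]} = 0.
  apply: etrans (lin0 lr); rewrite -[in RHS]special_zeta (lin_sum lr).
  apply: eq_bigr => i _; rewrite (linD lr) (linB lr) !inv.
  by rewrite subrr add0r.
have dm i : euler (d.1 (x i)) = m%:R *: d.1 (x i).
  by have [[_ _ _ dd _ _] _] := hd; apply: euler_deg.
have ls i : leaf_sum G (d.1 (x i)) (lgen (a i)) =
    m%:R *: G (a i) (d.1 (x i)) - residue G {[d.1 (x i), lgen (a i)]}.
  rewrite (residue_br bG) euler_gen dm (leaf_sum_gen bG) (bilZr bG).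
  by rewrite opprB addrC subrK.
rewrite /cocycle_tree (lin_sum lt).
under eq_bigr => i _.
  rewrite (tree_cocycle_join data) /tree_sum (leaf_sum_gen bG) ls.
  over.
rewrite big_split sumrB r0 subr0 /= -scaler_sumr.
have -> : \sum_i G (a i) (d.1 (x i)) = d.1 (x j).
  rewrite (bigD1 j)//= big1 ?addr0 => [|i ij]; first by rewrite Ga eqxx.
  by rewrite Ga (negbTE ij).
by rewrite -{1}[d.1 (x j)]scale1r -scalerDl -[m.+1]add1n natrD.
Qed.

End SpecialDerivations.

(** The tree built from the values of the cocycle has the right cocycle up to the
    factor m + 1, and [special_unique] identifies the derivations. *)
Lemma special_surj m d : (0 < m)%N -> is_special act zeta m d ->
  exists2 u, tree_deg act m u &
    (forall f, tree_cocycle u f = d.1 f) /\ (forall y, tree_der u y = d.2 y).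
Proof.
move=> m0 hd; pose u := m.+1%:R^-1 *: cocycle_tree d.1.
have du : tree_deg act m u.
  apply/spanZ/span_sum => i _.
  suff : tree_deg act m (join (lgen (a i)) (d.1 (x i))) by [].
  apply: (join_deg act (lie_deg_gen _)); last by rewrite add1n.
  by have [[_ _ _ dd _ _] _] := hd; apply: dd.
exists u => //; have hu := tree_special du.
have he := special_lincomb (-1) hd hu.
have [|c0 d0] := special_unique he m0.
  move=> i /=; rewrite /u (linZ (tree_cocycle_linear data _)).
  rewrite (cocycle_tree_cocycle hd) scalerA mulVf ?Num.Theory.pnatr_eq0//.
  by rewrite scale1r scaleN1r addNr.
split=> z; [have := c0 z | have := d0 z]; rewrite /= scaleN1r addrC => /eqP.
  by rewrite subr_eq0 => /eqP.
by rewrite subr_eq0 => /eqP.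
Qed.

(** ** A tree is determined by its cocycle *)

Definition recover (u : treemod act) : treemod act := cocycle_tree (tree_cocycle u).

Lemma recover_linear : linear recover.
Proof.
move=> c u v; rewrite /recover /cocycle_tree scaler_sumr -big_split.
by apply: eq_bigr => i _ /=; rewrite (tree_cocycle_linear data) joinB.2.
Qed.

(** Each leaf v of the tree is replaced by its expression in the basis [a], so that
    every leaf contributes the tree itself. *)
Lemma recover_deg m u : tree_deg act m u -> recover u = m.+1%:R *: u.
Proof.
have lr := recover_linear.
elim/(tree_deg_ind hact) => [|c v w ev ew|i j y z dy dz e].
- by rewrite (lin0 lr) scaler0.
- by rewrite lr ev ew scalerDr !scalerA mulrC.
pose G v q := join (lgen v) q.
have jl q : linear (fun v => join (lgen v) q).
  exact: (linear_comp (joinB.1 q) (@lgen_linear W)).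
have bG : bilinear_map G by split=> q; [exact: jl|exact: joinB.2].
have lG p q : leaf_sum G p q = join (euler p) q.
  rewrite -(leaf_sum_form (eulerP W) p q joinB (form_lie hjoin)).
  by apply: eq_leaf_sum => v t; rewrite euler_gen.
have -> : recover (join y z) = tree_sum G y z.
  have lc k := leaf_map_bilinear (leaf_cocycle_map data (x k)).
  transitivity (tree_sum (fun v q =>
      \sum_k join (lgen (a k)) (leaf_cocycle (x k) v q)) y z).
    rewrite /recover /cocycle_tree tree_sum_sum => [|k].
      apply: eq_bigr => k _; rewrite (tree_cocycle_join data).
      by rewrite (tree_sum_comp (lc k) (joinB.2 _)).
    by have [h1 h2] := lc k; split=> q; apply: (linear_comp (joinB.2 _)).
  apply: eq_tree_sum => v q.
  transitivity (\sum_k - join (lgen (galg_act act (antipode (pr (x k) v)) (a k))) q).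
    apply: eq_bigr => k _; rewrite -(zact_gen hact) (form_zact hact hjoin).
    by rewrite antipodeK (bilNr joinB).
  rewrite sumrN -(lin_sum (jl q)) (pair_coordinates data) (linN (jl q)).
  by rewrite opprK.
rewrite /tree_sum !lG (euler_deg dy) (euler_deg dz) !(bilZl joinB).
by rewrite [join z y](form_sym hjoin) -scalerDl -natrD e.
Qed.

End Correspondence.
(** * The Lie bracket of trees *)

Section TreeBracket.
Context (F : groupType) (W : lmodType rat) (act : F -> W -> W).
Context (g : nat) (x : 'I_g -> F) (a : 'I_g -> W).
Context (pair : freemod F -> W -> freemod F) (Psi : W -> W -> fmod F W) (zeta : W).
Hypothesis data : is_intersection_data act x a pair Psi zeta.
Notation L := (freeLie W).
Notation QF := (freemod F).
Notation zact := (zact act).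
Notation "f '.*' b" := (lmap (act f) b) (at level 40).
Notation pr f w := (pair (basis f) w).
Notation join := (join act).
Notation tc := (tree_class act).
Notation tree_val := (tree_val act).
Notation edge_act := (edge_act act).
Notation bead_act := (bead_act act).
Notation tree_cocycle := (tree_cocycle pair).
Notation tree_der := (tree_der Psi).
Notation tree_gen := (tree_gen Psi).
Notation leaf_cocycle := (leaf_cocycle act pair).
Notation leaf_gen := (leaf_gen act Psi).
Notation leaf_der := (leaf_der act Psi).
Notation back bs := (rev [seq antipode b | b <- bs]).

Let hact := data_action data.
Let pb := pair_bilinear (data_pair data).
Let lb := lbr_bilinear W.
Let lf := lact_linear hact.
Let zl := zactl data.
Let zr := zactr data.
Let hjoin := join_form hact.
Let joinB := form_bilinear hjoin.

Definition leaf_join (u : treemod act) (w : W) (q : L) : treemod act :=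
  join (tree_der u (lgen w)) q.

(** The derivation of [u] applied to a tree [v], leaf by leaf. *)
Definition bracket (u v : treemod act) : treemod act := tree_functional (leaf_join u) v.

Lemma leaf_join_map u :
  is_leaf_map act (leaf_join u) (fun f X => join (tree_cocycle u f) (f .* X)).
Proof.
have [ld db] := tree_derP data u.
split=> [|f|f w q].
- split=> [q|w]; last exact: joinB.2.
  exact: (linear_comp (joinB.1 q) (linear_comp ld (@lgen_linear W))).
- exact: (linear_comp (joinB.2 _) (lf f)).
rewrite /leaf_join -(lact_gen hact) (tree_der_act data) (bilDl joinB).
by rewrite (form_act hjoin) (form_lie hjoin) -lact_br.
Qed.

Lemma bracket_linearr u : linear (bracket u).
Proof. exact: (tree_functional_linear hact (leaf_join_map u)). Qed.

Lemma bracket_join u p q :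
  bracket u (join p q) = join (tree_der u p) q + join (tree_der u q) p.
Proof.
rewrite /bracket (tree_functional_join hact (leaf_join_map u)) /tree_sum.
by rewrite !(leaf_sum_form (tree_derP data u) _ _ joinB (form_lie hjoin)).
Qed.

Lemma bracket_linearl v : linear (bracket^~ v).
Proof.
move=> c u u'; apply: (tree_eq hact (bracket_linearr _)
  (linear_lincomb c (bracket_linearr u) (bracket_linearr u'))) => p q.
rewrite !bracket_join !(tree_der_linearl data) !(bilDl joinB) !(bilZl joinB).
by rewrite scalerDr addrACA.
Qed.

(** ** Compatibility with the bracket of derivations *)

Section Cocycle.
Context (p q : L) (y : F).
Notation D := (join p q).
Notation H := (leaf_cocycle y).
Let HB f := leaf_map_bilinear (leaf_cocycle_map data f).

Let leaf_sum_H f X Z : leaf_sum H (f .* X) (f .* Z) = leaf_sum H X Z.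
Proof. by rewrite (leaf_sum_lact hact (leaf_cocycle_map data y)) addr0. Qed.

Let leaf_gen_skew v w t :
  leaf_gen v w t = fmod_ext (fun h u => {[h .* t, h .* lgen u]}) (Psi v w).
Proof.
have lk h : linear (fun u => {[h^-1%g .* t, lgen u]}).
  exact: (linear_comp (lb.2 _) (@lgen_linear W)).
rewrite leaf_genE (Psi_skew data v w lk); apply: eq_fmod_ext => h u.
by rewrite invgK (lact_gen hact).
Qed.

(* Grafting the leaf w of another tree on the leaf v, seen from a third leaf. *)
Let leaf_sum_leaf_gen v w t z :
  leaf_sum H (leaf_gen w v t) z =
  - leaf_sum H t (leaf_der (lgen v) w z) - exch_Psi act pair Psi y v w t z.
Proof.
have lH := leaf_sum_bilinear (HB y).
have k1 h : linear (fun u => {[h^-1%g .* t, lgen u]}).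
  exact: (linear_comp (lb.2 _) (@lgen_linear W)).
have k2 h : linear (fun u => {[h .* z, h .* lgen u]}).
  exact: (linear_comp (lb.2 _) (linear_comp (lf h) (@lgen_linear W))).
have k3 h : linear (fun u => zact (pr y u) {[z, h^-1%g .* t]}).
  exact: (linear_comp (zl _) (pb.2 _)).
rewrite leaf_genE (leaf_der_gen data) leaf_gen_skew.
rewrite (lin_fmod_ext _ (lH.1 z) k1) (lin_fmod_ext _ (lH.2 t) k2) /exch_Psi.
have lN := linear_opp (@linear_id L).
rewrite (lin_fmod_ext _ lN k3) (lin_fmod_ext _ lN (fun h => linear_comp (lH.2 t) (k2 h))).
rewrite -fmod_extD => [|h|h].
- apply: eq_fmod_ext => h u; rewrite (leaf_sum_br (HB y)) (leaf_sum_gen (HB y)).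
  congr (_ + _); rewrite -(leaf_sum_H h) (lactK hact) lact_br//.
  by rewrite [{[h .* lgen u, _]}]lbrC (bilNr lH).
- exact: (linear_opp (linear_comp (lH.2 t) (k2 h))).
- exact: (linear_opp (k3 h)).
Qed.

(* For the contributions of a leaf v of D and a leaf w of the other tree, this is the
   vanishing of [exch_defect]; the remaining terms range over ordered pairs of leaves
   of D, and cancel by [two_leaves]. *)
Let leaf_identity w z :
  leaf_sum H (tree_der D (lgen w)) z + H w (tree_der D z) =
  tree_der D (H w z) - leaf_der (tree_cocycle D y) w z -
  {[tree_cocycle D y, H w z]}.
Proof.
have [ld db] := tree_derP data D; have dP := leaf_derP data w z; have [ll l2] := dP.
have lH := leaf_sum_bilinear (HB y); have hg := leaf_gen_bilinear data w.
pose L1 v t := leaf_sum H (leaf_gen w v t) z.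
pose R1 v t := linext (fun h => {[leaf_cocycle h v t, h .* z]}) (pr y w).
pose R2 v t := leaf_der (H v t) w z.
pose R3 v t := {[H v t, H w z]}.
pose A1 v t := leaf_sum H t (leaf_der (lgen v) w z).
pose A2 v t := H v (leaf_der t w z).
have b1 : bilinear_map L1 by exact: (bilinear_comp (lH.1 z) hg).
have bh h : bilinear_map (fun v t => {[leaf_cocycle h v t, h .* z]}).
  exact: (bilinear_comp (lb.1 _) (HB h)).
have br1 : bilinear_map R1.
  split=> v c u u'; rewrite /R1 -linext_lincomb; apply: eq_linext => h.
    exact: (bh h).1.
  exact: (bh h).2.
have br2 : bilinear_map R2 by exact: (bilinear_comp ll (HB y)).
have br3 : bilinear_map R3 by exact: (bilinear_comp (lb.1 _) (HB y)).
have ba1 : bilinear_map A1.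
  split=> v; last exact: lH.1.
  exact: (linear_comp (lH.2 v) (linear_comp ll (@lgen_linear W))).
have ba2 : bilinear_map A2.
  split=> v; first exact: (HB y).1.
  exact: (linear_comp ((HB y).2 v) ll).
have E1 : leaf_sum H (tree_der D (lgen w)) z = tree_sum L1 p q.
  by rewrite (tree_der_gen data) (tree_gen_join data) -(tree_sum_comp hg (lH.1 z)).
have E2 : tree_der D (H w z) = H w (tree_der D z) - tree_sum R1 p q.
  rewrite /R1 tree_sum_linext// !leaf_cocycleE (linN ld) -opprD.
  congr (- _); rewrite /zact /galg_act (lin_linext _ _ ld) -linextD.
  apply: eq_linext => h; rewrite (tree_der_act data) (tree_cocycle_join data).
  by rewrite -(tree_sum_comp (HB h) (lb.1 (h .* z))).
have E3 : leaf_der (tree_cocycle D y) w z = tree_sum R2 p q.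
  by rewrite (tree_cocycle_join data) -(tree_sum_comp (HB y) ll).
have E4 : {[tree_cocycle D y, H w z]} = tree_sum R3 p q.
  by rewrite (tree_cocycle_join data) -(tree_sum_comp (HB y) (lb.1 _)).
have two : tree_sum A1 p q = tree_sum A2 p q by exact: (two_leaves dP (HB y)).
suff S : tree_sum L1 p q + tree_sum A1 p q + tree_sum R1 p q + tree_sum R2 p q +
    tree_sum R3 p q = tree_sum A2 p q.
  rewrite E1 E2 E3 E4; move: S; rewrite two => S.
  apply: (addIr (tree_sum A2 p q)); rewrite -{2}S; zmod.
have b2 := bilinear_add b1 ba1; have b3 := bilinear_add b2 br1.
have b4 := bilinear_add b3 br2.
rewrite -(tree_sumD _ _ b1 ba1) -(tree_sumD _ _ b2 br1) -(tree_sumD _ _ b3 br2).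
rewrite -(tree_sumD _ _ b4 br3); apply: eq_tree_sum => v t.
have R1E : R1 v t = - exch_pair act pair y v w t z.
  rewrite /R1 -linextN; apply: eq_linext => h.
  by rewrite leaf_cocycleE (bilNl lb).
have R2E : R2 v t = A2 v t + exch_pair act pair y w v z t.
  rewrite /R2 /A2 !leaf_cocycleE (linN ll) /exch_pair.
  rewrite /zact /galg_act (lin_linext _ _ ll) -!linextN -linextD.
  apply: eq_linext => h; rewrite (leaf_der_act data) leaf_cocycleE (bilNl lb).
  by rewrite opprD opprK.
have R3E : R3 v t = exch_br act pair y v w t z.
  by rewrite /R3 !leaf_cocycleE (bilNl lb) (bilNr lb) opprK.
have := exch_defect0 data y v w t z; rewrite /exch_defect => e0.
rewrite R1E R2E R3E /L1 leaf_sum_leaf_gen -/(A1 v t) -[RHS]subr0 -e0.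
zmod.
Qed.

Lemma tree_cocycle_bracket_join r s :
  tree_cocycle (bracket D (join r s)) y =
  tree_der D (tree_cocycle (join r s) y) - tree_der (join r s) (tree_cocycle D y) -
  {[tree_cocycle D y, tree_cocycle (join r s) y]}.
Proof.
have dP := tree_derP data D; have [ld db] := dP.
have b1 := bilinear_comp ld (HB y).
have b2 := leaf_der_bilinear data (tree_cocycle D y).
have b3 := bilinear_comp (lb.2 (tree_cocycle D y)) (HB y).
have b12 : bilinear_map (fun w z =>
    tree_der D (H w z) - leaf_der (tree_cocycle D y) w z).
  by apply: bilinear_add => //; apply: bilinear_comp (linear_opp (@linear_id L)) _.
rewrite bracket_join (linD (tree_cocycle_linear data y)) !(tree_cocycle_join data).
rewrite -(tree_cocycle_join data p q y).
rewrite (tree_der_join data r s) -(tree_sum_comp (HB y) ld).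
rewrite -(tree_sum_comp (HB y) (lb.2 _)) -tree_sumB// -tree_sumB//.
transitivity (tree_sum (fun w z =>
    leaf_sum H (tree_der D (lgen w)) z + H w (tree_der D z)) r s).
  rewrite [RHS]/tree_sum -!(leaf_sum_derivation dP (HB y)) /tree_sum.
  zmod.
by apply: eq_tree_sum => w z; apply: leaf_identity.
Qed.

End Cocycle.

(** The right-hand side is the cocycle of the bracket of the derivations attached to
    [u] and [v]. *)
Theorem tree_cocycle_bracket u v y :
  tree_cocycle (bracket u v) y =
  tree_der u (tree_cocycle v y) - tree_der v (tree_cocycle u y) -
  {[tree_cocycle u y, tree_cocycle v y]}.
Proof.
have lc := tree_cocycle_linear data y; have dl := tree_der_linearl data.
have ld w := (tree_derP data w).1.
have lu (v0 : treemod act) : linear (fun u : treemod act => tree_der u (tree_cocycle v0 y) -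
    tree_der v0 (tree_cocycle u y) - {[tree_cocycle u y, tree_cocycle v0 y]}).
  apply: linear_add; last exact: (linear_opp (linear_comp (lb.1 (tree_cocycle v0 y)) lc)).
  by apply: linear_add; [exact: dl | exact: (linear_opp (linear_comp (ld v0) lc))].
apply: (tree_eq hact (linear_comp lc (bracket_linearl v)) (lu v)) => p q.
have lv (u0 : treemod act) : linear (fun v : treemod act => tree_der u0 (tree_cocycle v y) -
    tree_der v (tree_cocycle u0 y) - {[tree_cocycle u0 y, tree_cocycle v y]}).
  apply: linear_add; last exact: (linear_opp (linear_comp (lb.2 (tree_cocycle u0 y)) lc)).
  by apply: linear_add; [exact: (linear_comp (ld u0) lc) | exact: (linear_opp (dl _))].
apply: (tree_eq hact (linear_comp lc (bracket_linearr _)) (lv _)) => r s.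
exact: tree_cocycle_bracket_join.
Qed.

(** ** The bracket as branching and grafting *)

Let class_linear := @cls_is_linear _ (tree_rel act).

Lemma class_branch v eD D w eE E :
  cls (tree_rel act) (branch_at Psi (v, eD, D) (w, eE, E)) =
  join (leaf_gen w v (edge_act eD (tree_val D))) (edge_act eE (tree_val E)).
Proof.
set X := edge_act eD _; set Y := edge_act eE _.
pose T f u := Cut (Leaf F u) (true, [::]) (Node eE E (add_bead eD (basis f)) D).
have TE f u : tc (T f u) = join {[f^-1%g .* X, lgen u]} Y.
  rewrite (class_join hact) /=.
  have -> : edge_act (add_bead eD (basis f)) (tree_val D) = f^-1%g .* X.
    rewrite /X /add_bead; case: (eD) => [[] bs].
      by rewrite !edge_act_fwd /= antipode_basis zact_basis.
    by rewrite !edge_act_bwd map_rcons rev_rcons /= antipode_basis zact_basis.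
  by rewrite edge_act_fwd /= (form_sym hjoin) (form_lie hjoin) (form_sym hjoin).
have lT f : linear (fun u => tc (T f u)).
  move=> c u u'; rewrite !TE lgen_linear lb.2 joinB.1.
  by [].
transitivity (fmod_ext (fun f u => tc (T f u)) (Psi v w)).
  have [r ur sr] := fin_suppP (Psi v w).
  pose r0 := [seq f <- r | Psi v w f != 0].
  have ur0 : uniq r0 by apply: filter_uniq.
  rewrite (fmod_ext_seq lT ur0) => [|f fn0]; last by rewrite mem_filter fn0 sr.
  rewrite /branch_at (fsbigE r0)//=; first last.
  - by move=> f fn0; rewrite mem_filter fn0 sr.
  - by move=> f; rewrite /= mem_filter => /andP[].
  rewrite (lin_sum class_linear) big_mkcond big_seq [RHS]big_seq.
  apply: eq_bigr => f; rewrite mem_filter => /andP[fn0 _].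
  by rewrite ifT// inE.
rewrite (eq_fmod_ext _ TE) leaf_genE.
rewrite (lin_fmod_ext _ (joinB.1 Y)) // => f.
exact: (linear_comp (lb.2 _) (@lgen_linear W)).
Qed.

Lemma class_graft t bs b bs' s w eE E :
  cls (tree_rel act) (graft_at (Theta pair) (t, bs, b, bs', s) (w, eE, E)) =
  linext (fun f => linext (fun h => join (bead_act (back bs) (tree_val t))
    (h .* {[(h^-1 * f)%g .* bead_act bs' (tree_val s), edge_act eE (tree_val E)]}))
    (pr f w)) b.
Proof.
rewrite /graft_at (lin_linext _ _ class_linear) /Theta linext_comp.
apply: eq_linext => f; rewrite linext_basis; apply: eq_linext => h /=.
rewrite -/(tc _) (class_join hact) /= edge_act_fwd -cats1 bead_act_cat /= zact_basis.
rewrite (form_sym hjoin) (form_bead hact hjoin) (form_sym hjoin) edge_act_fwd /=.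
by rewrite zact_basis.
Qed.

(* A bead of D on which the leaf w is grafted is a defect of moving the leaves of D
   through this bead. *)
Let class_graft_left b v eE E :
  cls (tree_rel act) (graft_at (Theta pair) b (v, eE, E)) =
  - join (bead_term act (fun f X => zact (antipode (pr f v)) (f .* X)) b)
      (edge_act eE (tree_val E)).
Proof.
case: b => [[[[t bs] b] bs'] s]; rewrite class_graft /=; set Y := edge_act eE _.
set S := bead_act bs' _; set T := bead_act _ _.
rewrite (lin_linext _ _ (joinB.1 Y)) -linextN; apply: eq_linext => f.
rewrite /zact /galg_act /antipode linext_basis (lin_linext _ _ (joinB.1 Y)) -linextN.
apply: eq_linext => h; rewrite -[LHS](form_act hjoin h^-1%g) (lactKV hact).
rewrite -(form_lie hjoin) !(lact_br hact) (lactK hact) -(lactM hact).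
by rewrite -(bilNl joinB) -lbrC.
Qed.

(* A bead of E on which the leaf v of D is grafted is where the cocycle of D comes
   in. *)
Let class_graft_right b v eD D :
  cls (tree_rel act) (graft_at (Theta pair) b (v, eD, D)) =
  bead_term act (fun f X => join (leaf_cocycle f v (edge_act eD (tree_val D))) (f .* X)) b.
Proof.
case: b => [[[[t bs] b] bs'] s]; rewrite class_graft /=; set Y := edge_act eD _.
set S := bead_act bs' _; set T := bead_act _ _.
apply: eq_linext => f; rewrite leaf_cocycleE (bilNl joinB) /zact /galg_act.
rewrite (lin_linext _ _ (joinB.1 _)) -linextN; apply: eq_linext => h.
rewrite !lact_br// (lactK hact) -(lactM hact) mulVKg -(form_lie hjoin).
by rewrite (form_sym hjoin) lbrC (bilNr joinB).
Qed.

(** The derivation of D is applied to each leaf w of E. By [tree_functional_class], it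
    is a sum over the leaves of D, which yields the branchings, plus defects located
    at the beads of D, which yield the graftings on D. The same formula for the sum
    over the leaves w gives defects at the beads of E, where the cocycle of D enters:
    these are the graftings on E. *)
Theorem tree_br_bracket D E :
  tree_br act (Theta pair) Psi D E = bracket (tc D) (tc E).
Proof.
rewrite /bracket (tree_functional_class hact (leaf_join_map _)).
rewrite /tree_br (linD class_linear) (linB class_linear).
have sumE (I J : Type) (r : seq I) (s : seq J) (f : I -> J -> freemod (tree F W)) :
    cls (tree_rel act) (\sum_(i <- r) \sum_(j <- s) f i j) =
    \sum_(i <- r) \sum_(j <- s) cls (tree_rel act) (f i j).
  rewrite (lin_sum class_linear); apply: eq_bigr => i _.
  by rewrite (lin_sum class_linear).
rewrite /branching /grafting !sumE; congr (_ + _).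
  rewrite exchange_big [X in _ - X]exchange_big /= -sumrB.
  apply: eq_bigr => -[[w eE] E'] _ /=; rewrite /leaf_join (tree_der_gen data).
  rewrite -[tree_gen _ _]/(tree_functional (leaf_gen w) _).
  rewrite (tree_functional_class hact (leaf_gen_map data w)).
  rewrite (bilDl joinB) !(bil_suml joinB); congr (_ + _).
    by apply: eq_bigr => -[[v eD] D'] _; rewrite class_branch.
  by rewrite -sumrN; apply: eq_bigr => b _; rewrite class_graft_left opprK.
apply: eq_bigr => b _.
transitivity (\sum_(q <- leaves D)
    bead_term act (fun f X => join (leaf_term act (leaf_cocycle f) q) (f .* X)) b).
  by apply: eq_bigr => -[[v eD] D'] _; rewrite class_graft_right.
case: b => [[[[t bs] b] bs'] s] /=; rewrite -linext_sum; apply: eq_linext => f.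
rewrite -(bil_suml joinB) -[tree_cocycle _ _]/(tree_functional (leaf_cocycle f) _).
rewrite (tree_functional_class hact (leaf_cocycle_map data f)).
rewrite [X in _ = join (_ + X) _]big1 ?addr0// => -[[[[t' bs1] b'] bs1'] s'] _ /=.
exact: linext0.
Qed.

End TreeBracket.
(** * The isomorphism of graded Lie algebras *)

(** The Jacobi identity is checked on cocycles, where it only involves three
    derivations and three elements of the free Lie algebra. *)
Lemma cocycle_jacobi (W V : lmodType rat) (br : V -> V -> V) (c : V -> freeLie W)
    (d : V -> freeLie W -> freeLie W) :
    linear c -> (forall u, is_lie_derivation (d u)) ->
    (forall u v, c (br u v) = d u (c v) - d v (c u) - {[c u, c v]}) ->
    (forall u v y, d (br u v) y = d u (d v y) - d v (d u y)) ->
  forall u v w, c (br u (br v w) + br v (br w u) + br w (br u v)) = 0.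
Proof.
move=> lc dP cE dE u v w; have lb := lbr_bilinear W.
have ld z := (dP z).1; have db z := (dP z).2.
rewrite (linD lc) (linD lc) !cE !dE.
move: (c u) (c v) (c w) => cu cv cw.
rewrite !(linB (ld _)) !db !(bilBr lb).
rewrite [{[cw, d u cv]}]lbrC [{[d v cw, cu]}]lbrC.
rewrite [{[d w cu, cv]}]lbrC -[RHS](lbr_jacobi cu cv cw).
zmod.
Qed.

Section Isomorphism.
Context (F : groupType) (W : lmodType rat) (act : F -> W -> W).
Context (g : nat) (x : 'I_g -> F) (a : 'I_g -> W).
Context (pair : freemod F -> W -> freemod F) (Psi : W -> W -> fmod F W) (zeta : W).
Hypothesis data : is_intersection_data act x a pair Psi zeta.
Notation L := (freeLie W).
Notation "f '.*' b" := (lmap (act f) b) (at level 40).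
Notation join := (join act).
Notation tc := (tree_class act).
Notation tree_cocycle := (tree_cocycle pair).
Notation tree_der := (tree_der Psi).
Notation bracket := (bracket (act := act) Psi).

Let hact := data_action data.
Let lb := lbr_bilinear W.
Let lf := lact_linear hact.
Let hjoin := join_form hact.
Let joinB := form_bilinear hjoin.

Lemma special_der_br m n d e :
    is_special act zeta m d -> is_special act zeta n e ->
  is_special act zeta (m + n) (der_br d e).
Proof.
move=> hd he; have [dl db] := special_derivation hd; have [el eb] := special_derivation he.
have [[_ _ dd d0 _ _] dz] := hd; have [[_ _ ed e0 _ _] ez] := he.
have [dc da] := (special_cocycle hd, special_act hd).
have [ec ea] := (special_cocycle he, special_act he).
split=> /=; last by rewrite dz ez (lin0 dl) (lin0 el) subrr.
split=> /=.
- exact: (linear_add (linear_comp dl el) (linear_opp (linear_comp el dl))).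
- move=> y z; rewrite !lie_brS db eb !(linD dl) !(linD el) !db !eb.
  rewrite (bilBl lb) (bilBr lb); zmod.
- move=> k y dy; apply: spanD; first by rewrite [(m + n)%N]addnC addnA; apply/dd/ed.
  by rewrite addnA; apply/spanN/ed/dd.
- move=> f; apply: spanD; first apply: spanD.
  + by rewrite addnC; apply: dd.
  + by apply/spanN/ed.
  + by rewrite lie_brS; apply/spanN/lie_deg_br.
- move=> f h; rewrite dc ec !lie_brS lie_mapS (linD dl) (linD el) da ea.
  rewrite !(linB (lf f)) (bilDl lb) !(bilDr lb) (lact_br hact).
  rewrite [{[f .* d.1 h, e.1 f]}]lbrC; zmod.
- move=> f y; rewrite !lie_brS !lie_mapS da ea (linD dl) (linD el) db eb !da !ea.
  rewrite (linB (lf f)) !(bilDr lb) !(bilBl lb) lbr_jacl [{[f .* y, d.1 f]}]lbrC.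
  rewrite (bilNr lb); zmod.
Qed.

Lemma bracket_deg m n u v :
  tree_deg act m u -> tree_deg act n v -> tree_deg act (m + n) (bracket u v).
Proof.
move=> du; have lr := bracket_linearr data u.
elim/(tree_deg_ind hact) => [|c v1 v2 d1 d2|i j y z dy dz e].
- by rewrite (lin0 lr); apply: span0.
- by rewrite (lr c v1 v2); apply: (spanD (spanZ c d1) d2).
have [[_ _ dd _ _ _] _] := tree_special data du.
rewrite (bracket_join data); apply: spanD.
  apply: (join_deg act (dd i y dy) dz).
  by rewrite addnAC e addSn addnC.
apply: (join_deg act (dd j z dz) dy).
by rewrite addnAC [(j + i)%N]addnC e addSn addnC.
Qed.

(** In positive degree, two special derivations with the same cocycle agree. *)
Lemma tree_der_bracket u v y :
  tree_der (bracket u v) y = tree_der u (tree_der v y) - tree_der v (tree_der u y).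
Proof.
have dl := tree_der_linearl data; have ld w := (tree_derP data w).1.
have hom m n u0 v0 : (0 < m)%N -> tree_deg act m u0 -> tree_deg act n v0 ->
    tree_der (bracket u0 v0) y =
    tree_der u0 (tree_der v0 y) - tree_der v0 (tree_der u0 y).
  move=> m0 du dv.
  have s1 := tree_special data (bracket_deg du dv).
  have s2 := special_der_br (tree_special data du) (tree_special data dv).
  have s := special_lincomb data (-1) s1 s2.
  have [|i|_ d0] := special_unique data s; first by rewrite addn_gt0 m0.
    by rewrite /= scaleN1r (tree_cocycle_bracket data) lie_brS addNr.
  have := d0 y; rewrite /= scaleN1r addrC => /eqP.
  by rewrite subr_eq0 => /eqP.
have degT T : tree_deg act (degree T) (tc T) by apply: span_gen; exists T.
have lu (v0 : treemod act) : linear (fun u : treemod act => tree_der u (tree_der v0 y) - tree_der v0 (tree_der u y)).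
  exact: (linear_add (dl (tree_der v0 y)) (linear_opp (linear_comp (ld v0) (dl y)))).
have lv (u0 : treemod act) : linear (fun v : treemod act => tree_der u0 (tree_der v y) - tree_der v (tree_der u0 y)).
  exact: (linear_add (linear_comp (ld u0) (dl y)) (linear_opp (dl (tree_der u0 y)))).
have lbl v0 := linear_comp (dl y) (bracket_linearl data v0).
have lbr0 u0 := linear_comp (dl y) (bracket_linearr data u0).
apply: (treemod_eq (lbl v) (lu v)) => T.
apply: (treemod_eq (lbr0 (tc T)) (lv (tc T))) => T'.
exact: (hom (degree T) (degree T')).
Qed.

Lemma tree_deg_indep n (u : 'I_n -> treemod act) :
  (forall i : 'I_n, tree_deg act i (u i)) -> \sum_i u i = 0 -> forall i, u i = 0.
Proof.
move=> du; apply: (eigen_indep (recover_linear data) (c := fun i => i.+1%:R)).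
  by move=> i j /eqP; rewrite Num.Theory.eqr_nat eqSS => /eqP/val_inj.
by move=> i; apply: (recover_deg data).
Qed.

Lemma tree_decomposition (u : treemod act) :
  exists n (v : nat -> treemod act), (forall i, tree_deg act i (v i)) /\
    (forall i, (n <= i)%N -> v i = 0) /\ u = \sum_(i < n) v i.
Proof.
move: u; apply: treemod_ind => [|c u1 u2 [n1 [v1 [d1 [z1 ->]]]] [n2 [v2 [d2 [z2 ->]]]]|T].
- exists 0%N, (fun _ => 0); split=> [i|]; first exact: span0.
  by rewrite big_ord0.
- exists (maxn n1 n2), (fun i => c *: v1 i + v2 i); split=> [i|].
    exact: (spanD (spanZ c (d1 i)) (d2 i)).
  split=> [i|]; first by rewrite geq_max => /andP[/z1-> /z2->]; rewrite scaler0 addr0.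
  have ext n m v : (n <= m)%N -> (forall i, (n <= i)%N -> v i = 0 :> treemod act) ->
      \sum_(i < n) v i = \sum_(i < m) v i.
    move=> nm z; rewrite -!(big_mkord xpredT v) (big_cat_nat _ nm)//=.
    rewrite [X in _ = _ + X]big_nat_cond [X in _ = _ + X]big1 ?addr0// => i.
    by case/andP=> /andP[ni _] _; apply: z.
  rewrite (ext _ _ _ (leq_maxl n1 n2) z1) (ext _ _ _ (leq_maxr n1 n2) z2).
  by rewrite scaler_sumr -big_split.
- exists (degree T).+1, (fun i => if i == degree T then tc T else 0); split=> [i|].
    by case: eqP => [->|_]; [apply: span_gen; exists T | exact: span0].
  split=> [i|]; first by case: eqP => // ->; rewrite ltnn.
  rewrite (bigD1 ord_max)//= eqxx big1 ?addr0// => i.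
  by rewrite -val_eqE/= => /negbTE ->.
Qed.

(** The operator [recover] only uses the cocycle, and multiplies by m + 1 in
    degree m. *)
Lemma tree_cocycle_inj (u : treemod act) : (forall f, tree_cocycle u f = 0) -> u = 0.
Proof.
move=> c0; have [n [v [dv [_ uE]]]] := tree_decomposition u.
have r0 : recover x a pair u = 0.
  by rewrite /recover /cocycle_tree big1// => i _; rewrite c0 (bil0r joinB).
rewrite uE big1// => i _.
have /(_ i) /eqP : forall i : 'I_n, i.+1%:R *: v i = 0.
  apply: (tree_deg_indep (u := fun i : 'I_n => i.+1%:R *: v i)).
    by move=> j; apply/spanZ/dv.
  rewrite -[RHS]r0 uE (lin_sum (recover_linear data)); apply: eq_bigr => j _.
  by rewrite (recover_deg data (dv j)).
by rewrite scaler_eq0 Num.Theory.pnatr_eq0 => /eqP.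
Qed.

Lemma bracket_alternating (u : treemod act) : bracket u u = 0.
Proof.
apply: tree_cocycle_inj => f.
by rewrite (tree_cocycle_bracket data) lbrxx !subrr.
Qed.

Lemma bracket_jacobi (u v w : treemod act) :
  bracket u (bracket v w) + bracket v (bracket w u) + bracket w (bracket u v) = 0.
Proof.
apply: tree_cocycle_inj => f.
exact: (cocycle_jacobi (tree_cocycle_linear data f) (tree_derP data)
  (fun u0 v0 => tree_cocycle_bracket data u0 v0 f) tree_der_bracket).
Qed.

Theorem bracket_graded_lie : is_graded_lie bracket (tree_deg act).
Proof.
split.
- by split=> [v|u]; [exact: (bracket_linearl data) | exact: (bracket_linearr data)].
- exact: bracket_alternating.
- exact: bracket_jacobi.
- by move=> n u; apply: spanS.
- apply/seteqP; split=> // u _.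
  move: u; apply: treemod_ind => [|c u v su sv|T]; first exact: span0.
    exact: (spanD (spanZ c su) sv).
  by apply: span_gen; exists (degree T) => //; apply: span_gen; exists T.
- exact: tree_deg_indep.
- exact: bracket_deg.
Qed.

Definition tree_pair (u : treemod act) : (F -> L) * (L -> L) :=
  (tree_cocycle u, tree_der u).

Lemma tree_pair_linear : linear tree_pair.
Proof.
move=> c u v; apply/pair_equal_spec; split; apply/funext => z.
  exact: (tree_cocycle_linear data).
exact: (tree_der_linearl data).
Qed.

Let special_span : set ((F -> L) * (L -> L)) :=
  [set d | exists2 m, (0 < m)%N & is_special act zeta m d]%classic.

Lemma tree_pair_span u : tree_pair u \in in_span special_span.
Proof.
apply/asboolP; move: u; apply: treemod_ind => [|c u v su sv|T].
- by rewrite (lin0 tree_pair_linear); apply: span0.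
- by rewrite tree_pair_linear; apply: spanD => //; apply: spanZ.
apply: span_gen; exists (degree T) => //.
by apply: (tree_special data); apply: span_gen; exists T.
Qed.

Definition tree_SDer (u : treemod act) : SDer act zeta :=
  exist _ (tree_pair u) (tree_pair_span u).

Lemma tree_SDer_linear : linear tree_SDer.
Proof. by move=> c u v; apply/val_inj/tree_pair_linear. Qed.

Lemma tree_SDer_inj : injective tree_SDer.
Proof.
move=> u v e; have cE : tree_cocycle u = tree_cocycle v.
  exact: (congr1 (fun d : SDer act zeta => (val d).1) e).
apply/eqP; rewrite -subr_eq0; apply/eqP; apply: tree_cocycle_inj => f; have lc := tree_cocycle_linear data f.
by rewrite (linB lc) cE subrr.
Qed.

Lemma tree_pair_surj d : span special_span d -> exists u, tree_pair u = d.
Proof.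
elim=> [|c d1 d2 [m m0 hd] _ [v <-]].
  by exists 0; rewrite (lin0 tree_pair_linear).
have [u _ [uc ud]] := special_surj data m0 hd.
exists (c *: u + v); rewrite tree_pair_linear; congr (_ *: _ + _).
by rewrite [d1]surjective_pairing; apply/pair_equal_spec; split; apply/funext.
Qed.

Lemma tree_SDer_bij : bijective tree_SDer.
Proof.
have ex (d : SDer act zeta) : exists u, tree_SDer u = d.
  have /asboolP sd := valP d; have [u uE] := tree_pair_surj sd.
  by exists u; apply/val_inj.
pose inv d := projT1 (cid (ex d)); have invK d := projT2 (cid (ex d)).
by exists inv => [u|d]; [apply: tree_SDer_inj; apply: invK | apply: invK].
Qed.

Theorem special_derivations_trees :
  exists phi : {linear treemod act -> SDer act zeta},
    [/\ bijective phi,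
        forall m u, (0 < m)%N -> tree_deg act m u <-> SDer_deg m (phi u) &
        forall u v, SDer_val (phi (bracket u v)) =
          der_br (SDer_val (phi u)) (SDer_val (phi v))].
Proof.
pose phi : {linear treemod act -> SDer act zeta} := HB.pack tree_SDer
  (GRing.isLinear.Build rat (treemod act) (SDer act zeta) _ _ tree_SDer_linear).
exists phi; split; first exact: tree_SDer_bij.
- move=> m u m0; split; first exact: (tree_special data).
  move=> hs; have [v dv [vc vd]] := special_surj data m0 hs.
  suff -> : u = v by [].
  apply/tree_SDer_inj/val_inj; rewrite [val (phi u)]surjective_pairing.
  by apply/pair_equal_spec; split; apply/funext => z; [exact/esym/vc|exact/esym/vd].
move=> u v; apply/pair_equal_spec; split; apply/funext => z.
  by rewrite (tree_cocycle_bracket data) lie_brS.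
exact: tree_der_bracket.
Qed.

End Isomorphism.
(** * The intersection data of a handlebody *)

Section GeneratedSubgroup.
Context (G : groupType) (I : Type) (b : I -> G).

Inductive generated : G -> Prop :=
| generated1 : generated 1%g
| generatedM i f : generated f -> generated (b i * f)%g
| generatedV i f : generated f -> generated ((b i)^-1 * f)%g.

Definition generated_pred : {pred G} := fun f => `[< generated f >].

Lemma generated_mul f h : generated f -> generated h -> generated (f * h)%g.
Proof.
move=> gf gh; elim: gf => [|i k _ ih|i k _ ih]; first by rewrite mul1g.
  by rewrite -mulgA; apply: generatedM.
by rewrite -mulgA; apply: generatedV.
Qed.

Lemma generated_inv f : generated f -> generated f^-1%g.
Proof.
elim=> [|i k _ ih|i k _ ih]; first by rewrite invg1; apply: generated1.
  rewrite invgM; apply: generated_mul => //; rewrite -[_^-1%g]mulg1.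
  exact/generatedV/generated1.
rewrite invgM invgK; apply: generated_mul => //; rewrite -[b i]mulg1.
exact/generatedM/generated1.
Qed.

Lemma generated_closed : group_closed generated_pred.
Proof.
split=> [|f h /asboolP gf /asboolP gh]; apply/asboolP; first exact: generated1.
exact/generated_mul/generated_inv.
Qed.

Definition generated_group : Type := {f : G | generated_pred f}.
HB.instance Definition _ := SubChoice.on generated_group.
HB.instance Definition _ :=
  SubChoice_isSubGroup.Build G generated_pred generated_group generated_closed.

(** The retraction of a free group on the subgroup generated by its basis is the
    identity, since it is so on the basis. *)
Lemma free_basis_generated f : is_free_basis b -> generated f.
Proof.
move=> hb.
have gb i : generated_pred (b i).
  by apply/asboolP; rewrite -[b i]mulg1; apply/generatedM/generated1.
have [h hbi _] := hb generated_group (fun i => exist _ (b i) (gb i)).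
have [k _ kU] := hb G b.
pose r : {multiplicative G -> G} := val \o h.
have rE : r f = f.
  rewrite (kU r) => [|i]; last by rewrite /r /= hbi.
  by rewrite -(kU idfun).
by rewrite -rE; apply/asboolP/(valP (h f)).
Qed.

End GeneratedSubgroup.

Section Handlebody.
Context (g : nat) (P F : groupType) (varpi : {multiplicative P -> F}).
Context (alpha beta : 'I_g -> P).
Notation x := (fun i => varpi (beta i)).
Notation a := (fun i => ab_class varpi (alpha i)).
Notation zeta := (ab_class varpi (boundary_class alpha beta)).
Notation act := (ab_act varpi).
Hypothesis sys : is_meridian_parallel_system varpi alpha beta.

Lemma varpi1 : varpi 1%g = 1%g.
Proof. by apply: (@mulgI _ (varpi 1%g)); rewrite -gmulfM !mulg1. Qed.

Lemma varpiV y : varpi y^-1%g = (varpi y)^-1%g.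
Proof. by apply: (@mulgI _ (varpi y)); rewrite -gmulfM !mulgV varpi1. Qed.

Lemma kernelJ y k : varpi k = 1%g -> varpi (y * k * y^-1)%g = 1%g.
Proof. by move=> k1; rewrite !gmulfM k1 mulg1 varpiV mulgV. Qed.

Lemma kernelV k : varpi k = 1%g -> varpi k^-1%g = 1%g.
Proof. by move=> k1; rewrite varpiV k1 invg1. Qed.

Lemma ab_class1 : ab_class varpi 1%g = 0.
Proof.
have w1 : varpi 1%g = 1%g by exact: varpi1.
have /eqP := ab_classM w1 w1; rewrite mulg1 -subr_eq0 opprD addNKr oppr_eq0.
by move=> /eqP.
Qed.

Lemma ab_classV k : varpi k = 1%g -> ab_class varpi k^-1%g = - ab_class varpi k.
Proof.
move=> k1; apply/eqP; rewrite -addr_eq0 -ab_classM ?mulVg ?ab_class1//.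
exact: kernelV.
Qed.

Lemma ab_conj_linear y : linear (@ab_conj _ _ varpi y).
Proof.
apply: (quot_ext_linear (linext_linear _)) => _ [k1 [k2 [k3 [e ->]]]].
have wk (k : kernel varpi) : varpi (y * val k * y^-1)%g = 1%g.
  exact/kernelJ/eqP/(valP k).
rewrite (linB (linext_linear _)) (linD (linext_linear _)) !linextU e.
by rewrite -ab_classM ?wk// !mulgA mulgVK subrr.
Qed.

Lemma ab_act_linear f : linear (act f).
Proof. exact: ab_conj_linear. Qed.

Lemma ab_ind (Q : AbQ varpi -> Prop) :
    Q 0 -> (forall c u v, Q u -> Q v -> Q (c *: u + v)) ->
    (forall k, varpi k = 1%g -> Q (ab_class varpi k)) -> forall u, Q u.
Proof.
move=> Q0 QL Qk u; rewrite -(repK u).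
have lc := @cls_is_linear _ (@ab_rel _ _ varpi).
elim/freemod_ind: (rep u) => [|c k v Qv]; first by rewrite (lin0 lc).
rewrite lc; apply: QL => //; rewrite -ab_classE; apply: Qk.
exact/eqP/(valP k).
Qed.

Lemma varpi_generated f : generated x f.
Proof. exact/free_basis_generated/(system_parallels sys). Qed.

(** The image of [varpi] contains the basis of [F]. *)
Lemma varpi_surj f : exists y, varpi y = f.
Proof.
elim: (varpi_generated f) => [|i h _ [y <-]|i h _ [y <-]].
- by exists 1%g; apply: varpi1.
- by exists (beta i * y)%g; rewrite gmulfM.
by exists ((beta i)^-1 * y)%g; rewrite gmulfM varpiV.
Qed.

Lemma ab_action : is_action act.
Proof.
have la := ab_act_linear; split=> // [u|f h u].
  elim/ab_ind: u => [|c u v eu ev|k k1]; first exact: (lin0 (la _)).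
    by rewrite la eu ev.
  by rewrite -varpi1 ab_act_class// mul1g invg1 mulg1.
have [[y <-] [z <-]] := (varpi_surj f, varpi_surj h).
elim/ab_ind: u => [|c u v eu ev|k k1]; first by rewrite !(lin0 (la _)).
  by rewrite !la eu ev.
rewrite -gmulfM !ab_act_class// ?kernelJ//.
by rewrite invgM !mulgA.
Qed.

(** The kernel is the normal closure of the meridians, and conjugation in the kernel
    is the action of [F] on its classes. *)
Lemma ab_generated u : span (fun u => exists f i, u = act f (a i)) u.
Proof.
have la := ab_act_linear.
set S := fun u => _; have Sact f v : span S v -> span S (act f v).
  apply: span_image; first exact: la.
  move=> _ [h [i ->]]; apply: span_gen; exists (f * h)%g, i.
  by rewrite (actionM ab_action).
elim/ab_ind: u => [|c u v su sv|k /(system_kernel sys) nk]; first exact: span0.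
  exact: (spanD (spanZ c su) sv).
have wk k' : normal_closure (range alpha) k' -> varpi k' = 1%g.
  by move=> /(system_kernel sys).
elim: nk => [_ [i _ <-]||y z /wk y1 sy /wk z1 sz|y /wk y1 sy|y z /wk y1 sy].
- by apply: span_gen; exists 1%g, i; rewrite (action1 ab_action).
- by rewrite ab_class1; apply: span0.
- by rewrite ab_classM//; apply: spanD.
- by rewrite ab_classV//; apply: spanN.
by rewrite -ab_act_class//; apply: Sact.
Qed.

Lemma ab_class_prod (I : Type) (r : seq I) (k : I -> P) :
    (forall i, varpi (k i) = 1%g) ->
  varpi (\prod_(i <- r) k i)%g = 1%g /\
  ab_class varpi (\prod_(i <- r) k i)%g = \sum_(i <- r) ab_class varpi (k i).
Proof.
move=> k1; elim: r => [|i r [p1 pE]].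
  by rewrite !big_nil ab_class1; split=> //; apply: varpi1.
rewrite !big_cons ab_classM// pE; split=> //.
by rewrite gmulfM k1 p1 mulg1.
Qed.

Lemma boundary_zeta : zeta = \sum_i (a i - act (x i)^-1%g (a i)).
Proof.
have wa i : varpi (alpha i) = 1%g.
  by apply/(system_kernel sys)/nclosure_gen; exists i.
have wb i : varpi ((beta i)^-1 * alpha i * beta i)%g = 1%g.
  by have := kernelJ (beta i)^-1%g (wa i); rewrite invgK.
have wc i : varpi ((beta i)^-1 * alpha i * beta i * (alpha i)^-1)%g = 1%g.
  by rewrite gmulfM wb kernelV// mulg1.
have [p1 pE] := ab_class_prod (index_enum 'I_g) wc.
rewrite /boundary_class ab_classV// pE -sumrN; apply: eq_bigr => i _.
rewrite ab_classM ?wb ?kernelV// ab_classV// opprD opprK addrC; congr (_ - _).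
by rewrite -varpiV ab_act_class// invgK.
Qed.

Lemma handlebody_data (pair : freemod F -> AbQ varpi -> freemod F)
    (Psi : AbQ varpi -> AbQ varpi -> fmod F (AbQ varpi)) :
    is_intersection_pairing act x a pair -> is_Psi act a pair Psi ->
  is_intersection_data act x a pair Psi zeta.
Proof.
move=> hp hP; split=> //.
- exact: ab_action.
- by move=> Q Q1 QM QV f; elim: (varpi_generated f) => // i h _; [apply: QM|apply: QV].
- exact: ab_generated.
exact: boundary_zeta.
Qed.

End Handlebody.

Theorem theorem1p6 (g : nat) (P F : groupType) (varpi : {multiplicative P -> F})
    (alpha beta : 'I_g -> P)
    (x := fun i => varpi (beta i)) (a := fun i => ab_class varpi (alpha i))
    (zeta := ab_class varpi (boundary_class alpha beta))
    (pair : freemod F -> AbQ varpi -> freemod F)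
    (Psi : AbQ varpi -> AbQ varpi -> fmod F (AbQ varpi)) :
  (0 < g)%N ->
  is_meridian_parallel_system varpi alpha beta ->
  is_intersection_pairing (ab_act varpi) x a pair ->
  is_Psi (ab_act varpi) a pair Psi ->
  exists br : treemod (ab_act varpi) -> treemod (ab_act varpi) -> treemod (ab_act varpi),
    [/\ is_graded_lie br (tree_deg (ab_act varpi)),
        forall D E : tree F (AbQ varpi),
          br (tree_class (ab_act varpi) D) (tree_class (ab_act varpi) E) =
          tree_br (ab_act varpi) (Theta pair) Psi D E &
        exists phi : {linear (treemod (ab_act varpi)) -> (SDer (ab_act varpi) zeta)},
          [/\ bijective phi,
              forall (m : nat) (u : treemod (ab_act varpi)), (0 < m)%N ->
                tree_deg (ab_act varpi) m u <-> SDer_deg m (phi u) &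
              forall u v : treemod (ab_act varpi),
                SDer_val (phi (br u v)) =
                der_br (SDer_val (phi u)) (SDer_val (phi v))]].
Proof.
move=> _ sys hp hP; have data := handlebody_data sys hp hP.
exists (bracket Psi); split.
- exact: bracket_graded_lie data.
- by move=> D E; rewrite (tree_br_bracket data).
exact: special_derivations_trees data.
Qed.
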